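(* Let $P$ be a finite poset with $n$ elements that is ranked mod $2$, i.e. the lengths of all maximal chains of $P$ have the same parity. Let $\alpha=(\alpha_J)_{J\in\mathcal{J}(P)}$ be any choice of weights: nonzero real numbers, indexed by the upper order ideals $J$ of $P$, such that the sign of $\alpha_J$ depends only on $|J|$. Consider a Wronski polynomial system for the canonical triangulation of the order polytope of $P$ with weight $\alpha$, that is, a system of $n$ equations in the $n$ variables $(t_a)_{a\in P}$ $$\sum_{J\in\mathcal{J}(P)} c_{i,|J|}\,\alpha_J\,t^J=0,\qquad i=1,\dots,n,$$ with real coefficients $c_{i,j}$ ($1\le i\le n$, $0\le j\le n$), and assume the system is generic in the sense that it has exactly $n!\,\mathrm{vol}(O(P))$ solutions in $(\mathbb{C}^\times)^P$, each of multiplicity one. Then the system has at least $\sigma(P)$ real solutions.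
   Context: An upper order ideal of $P$ is a subset $J$ such that $a\in J$ and $a\le b$ imply $b\in J$; $\mathcal{J}(P)$ is the set of upper order ideals and $t^J=\prod_{a\in J}t_a$. The order polytope is $O(P)=\{y\in[0,1]^P\mid y_a\le y_b\text{ whenever }a\le b\}$; its vertices are the characteristic functions of upper order ideals, and $n!\,\mathrm{vol}(O(P))$ is the number of linear extensions of $P$. A linear extension is an order-preserving bijection $\lambda\colon P\to\{1,\dots,n\}$. Fixing one linear extension $\lambda_0$, the sign of $\lambda$ is the sign of the permutation $\lambda\circ\lambda_0^{-1}$. The sign-imbalance $\sigma(P)$ is the absolute value of the difference between the numbers of positive and negative linear extensions (independent of $\lambda_0$). Real solutions are solutions in $(\mathbb{R}^\times)^P$. *)

(* Defs.v *)
From HB Require Import structures.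
From mathcomp Require Import all_boot all_order all_fingroup all_algebra.
From mathcomp Require Import all_classical all_reals all_analysis.
From mathcomp Require Import complex.
(* The notations of mpoly clash with those of mathcomp-analysis. *)
From mathcomp Require Import -(notations) mpoly.

Set Implicit Arguments.
Unset Strict Implicit.
Unset Printing Implicit Defensive.

Import Order.TTheory GRing.Theory Num.Theory.

Local Open Scope ring_scope.
Local Open Scope classical_set_scope.

Section Poset.
Context {d : Order.disp_t} (P : finPOrderType d).
Implicit Types (C J : {set P}) (l : {ffun P -> 'I_#|P|}).

Definition upper_ideal J : bool :=
  [forall a, forall b, (a \in J) && (a <= b)%O ==> (b \in J)].

Definition is_chain C : bool :=
  [forall a, forall b, (a \in C) && (b \in C) ==> (a >=< b)%O].

Definition maximal_chain C : bool := maxset is_chain C.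

Definition chain_length C : nat := #|C|.-1.

Definition ranked_mod2 : Prop :=
  forall C D, maximal_chain C -> maximal_chain D ->
    odd (chain_length C) = odd (chain_length D).

(* Values are shifted by one: {0, ..., n-1} instead of {1, ..., n}. An
   injection between these sets of equal cardinality is a bijection. *)
Definition linear_extension l : bool :=
  injectiveb l && [forall a, forall b, (a <= b)%O ==> (l a <= l b)%N].

(* [extension_sign l0 l b]: the permutation s = l \o l0^-1 of 'I_n, written as
   s \o l0 = l, has parity b (b = true means odd, i.e. negative sign). *)
Definition extension_sign l0 l (b : bool) : bool :=
  [exists s : 'S_#|P|, [forall a, s (l0 a) == l a] && (odd_perm s == b)].

Definition signed_extensions l0 (b : bool) : nat :=
  #|[pred l | linear_extension l && extension_sign l0 l b]|.

Definition sign_imbalance_wrt l0 : nat :=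
  `|(signed_extensions l0 false)%:Z - (signed_extensions l0 true)%:Z|%N.

Lemma linear_extension_exists : exists l, linear_extension l.
Proof.
pose down (a : P) := #|[pred b | (b <= a)%O]|.
pose r := [rel a b | (down a <= down b)%N].
pose s := sort r (enum P).
have r_total : total r by move=> a b; exact: leq_total.
have r_trans : transitive r by move=> b a c; exact: leq_trans.
have sP a : a \in s by rewrite mem_sort mem_enum.
have s_size : size s = #|P| by rewrite size_sort -cardE.
have idxP a : (index a s < #|P|)%N by rewrite -s_size index_mem sP.
pose l := [ffun a => Ordinal (idxP a)].
have l_inj : injective l.
  move=> a b; rewrite !ffunE => /(congr1 val) /= eq_ab.
  by rewrite -(nth_index a (sP a)) eq_ab nth_index.
exists l; apply/andP; split; first exact/injectiveP.
apply/forallP => a; apply/forallP => b; apply/implyP => le_ab.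
case: (eqVneq a b) => [->|ne_ab]; first exact: leqnn.
have lt_ab : (a < b)%O by rewrite lt_neqAle ne_ab.
rewrite leqNgt; apply/negP; rewrite !ffunE /= => lt_idx.
have := sort_sorted r_total (enum P).
move=> /(sorted_ltn_nth r_trans a) /(_ (index b s) (index a s)).
rewrite !inE s_size !idxP => /(_ isT isT lt_idx).
rewrite !nth_index // /r /= leqNgt => /negP; apply.
apply: proper_card; apply/properP; split.
  by apply/fintype.subsetP => c; rewrite !inE => /le_trans; apply.
by exists b; rewrite !inE ?lexx ?lt_geF.
Qed.

(* By [sign_imbalance_wrtE] below, the choice of l0 is irrelevant. *)
Definition sign_imbalance : nat :=
  sign_imbalance_wrt (xchoose linear_extension_exists).

Lemma linear_extension_perm l0 l1 :
  linear_extension l0 -> linear_extension l1 ->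
  exists s : 'S_#|P|, forall a, s (l0 a) = l1 a.
Proof.
move=> /andP[/injectiveP i0 _] /andP[/injectiveP i1 _].
have [g gK Kg] : bijective l0 by apply: inj_card_bij => //; rewrite card_ord.
have sI : injective (l1 \o g) by apply: inj_comp => //; exact: can_inj Kg.
by exists (perm sI) => a; rewrite permE /= gK.
Qed.

Lemma sign_imbalance_wrt_irr l0 l1 :
  linear_extension l0 -> linear_extension l1 ->
  sign_imbalance_wrt l0 = sign_imbalance_wrt l1.
Proof.
move=> L0 L1; have [s ss] := linear_extension_perm L0 L1.
have E b : signed_extensions l0 b = signed_extensions l1 (odd_perm s (+) b).
  apply: eq_card => l; rewrite !inE; congr (_ && _); apply/existsP/existsP.
    move=> [u /andP[/forallP Hu /eqP ub]]; exists (s^-1 * u)%g.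
    rewrite odd_permM odd_permV ub eqxx andbT; apply/forallP => a.
    by rewrite permM -ss permK.
  move=> [u /andP[/forallP Hu /eqP ub]]; exists (s * u)%g.
  rewrite odd_permM ub addKb eqxx andbT; apply/forallP => a.
  by rewrite permM ss.
rewrite /sign_imbalance_wrt !E addbF addbT.
by case: (odd_perm s) => //=; rewrite distnC.
Qed.

Lemma sign_imbalance_wrtE l0 :
  linear_extension l0 -> sign_imbalance_wrt l0 = sign_imbalance.
Proof. by move=> L0; apply: sign_imbalance_wrt_irr => //; exact: xchooseP. Qed.

End Poset.

Section Volume.
Variable R : realType.

(* The product of n copies of the Lebesgue measure on R, by iterating
   (mu \x nu) A = \int[mu]_x nu (xsection A x). *)
Fixpoint volume (n : nat) : set (n.-tuple R) -> \bar R :=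
  match n with
  | 0 => fun A => dirac [tuple] A
  | m.+1 => fun A =>
      (\int[lebesgue_measure]_x
         volume [set v : m.-tuple R | A [tuple of x :: v]])%E
  end.

Definition order_polytope {d} (P : finPOrderType d) : set (P -> R) :=
  [set y | (forall a, 0 <= y a <= 1) /\
           (forall a b, (a <= b)%O -> y a <= y b)].

Definition order_polytope_volume {d} (P : finPOrderType d) : \bar R :=
  volume [set v : #|P|.-tuple R |
            order_polytope (fun a : P => tnth v (enum_rank a))].

End Volume.

Section Multiplicity.
Context {K : fieldType} {m n : nat} (F : 'I_m -> mpoly n K).

Definition in_ideal (g : mpoly n K) : Prop :=
  exists h : 'I_m -> mpoly n K, g = \sum_i h i * F i.

(* The contraction to K[X] of the ideal generated by F in the local ring of
   K^n at p. *)
Definition in_local_ideal (p : 'I_n -> K) (g : mpoly n K) : Prop :=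
  exists2 u : mpoly n K, meval p u != 0 & in_ideal (u * g).

(* The dimension over K of the local ring at p modulo F is k. The basis b is
   taken in K[X]: elements of K[X] not vanishing at p are non-zero-divisors
   modulo [in_local_ideal p], hence invertible as soon as that quotient has
   finite dimension, and so the quotient is the whole local ring modulo F. *)
Definition has_multiplicity (p : 'I_n -> K) (k : nat) : Prop :=
  exists b : 'I_k -> mpoly n K, forall g : mpoly n K,
    exists! a : 'rV[K]_k, in_local_ideal p (g - \sum_j a 0 j *: b j).

End Multiplicity.

Section Wronski.
Context {d : Order.disp_t} {P : finPOrderType d}.

(* The variable t_a is the indeterminate of index [enum_rank a]. *)
Definition coords {K : fieldType} (t : {ffun P -> K}) : 'I_#|P| -> K :=
  fun i => t (enum_val i).

Definition torus_zeros {K : fieldType} {m : nat}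
    (F : 'I_m -> mpoly #|P| K) : set {ffun P -> K} :=
  [set t : {ffun P -> K} | (forall a, t a != 0) /\
                           (forall i, meval (coords t) (F i) = 0)].

Context {R : realType}.

Definition is_weight (alpha : {set P} -> R) : Prop :=
  (forall J, upper_ideal J -> alpha J != 0) /\
  (forall I J, upper_ideal I -> upper_ideal J -> #|I| = #|J| ->
     Num.sg (alpha I) = Num.sg (alpha J)).

Definition wronski_system (alpha : {set P} -> R) (c : 'M[R]_(#|P|, #|P|.+1))
    (i : 'I_#|P|) : mpoly #|P| R :=
  \sum_(J : {set P} | upper_ideal J)
    (c i (inord #|J|) * alpha J) *: \prod_(a in J) mpolyX R (mnm1 (enum_rank a)).

Definition complexify {m n : nat} (F : 'I_m -> mpoly n R) :
    'I_m -> mpoly n R[i] :=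
  fun i => map_mpoly (real_complex R) (F i).

End Wronski.

(* Main.v *)
Require Import Defs.
From HB Require Import structures.
From mathcomp Require Import all_boot all_order all_fingroup all_algebra.
From mathcomp Require Import all_classical all_reals all_analysis measurable_realfun.
From mathcomp Require Import complex.
From mathcomp Require Import -(notations) mpoly.
From mathcomp Require Import zify ring lra.
Set Implicit Arguments.
Unset Strict Implicit.
Unset Printing Implicit Defensive.

Import Order.TTheory GRing.Theory Num.Theory.
Import numFieldNormedType.Exports.

Local Open Scope ring_scope.

(** Let W_j(t) be the sum of alpha_J t^J over the upper ideals J of size j. Up to
    scaling, the system says that W_j(t) = v_j for j = 1, ..., n with a fixed real
    vector v, and its n! vol(O(P)) = e(P) solutions are counted by the linear
    extensions of P.

    For a labelling w of P, the monomials of (P,w)-partitions span a module over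
    the ring generated by W_1, ..., W_n which is generated by the e(P) descent
    monomials. Let omega be the module of strict P-partitions. As P is ranked
    mod 2, the set S of the elements of odd height contains the minimal elements
    and exactly one end of every cover relation; let M be the module for which
    the covers from S to its complement are strict and the other ones weak. Then
    (f, g) |-> f g / prod_(a notin S) t_a maps M x M to omega / t_P, and composing with the
    coordinate on the descent monomial of highest degree gives a symmetric form
    on M, a residue pairing. Its Gram matrix in the descent monomials is a
    weighted homogeneous function of v whose determinant has degree 0, so it
    degenerates to a nonsingular matrix at v = 0, and its signature does not
    depend on v.

    At the given v the form is a combination of products x(t) y(t) over the
    solutions t, and a pair of complex conjugate solutions contributes 0 to the
    signature; hence the number of real solutions is at least the absolute value
    of the signature. When the v_j have the signs of the alpha_J and are widely
    spaced, there is one positive solution near each linear extension, it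
    contributes the sign of that extension up to a common factor, and the
    signature is, up to sign, sigma(P). *)

(** * P-partitions and linear extensions *)

Section Labellings.
Context {d : Order.disp_t} {P : finPOrderType d}.
Implicit Types (m w k : P -> nat) (I J : {set P}).

(** Solutions cannot be followed from one v to another: they may collide or leave the torus, and at
    v = 0 the torus contains none, since W_n is a multiple of t_P. What is compared instead is the
    Gram matrix, whose entries are functions of v alone. Straightening yields coefficients valid at
    every point, over every extension field, with the prescribed W_j, so one matrix serves the real
    and the complex solutions. Freeness of the modules is never proved; it suffices that the descent
    monomials form an invertible matrix at e(P) distinct solutions. Nonsingularity at v = 0 is
    imported from the widely spaced v through the determinant.

    Ranked mod 2 enters twice through S: it makes the quotients f g / prod_(a notin S) t_a strict,
    and it balances the degrees of the descent monomials. Equal signs of the weights on ideals of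
    equal size let positive solutions for |alpha| serve for alpha. Simplicity of the solutions
    forces the coefficient matrix to have rank n; their number is pinned to e(P) from above by
    independence of the points and from below by the volume. *)

Definition linext := {l : {ffun P -> 'I_#|P|} | linear_extension l}.

Definition lval (l : linext) : P -> nat := fun x => val l x.

Definition shift m I : P -> nat := fun x => (m x + (x \in I))%N.

Definition mdeg m : nat := (\sum_x m x)%N.

(** For labels below [W], one number that orders the elements lexicographically by the pair (m x, w
    x). *)
Definition key (W : nat) w m : P -> nat := fun x => (W * m x + w x)%N.

(* When [w] is an injective labelling with values below [W], this says that [m]
   is a P-partition for [w]: m x <= m y whenever x < y, strictly so if
   moreover w x > w y. *)
Definition wpart (W : nat) w m : Prop :=
  forall x y, (x < y)%O -> (key W w m x < key W w m y)%N.

(* Exponents of the Garsia-Stanton descent monomial of [l] for the labelling [w]. *)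
Definition delta w (l : linext) : P -> nat := fun x =>
  (\sum_(y | lval l y <= lval l x) \sum_(z | (lval l z).+1 == lval l y)
      (w y < w z))%N.

Lemma lval_inj l : injective (lval l).
Proof.
move=> x y e; have {e} := val_inj (e : val (val l x) = val (val l y)).
by have /andP[/injectiveP li _] := valP l; exact: li.
Qed.

Lemma lval_lt l x : (lval l x < #|P|)%N.
Proof. exact: ltn_ord. Qed.

Lemma lval_mono l x y : (x < y)%O -> (lval l x < lval l y)%N.
Proof.
move=> xy; rewrite ltn_neqAle; apply/andP; split.
  by apply: contraTneq xy => /lval_inj ->; rewrite ltxx.
have /andP[_ /forallP/(_ x)/forallP/(_ y)/implyP] := valP l.
by apply; exact: ltW.
Qed.

Lemma lval_surj l i : (i < #|P|)%N -> exists x, lval l x = i.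
Proof.
move=> iP; have li : injective (val l) by move=> x y e; apply: (@lval_inj l); rewrite /lval e.
have [g gK Kg] : bijective (val l) by apply: inj_card_bij => //; rewrite card_ord.
by exists (g (Ordinal iP)); rewrite /lval Kg.
Qed.

Lemma sum_lval (F : nat -> nat) l : (\sum_x F (lval l x) = \sum_(i < #|P|) F i)%N.
Proof.
have li : injective (val l) by move=> x y e; apply: (@lval_inj l); rewrite /lval e.
have [g gK Kg] : bijective (val l) by apply: inj_card_bij => //; rewrite card_ord.
by rewrite (reindex (val l)) //; exists g => x _.
Qed.

Lemma rankext k : injective k -> (forall x y, (x < y)%O -> (k x < k y)%N) ->
  exists l : linext, forall x y, (lval l x < lval l y)%N = (k x < k y)%N.
Proof.
move=> ki km.
pose r x := #|[pred y | (k y < k x)%N]|.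
have rlt x y : (k x < k y)%N -> (r x < r y)%N.
  move=> kxy; apply: proper_card; apply/properP; split.
    by apply/fintype.subsetP => z; rewrite !inE => /ltn_trans; apply.
  by exists x; rewrite !inE ?ltnn.
have rP x : (r x < #|P|)%N.
  by apply: (@proper_card _ [pred y | (k y < k x)%N] predT); apply/properP; split;
    [apply/fintype.subsetP | exists x; rewrite !inE ?ltnn].
move: r rlt rP => r rlt rP.
have rE x y : (r x < r y)%N = (k x < k y)%N.
  apply/idP/idP; last exact: rlt.
  apply: contraTT; rewrite -!leqNgt leq_eqVlt => /orP[/eqP/ki ->//|/rlt/ltnW//].
have H : linear_extension [ffun x => Ordinal (rP x)].
  apply/andP; split.
    apply/injectiveP => x y; rewrite !ffunE => /(congr1 val) /= rxy; apply: ki.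
    by case: (ltngtP (k x) (k y)) => // /rlt; rewrite rxy ltnn.
  apply/forallP => x; apply/forallP => y; apply/implyP.
  rewrite le_eqVlt !ffunE /= => /orP[/eqP -> //|xy]; apply/ltnW.
  by rewrite (rE x y) km.
by exists (exist (fun l => is_true (linear_extension l)) _ H) => x y; rewrite /lval /= !ffunE /= (rE x y).
Qed.

Lemma delta0 w l x : lval l x = 0%N -> delta w l x = 0%N.
Proof.
move=> lx; rewrite /delta big1 // => y; rewrite lx leqn0 => /eqP ->.
by rewrite big1.
Qed.

Lemma deltaS w l x y : (lval l y).+1 = lval l x ->
  delta w l x = (delta w l y + (w x < w y))%N.
Proof.
move=> lyx; rewrite /delta (bigD1 x) //= addnC; congr addn.
  apply: eq_bigl => z; rewrite -lyx leq_eqVlt ltnS.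
  have [->|nzx] := eqVneq z x; first by rewrite andbF -lyx ltnn.
  rewrite andbT; case: eqP => // e; case/eqP: nzx; apply: (@lval_inj l).
  by rewrite e lyx.
rewrite (bigD1 y) ?lyx //= big1 ?addn0 // => z /andP[/eqP zx nzy].
by case/eqP: nzy; apply: (@lval_inj l); apply: succn_inj; rewrite zx lyx.
Qed.

Lemma delta_unique w l m :
  (forall x, lval l x = 0%N -> m x = 0%N) ->
  (forall x y, (lval l y).+1 = lval l x -> m x = (m y + (w x < w y))%N) ->
  m =1 delta w l.
Proof.
move=> m0 mS x; case: (ubnP (lval l x)) => i; elim: i x => // i IH x.
case E: (lval l x) => [|j]; first by rewrite m0 ?delta0.
have [y ly] : exists y, lval l y = j.
  by apply: lval_surj; apply: leq_trans (lval_lt l x); rewrite E.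
move=> ii; have lyx : (lval l y).+1 = lval l x by rewrite ly E.
by rewrite (mS _ _ lyx) (deltaS _ lyx) IH // ly.
Qed.

Lemma key_shift W w m I x : key W w (shift m I) x = (key W w m x + W * (x \in I))%N.
Proof. by rewrite /key /shift mulnDr addnAC. Qed.

Lemma wpart_shift W w m I : wpart W w m -> upper_ideal I -> wpart W w (shift m I).
Proof.
move=> mw /forallP IP x y xy; rewrite !key_shift.
have := mw x y xy; case xI: (x \in I) => /=; last by rewrite muln0 addn0; lia.
have /forallP/(_ y)/implyP := IP x; rewrite xI (ltW xy) => -> //; lia.
Qed.

Lemma mdeg_shift m I : mdeg (shift m I) = (mdeg m + #|I|)%N.
Proof. by rewrite /mdeg /shift big_split /= -big_mkcond sum1_card. Qed.

(** Once the common part is cancelled, equally many elements remain on both sides: those of I above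
    the threshold c, those of J not above it. *)
Lemma exchange_lt k I J (c : nat) :
  #|I| = #|J| -> I != J -> (forall x, x \in I -> (c < k x)%N) ->
  (forall y, y \notin I -> (k y <= c)%N) ->
  (\sum_(x in J) k x < \sum_(x in I) k x)%N.
Proof.
move=> cIJ nIJ kI kJ.
rewrite (bigID (mem I) _ k) /= [ltnRHS](bigID (mem J) _ k) /=.
rewrite (eq_bigl (fun i => (i \in I) && (i \in J))); last by move=> i; rewrite andbC.
rewrite ltn_add2l.
rewrite (eq_bigl (mem (J :\: I))); last by move=> i; rewrite !inE andbC.
rewrite [ltnRHS](eq_bigl (mem (I :\: J))); last by move=> i; rewrite !inE andbC.
have cD : #|J :\: I| = #|I :\: J|.
  have := cardsID I J; have := cardsID J I; rewrite finset.setIC; lia.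
have Dpos : (0 < #|I :\: J|)%N.
  rewrite lt0n cards_eq0 finset.setD_eq0; apply: contra nIJ => IJ.
  by rewrite eqEcard IJ cIJ leqnn.
apply: (@leq_ltn_trans (#|J :\: I| * c)).
  by rewrite -sum_nat_const leq_sum // => y; rewrite !inE => /andP[/kJ].
apply: (@leq_trans (#|I :\: J| * c.+1)).
  by rewrite cD ltn_pmul2l.
by rewrite -sum_nat_const leq_sum // => y; rewrite !inE => /andP[_ /kI].
Qed.

Lemma exchange_top k I J : #|I| = #|J| -> I != J ->
  (forall x y, x \in I -> y \notin I -> (k y < k x)%N) ->
  (\sum_(x in J) k x < \sum_(x in I) k x)%N.
Proof.
move=> cIJ nIJ kIJ.
case: (set_0Vmem (~: I)) => [I0|[z zI]].
  have IT : I = [set: P] by rewrite -(finset.setCK I) I0 finset.setC0.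
  case/eqP: nIJ; apply/esym/eqP; rewrite eqEcard cIJ leqnn andbT.
  by rewrite IT finset.subsetT.
apply: (@exchange_lt _ _ _ (\max_(y | y \notin I) k y)) => // [x xI|y yI].
  have kx : (0 < k x)%N by apply: leq_ltn_trans (kIJ x z xI _); rewrite // -finset.in_setC.
  rewrite -(prednK kx) ltnS; apply/bigmax_leqP => y yI.
  by rewrite -ltnS prednK // kIJ.
exact: (@leq_bigmax_cond _ (fun y => y \notin I) k y).
Qed.

End Labellings.

(** * Straightening modulo the Wronski polynomials *)

Section Spanning.
Context {d : Order.disp_t} {P : finPOrderType d}.
Implicit Types (m w k : P -> nat) (I J : {set P}).

Lemma key_inj W w m : injective w -> (forall x, (w x < W)%N) -> injective (key W w m).
Proof.
move=> wi wW x y e; apply: wi.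
have := congr1 (fun i => i %% W)%N e.
by rewrite /key ![(W * _)%N]mulnC !modnMDl !modn_small.
Qed.

(** Sort P by key to get l. If [m] starts at 0 and no gap between consecutive keys exceeds W, [m]
    grows exactly at the descents of l, so it is a descent monomial. Otherwise the elements from a
    large gap on form an ideal I, and lowering [m] by one on I keeps the order of the keys. *)
Lemma wpart_decomp W w m : injective w -> (forall x, (w x < W)%N) -> wpart W w m ->
  (exists l : linext, m = delta w l) \/
  exists I m', [/\ upper_ideal I, (0 < #|I|)%N, m = shift m' I, wpart W w m' &
     forall x y, x \in I -> y \notin I -> (key W w m' y < key W w m' x)%N].
Proof.
move=> wi wW mw; have ki := key_inj (m := m) wi wW.
have [l lE] := rankext ki mw.
pose bad a := (lval l a = 0%N /\ (0 < m a)%N) \/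
   exists2 b, (lval l b).+1 = lval l a & (key W w m b + W < key W w m a)%N.
have [[a bada]|nbad] := pselect (exists a, bad a); last first.
  left; exists l; apply/funext; apply: delta_unique => [x lx|x y lyx].
    by apply/eqP; rewrite -leqn0 leqNgt; apply/negP => mx; apply: nbad; exists x; left.
  have h1 : (key W w m y < key W w m x)%N by rewrite -lE -lyx.
  have h2 : (key W w m x <= key W w m y + W)%N.
    by rewrite leqNgt; apply/negP => h; apply: nbad; exists x; right; exists y.
  have := wW x; have := wW y; move: h1 h2; rewrite /key.
  case: (ltnP (w x) (w y)) => /= wxy h1 h2 wy wx.
    have : (m y < m x)%N by rewrite -(ltn_pmul2l (leq_ltn_trans (leq0n _) wx)); lia.
    have : (m x < (m y).+2)%N by rewrite -(ltn_pmul2l (leq_ltn_trans (leq0n _) wx)); lia.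
    lia.
  have : (m y < (m x).+1)%N by rewrite -(ltn_pmul2l (leq_ltn_trans (leq0n _) wx)); lia.
  have : (m x < (m y).+1)%N.
    rewrite -(ltn_pmul2l (leq_ltn_trans (leq0n _) wx)).
    have : w x <> w y by move=> /wi e; move: lyx; rewrite e; lia.
    lia.
  lia.
right; pose I := [set x | (lval l a <= lval l x)%N].
have W0 : (0 < W)%N by apply: leq_ltn_trans (wW a).
have ka x : (lval l a <= lval l x)%N -> (key W w m a <= key W w m x)%N.
  by move=> ax; rewrite leqNgt -lE -leqNgt.
have IW x : x \in I -> (0 < m x)%N.
  rewrite inE => /ka; have Ha : (W <= key W w m a)%N.
    case: bada => [[_ ma]|[b _]]; last lia.
    by rewrite /key; case: (m a) ma => // i _; rewrite mulnS; lia.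
  move=> /(leq_trans Ha); rewrite /key; have := wW x; case: (m x) => // ; rewrite muln0; lia.
have IC x y : x \in I -> y \notin I -> (key W w m y + W < key W w m x)%N.
  rewrite !inE -ltnNge => /ka ax ya; case: bada => [[a0]|[b ba kb]].
    by move: ya; rewrite a0.
  apply: leq_trans ax; apply: leq_ltn_trans kb; rewrite leq_add2r leqNgt -lE -leqNgt.
  by rewrite -ltnS ba.
pose m' x := (m x - (x \in I))%N.
have mE : m = shift m' I.
  apply/funext => x; rewrite /shift /m' subnK //.
  by case xI: (x \in I) => //=; rewrite IW.
have kE x : key W w m x = (key W w m' x + W * (x \in I))%N by rewrite {1}mE key_shift.
have II : upper_ideal I.
  apply/forallP => x; apply/forallP => y; apply/implyP; rewrite !inE => /andP[ax].
  by rewrite le_eqVlt => /orP[/eqP <- //|/(lval_mono l)/ltnW]; apply: leq_trans.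
exists I, m'; split => // [|x y xy|x y xI yI].
- by apply/card_gt0P; exists a; rewrite inE.
- have := mw _ _ xy; rewrite !kE; case xI: (x \in I).
    have /forallP/(_ x)/forallP/(_ y)/implyP := II; rewrite xI (ltW xy) => -> //; lia.
  case yI: (y \in I) => /=; last lia.
  by have := IC y x yI (negbT xI); rewrite !kE xI yI; lia.
by have := IC x y xI yI; rewrite !kE xI (negbTE yI); lia.
Qed.

(* Multiplying by an upper ideal I raises the potential by the sum over I of the
   keys plus one. Among the ideals of a given size this is largest for the one
   formed by the largest keys, so straightening terminates. *)
Definition potential (W : nat) w m : nat :=
  (\sum_x (W * 'C(m x, 2) + (w x).+1 * m x))%N.

Lemma potential_shift W w m I :
  potential W w (shift m I) = (potential W w m + (\sum_(x in I) key W w m x + #|I|))%N.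
Proof.
rewrite /potential -sum1_card -[X in (_ + X)%N]big_split /=.
rewrite [X in (_ + X)%N]big_mkcond -big_split /=.
apply: eq_bigr => x _; rewrite /shift /key; case: (x \in I); last by rewrite !addn0.
by rewrite -[(m x + true)%N]/(m x + 1)%N !addn1 binS bin1; lia.
Qed.

Context {F : fieldType} (alpha : {set P} -> F).
Hypothesis alpha0 : forall J, upper_ideal J -> alpha J != 0.

Definition monom {K : fieldType} (t : P -> K) m : K := \prod_x t x ^+ m x.

Definition theta {K : fieldType} (f : F -> K) (t : P -> K) (j : nat) : K :=
  \sum_(J : {set P} | upper_ideal J && (#|J| == j)) f (alpha J) * \prod_(a in J) t a.

Lemma monom_shift {K : fieldType} (t : P -> K) m I :
  monom t (shift m I) = monom t m * \prod_(a in I) t a.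
Proof.
rewrite /monom [X in _ * X]big_mkcond -big_split /=; apply: eq_bigr => x _.
by rewrite /shift exprD; case: (x \in I).
Qed.

Lemma theta_monom {K : fieldType} (f : F -> K) (t : P -> K) m j :
  theta f t j * monom t m =
  \sum_(J : {set P} | upper_ideal J && (#|J| == j)) f (alpha J) * monom t (shift m J).
Proof.
rewrite /theta mulr_suml; apply: eq_bigr => J _.
by rewrite monom_shift -mulrA [monom _ _ * _]mulrC.
Qed.

Definition whomog (e : nat) (f : (nat -> F) -> F) : Prop :=
  forall x v, f (fun j => x ^+ j * v j) = x ^+ e * f v.

(** Weighted homogeneity of degree a - b with v_j in weight j. A negative degree forces the zero
    function, as it would for polynomials. *)
Definition graded (a b : nat) (f : (nat -> F) -> F) : Prop :=
  if (b <= a)%N then whomog (a - b) f else forall v, f v = 0.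

(** The coefficients depend on v only, not on the field or on the point: this is what ties real and
    complex solutions together. *)
Definition expansion w m (r : linext -> (nat -> F) -> F) : Prop :=
  (forall l, graded (mdeg m) (mdeg (delta w l)) (r l)) /\
  (forall (K : fieldType) (f : {rmorphism F -> K}) (t : P -> K) (v : nat -> F),
     (forall j, (0 < j <= #|P|)%N -> theta f t j = f (v j)) ->
     monom t m = \sum_(l : linext) f (r l v) * monom t (delta w l)).

Lemma gradedB a b (f g : (nat -> F) -> F) : graded a b f -> graded a b g ->
  graded a b (fun v => f v - g v).
Proof.
rewrite /graded; case: ifP => _ hf hg; last by move=> v; rewrite hf hg subrr.
by move=> x v; rewrite hf hg mulrBr.
Qed.

Lemma graded_scale a b c (f : (nat -> F) -> F) : graded a b f ->
  graded a b (fun v => c * f v).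
Proof.
rewrite /graded; case: ifP => _ hf; last by move=> v; rewrite hf mulr0.
by move=> x v; rewrite hf mulrCA.
Qed.

Lemma graded_sum a b (T : finType) (Q : pred T) (f : T -> (nat -> F) -> F) :
  (forall i, Q i -> graded a b (f i)) -> graded a b (fun v => \sum_(i | Q i) f i v).
Proof.
rewrite /graded; case: ifP => _ hf; last by move=> v; rewrite big1 // => i Qi; rewrite hf.
by move=> x v; rewrite mulr_sumr; apply: eq_bigr => i Qi; rewrite hf.
Qed.

Lemma graded_var a b j (f : (nat -> F) -> F) : graded a b f ->
  graded (a + j) b (fun v => v j * f v).
Proof.
rewrite /graded; case: (leqP b a) => ba hf.
  rewrite (leq_trans ba (leq_addr _ _)) => x v.
  by rewrite hf (addnC a) -addnBA // exprD; ring.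
by case: ifP => _ => [x v|v]; rewrite !hf !mulr0.
Qed.

(** If m = m' + I with I made of the largest keys, multiply t^m' by W_j for j = #|I| and solve for
    the term of I. The other terms, and m' itself, have smaller potential. *)
Lemma expansion_exists W w m : injective w -> (forall x, (w x < W)%N) -> wpart W w m ->
  exists r, expansion w m r.
Proof.
move=> wi wW; case: (ubnP (potential W w m)) => N.
elim: N m => // N IH m mN mw.
case: (wpart_decomp wi wW mw) => [[l0 mE]|[I [m' [II I0 mE mw' Itop]]]].
  exists (fun l _ => (l == l0)%:R); split.
    move=> l; rewrite /graded mE; have [->|_] := eqVneq l l0.
      by rewrite leqnn subnn => x v; rewrite expr0 mul1r.
    by case: ifP => _ x // v; rewrite mulr0.
  move=> K f t v _; rewrite (bigD1 l0) //= eqxx rmorph1 mul1r mE big1 ?addr0 //.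
  by move=> l /negbTE ->; rewrite rmorph0 mul0r.
have Pm' : (potential W w m' < N)%N.
  by move: mN; rewrite mE potential_shift; lia.
have [r' [gr' er']] := IH _ Pm' mw'.
have PJ J : upper_ideal J && (#|J| == #|I|) && (J != I) ->
    exists r, expansion w (shift m' J) r.
  move=> /andP[/andP[IJ /eqP cJ] nJ]; apply: IH; last exact: wpart_shift.
  rewrite -ltnS; apply: leq_trans mN.
  rewrite mE !potential_shift cJ !ltnS ltn_add2l ltn_add2r.
  by apply: exchange_top => //; rewrite eq_sym.
have [r rE] : exists r : {set P} -> linext -> (nat -> F) -> F, forall J,
    upper_ideal J && (#|J| == #|I|) && (J != I) -> expansion w (shift m' J) (r J).
  (* Sets outside the sum receive zero coefficients, so that a single choice covers all J. *)
  have [r rP] := choice (fun J : {set P} =>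
    (match pselect (upper_ideal J && (#|J| == #|I|) && (J != I)) with
     | left H => let: ex_intro r rP := PJ J H in ex_intro _ r (fun _ => rP)
     | right H => ex_intro _ (fun _ _ => 0) (fun H' => False_ind _ (H H'))
     end : exists r, upper_ideal J && (#|J| == #|I|) && (J != I) ->
        expansion w (shift m' J) r)).
  by exists r.
exists (fun l v => (alpha I)^-1 * (v #|I| * r' l v -
   \sum_(J : {set P} | upper_ideal J && (#|J| == #|I|) && (J != I)) alpha J * r J l v)).
split.
  move=> l; apply: graded_scale; apply: gradedB.
    by rewrite mE mdeg_shift; apply: graded_var.
  apply: graded_sum => J HJ; apply: graded_scale; have [+ _] := rE J HJ.
  by rewrite mE !mdeg_shift; move: HJ => /andP[/andP[_ /eqP ->] _].
move=> K f t v tv; have := theta_monom f t m' #|I|.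
rewrite tv ?I0 ?max_card // (bigD1 I) /=; last by rewrite II eqxx.
rewrite -mE (er' K f t v tv) => /eqP; rewrite -subr_eq => /eqP H.
have fI : f (alpha I) != 0 by rewrite fmorph_eq0 alpha0.
apply: (mulfI fI); rewrite -H mulr_sumr.
rewrite (eq_bigr (fun J => \sum_(l : linext) f (alpha J) * (f (r J l v) * monom t (delta w l)))); last first.
  move=> J HJ; have [_ /(_ K f t v tv) ->] := rE J HJ; by rewrite mulr_sumr.
rewrite exchange_big /= mulr_sumr -sumrB; apply: eq_bigr => l _.
rewrite rmorphM fmorphV /= !mulrA mulfV // mul1r rmorphB rmorphM mulrBl.
rewrite rmorph_sum /= mulr_suml; congr (_ - _).
by apply: eq_bigr => J _; rewrite rmorphM mulrA.
Qed.

End Spanning.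

(** * Separation of solutions *)

Section Separation.
Context {d : Order.disp_t} {P : finPOrderType d}.
Context {F : fieldType} (alpha : {set P} -> F).
Hypothesis alpha0 : forall J, upper_ideal J -> alpha J != 0.
Context (W : nat) (w : P -> nat).
Hypothesis (wi : injective w) (wW : forall x, (w x < W)%N).

Lemma key_delta (l : linext) x y : (lval l x < lval l y)%N ->
  (key W w (delta w l) x < key W w (delta w l) y)%N.
Proof.
have step u v : (lval l u).+1 = lval l v ->
    (key W w (delta w l) u < key W w (delta w l) v)%N.
  move=> uv; rewrite /key (deltaS _ uv) mulnDr; have := wW u; have := wW v.
  case: (ltnP (w v) (w u)) => /= wuv; first lia.
  have : w u <> w v by move=> /wi e; move: uv; rewrite e; lia.
  lia.
case: (ubnP (lval l y)) => i; elim: i y => // i IH y iy xy.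
case E: (lval l y) xy => [|j] // xj.
have [z lz] : exists z, lval l z = j.
  by apply: lval_surj; apply: leq_trans (lval_lt l y); rewrite E.
have zy : (lval l z).+1 = lval l y by rewrite lz E.
move: xj; rewrite ltnS leq_eqVlt -lz => /orP[/eqP/lval_inj -> | xz]; first exact: step.
by apply: leq_trans (step _ _ zy); rewrite ltnS ltnW // IH // lz; lia.
Qed.

Lemma wpart_delta (l : linext) : wpart W w (delta w l).
Proof. by move=> x y /(lval_mono l); apply: key_delta. Qed.

Lemma upper_ideal_ge (a : P) : upper_ideal [set x | (a <= x)%O].
Proof.
apply/forallP => x; apply/forallP => y; apply/implyP; rewrite !inE => /andP[].
exact: le_trans.
Qed.

Lemma upper_ideal_gt (a : P) : upper_ideal ([set x | (a <= x)%O] :\ a).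
Proof.
apply/forallP => x; apply/forallP => y; apply/implyP; rewrite !inE => /andP[/andP[xa ax] xy].
rewrite (le_trans ax xy) andbT; apply: contra xa => /eqP ya.
by rewrite eq_le ax -ya xy.
Qed.

(** The coordinate at a is the quotient of the monomials of the ideals {x >= a} and {x > a}. *)
Lemma torus_separated {K : fieldType} (t u : P -> K) :
  (forall a, t a != 0) -> t != u ->
  exists2 J : {set P}, upper_ideal J & \prod_(a in J) t a != \prod_(a in J) u a.
Proof.
move=> t0 tu; have [//|H] := pselect (exists2 J : {set P}, upper_ideal J &
  \prod_(a in J) t a != \prod_(a in J) u a).
have {}H J : upper_ideal J -> \prod_(a in J) t a = \prod_(a in J) u a.
  by move=> IJ; apply/eqP; apply: contraT => n; case: H; exists J.
case/eqP: tu; apply/funext => a; have := H _ (upper_ideal_ge a).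
have aJ : a \in [set x | (a <= x)%O] by rewrite inE.
rewrite (big_setD1 a aJ) /= (big_setD1 a aJ (F := u)) /= (H _ (upper_ideal_gt a)).
apply: mulIf; rewrite -(H _ (upper_ideal_gt a)); exact/prodf_neq0.
Qed.

(** The exponents of (P,w)-partitions are stable under adding ideals, so a relation may be
    multiplied by t^J - t_i^J. A separating ideal for each i other than i0 kills that term and keeps
    the one of i0, where any monomial is nonzero. *)
Lemma monom_separation {K : fieldType} k (t : 'I_k -> P -> K) (y : 'I_k -> K) :
  (forall i a, t i a != 0) -> injective t ->
  (forall m, wpart W w m -> \sum_i y i * monom (t i) m = 0) -> forall i, y i = 0.
Proof.
move=> t0 ti yV i0.
have sep (s : seq (ordinal k)) : i0 \notin s -> exists c : 'I_k -> K,
    [/\ c i0 != 0, forall i, i \in s -> c i = 0 &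
       forall m, wpart W w m -> \sum_i c i * y i * monom (t i) m = 0].
  elim: s => [_|i s IH].
    exists (fun=> 1); split; rewrite ?oner_neq0 // => m mw.
    by rewrite -[RHS](yV m mw); apply: eq_bigr => i _; rewrite mul1r.
  rewrite inE negb_or => /andP[ni0 /IH[c [c0 cs cV]]].
  have [|J IJ tJ] := torus_separated (t0 i) (u := t i0).
    by apply: contra ni0 => /eqP/ti ->.
  exists (fun j => (\prod_(a in J) t j a - \prod_(a in J) t i a) * c j); split.
  - by rewrite mulf_neq0 // subr_eq0 eq_sym.
  - move=> j; rewrite inE => /orP[/eqP -> |/cs ->]; first by rewrite subrr mul0r.
    by rewrite mulr0.
  move=> m mw; have h1 := cV _ (wpart_shift mw IJ); have h2 := cV _ mw.
  transitivity (\sum_j c j * y j * monom (t j) (shift m J) -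
    \prod_(a in J) t i a * \sum_j c j * y j * monom (t j) m); last first.
    by rewrite h1 h2 mulr0 subr0.
  by rewrite mulr_sumr -sumrB; apply: eq_bigr => j _; rewrite monom_shift; ring.
have [|c [c0 cs cV]] := sep [seq i <- enum 'I_k | i != i0].
  by rewrite mem_filter eqxx.
have [l lP] := @linear_extension_exists _ P.
pose l' : linext := exist (fun l => is_true (linear_extension l)) l lP.
have := cV _ (wpart_delta l'); rewrite (bigD1 i0) //= big1 => [|i ii0]; last first.
  by rewrite cs ?mul0r // mem_filter ii0 mem_enum.
move/eqP; rewrite addr0 !mulf_eq0 (negbTE c0) /= => /orP[/eqP //|].
by rewrite /monom prodf_seq_eq0 => /hasP[x _ /=]; rewrite expf_eq0 (negbTE (t0 _ _)) andbF.
Qed.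

Definition deltamx {K : fieldType} k (t : 'I_k -> P -> K) : 'M[K]_(k, #|{: @linext d P}|) :=
  \matrix_(i, j) monom (t i) (delta w (enum_val j)).

Lemma sum_linext {V : zmodType} (f : linext -> V) :
  \sum_(l : @linext d P) f l = \sum_(j < #|{: @linext d P}|) f (enum_val j).
Proof.
rewrite (reindex (enum_val (A := {: @linext d P}))) //=; last first.
  by apply: onW_bij; exact: enum_val_bij.
Qed.

(** Straightening expresses every (P,w)-partition monomial by descent monomials with coefficients
    common to all the points; a relation between the rows would thus hold for all these monomials,
    against [monom_separation]. *)
Lemma deltamx_free {K : fieldType} (f : {rmorphism F -> K}) v k (t : 'I_k -> P -> K) :
  (forall i a, t i a != 0) -> injective t ->
  (forall i j, (0 < j <= #|P|)%N -> theta alpha f (t i) j = f (v j)) ->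
  row_free (deltamx t).
Proof.
move=> t0 ti tv; rewrite -kermx_eq0; apply/rowV0P => y /sub_kermxP yE.
apply/rowP => i; rewrite mxE; apply: (monom_separation t0 ti (y := fun i => y 0 i)) => m mw.
have [r [_ /(_ K f)rE]] := expansion_exists alpha0 wi wW mw.
rewrite (eq_bigr (fun i => \sum_l (y 0 i * (f (r l v) * monom (t i) (delta w l))))).
  rewrite exchange_big sum_linext big1 // => j _.
  have /rowP/(_ j) := yE; rewrite !mxE => jE.
  transitivity (f (r (enum_val j) v) * \sum_i y 0 i * deltamx t i j).
    by rewrite mulr_sumr; apply: eq_bigr => i' _; rewrite mxE mulrCA.
  by rewrite jE mulr0.
by move=> i' _; rewrite (rE _ v) ?mulr_sumr //; apply: tv.
Qed.

(** The upper half of the count of solutions; the lower half is [volume_natural]. *)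
Lemma torus_points_bound {K : fieldType} (f : {rmorphism F -> K}) v k (t : 'I_k -> P -> K) :
  (forall i a, t i a != 0) -> injective t ->
  (forall i j, (0 < j <= #|P|)%N -> theta alpha f (t i) j = f (v j)) ->
  (k <= #|{: @linext d P}|)%N.
Proof.
move=> t0 ti tv; have /eqP <- := deltamx_free t0 ti tv; exact: rank_leq_col.
Qed.

End Separation.

(** * The residue functional *)

Section Residue.
Context {d : Order.disp_t} {P : finPOrderType d}.
Implicit Types (m : P -> nat) (I J : {set P}).

Lemma exchange_weak (k : P -> nat) I J : #|I| = #|J| ->
  (forall x y, x \in I -> y \notin I -> (k y <= k x)%N) ->
  (\sum_(x in J) k x <= \sum_(x in I) k x)%N.
Proof.
move=> cIJ kIJ; have [-> //|nIJ] := eqVneq I J.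
(* Ties are broken in favour of I; all the tie-breakers together stay below one unit of the factor
   [#|I|.+1]. *)
pose k' x := (#|I|.+1 * k x + (x \in I))%N.
have : (\sum_(x in J) k' x < \sum_(x in I) k' x)%N.
  apply: exchange_top => // x y xI yI; rewrite /k' xI (negbTE yI) addn0 addn1 ltnS.
  by rewrite leq_mul2l kIJ.
rewrite /k' !big_split /= -!big_distrr /=.
rewrite [X in (_ < _ + X)%N](eq_bigr (fun=> 1%N)) => [|x ->//]; rewrite sum1_card => h.
rewrite -ltnS -(@ltn_pmul2l #|I|.+1) // mulnSr !mulSn; move: h.
set A := (\sum_(x in J) k x)%N; set B := (\sum_(x in I) k x)%N.
move: (#|I| * A)%N (#|I| * B)%N (\sum_(x in J) (x \in I))%N => p q r.
move: A B #|I| => A B n; lia.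
Qed.

Lemma delta_le (w : P -> nat) (l : linext) x : (delta w l x <= lval l x)%N.
Proof.
case: (ubnP (lval l x)) => i; elim: i x => // i IH x ix.
case E: (lval l x) => [|j]; first by rewrite delta0.
have [y ly] : exists y, lval l y = j.
  by apply: lval_surj; apply: leq_trans (lval_lt l x); rewrite E.
have yx : (lval l y).+1 = lval l x by rewrite ly E.
rewrite (deltaS _ yx); have : (delta w l y <= j)%N by rewrite -ly IH //; lia.
case: (w x < w y)%N => /=; lia.
Qed.

(** Takes the same value on all [lval l], and replacing the ideal of largest keys by another one of
    its size cannot raise it. It tells which terms of a relation can have a nonzero residue. *)
Definition sqdeg m : nat := (\sum_x m x ^ 2)%N.

Lemma sqdeg_shift m I :
  sqdeg (shift m I) = (sqdeg m + \sum_(x in I) (2 * m x + 1))%N.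
Proof.
rewrite /sqdeg [X in (_ + X)%N]big_mkcond -big_split /=.
apply: eq_bigr => x _; rewrite /shift; case: (x \in I) => /=; last by rewrite !addn0.
lia.
Qed.

Variable l0 : @linext d P.

(* For this labelling [wpart] means strictly increasing. *)
Definition anti_label : P -> nat := fun x => (#|P| - (lval l0 x).+1)%N.

Lemma anti_label_lt x y : (anti_label x < anti_label y)%N = (lval l0 y < lval l0 x)%N.
Proof. rewrite /anti_label; have := lval_lt l0 x; have := lval_lt l0 y; lia. Qed.

Lemma anti_label_inj : injective anti_label.
Proof.
move=> x y e; apply: (@lval_inj _ _ l0); have := lval_lt l0 x; have := lval_lt l0 y.
by move: e; rewrite /anti_label; lia.
Qed.

Lemma anti_label_bound x : (anti_label x < #|P|)%N.
Proof. rewrite /anti_label; have := lval_lt l0 x; lia. Qed.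

(** Every step of l0 is a descent for this labelling, so this is the descent monomial of highest
    degree. *)
Lemma delta_anti : delta anti_label l0 = lval l0.
Proof.
apply/esym/funext/delta_unique => // x y yx.
by rewrite anti_label_lt -yx ltnSn addn1.
Qed.

Local Notation swpart := (wpart #|P| anti_label).

Lemma mdeg_lval (l l' : @linext d P) : mdeg (lval l) = mdeg (lval l').
Proof. by rewrite /mdeg (sum_lval id l) (sum_lval id l'). Qed.

Lemma sqdeg_lval (l l' : @linext d P) : sqdeg (lval l) = sqdeg (lval l').
Proof. by rewrite /sqdeg (sum_lval (fun i => i ^ 2)%N l) (sum_lval (fun i => i ^ 2)%N l'). Qed.

(* [rho m] stands for the global residue of the monomial with exponents [m]:
   the sum of its values at the solutions, divided by the toric Jacobian. *)
Context {F : fieldType} (alpha : {set P} -> F) (v : nat -> F) (rho : (P -> nat) -> F).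
Hypothesis alpha0 : forall J, upper_ideal J -> alpha J != 0.
Hypothesis rho_theta : forall m j, (0 < j <= #|P|)%N -> swpart m ->
  \sum_(J : {set P} | upper_ideal J && (#|J| == j)) alpha J * rho (shift m J) = v j * rho m.
Hypothesis rho_low : forall m, swpart m -> (mdeg m < mdeg (lval l0))%N -> rho m = 0.

(** A descent monomial of this degree must be some [lval l], by [delta_le], and then its sum of
    squares is not smaller. Otherwise straighten: the multiple of v_j vanishes by degree, and the
    other ideals give monomials of smaller potential with no larger sum of squares. *)
Lemma rho_unbalanced m : swpart m -> mdeg m = mdeg (lval l0) ->
  (sqdeg m < sqdeg (lval l0))%N -> rho m = 0.
Proof.
case: (ubnP (potential #|P| anti_label m)) => N; elim: N m => // N IH m mN mw mdegE msq.
case: (wpart_decomp anti_label_inj anti_label_bound mw) => [[l mE]|[I [m' [II I0 mE mw' Itop]]]].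
  suff e : m =1 lval l by move: msq; rewrite (funext e) (sqdeg_lval l l0) ltnn.
  have le x : (m x <= lval l x)%N by rewrite mE delta_le.
  move=> x; apply/eqP; rewrite eqn_leq le /= leqNgt; apply/negP => lt.
  move: mdegE; rewrite (mdeg_lval l0 l) => /eqP; apply/negP; rewrite neq_ltn; apply/orP; left.
  rewrite /mdeg (bigD1 x) //= [ltnRHS](bigD1 x) //= -addSn leq_add // leq_sum //.
have := @rho_theta m' #|I|; rewrite I0 max_card => /(_ isT mw').
rewrite (rho_low mw') ?mulr0; last by rewrite -mdegE mE mdeg_shift; lia.
rewrite (bigD1 I) /=; last by rewrite II eqxx.
rewrite big1 ?addr0 -?mE => [/eqP|J /andP[/andP[IJ /eqP cJ] nJ]].
  by rewrite mulf_eq0 (negbTE (alpha0 II)) => /eqP.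
rewrite IH ?mulr0 //; last 3 first.
- exact: wpart_shift.
- by rewrite -mdegE mE !mdeg_shift cJ.
- apply: leq_ltn_trans msq; rewrite mE !sqdeg_shift leq_add2l.
  apply: exchange_weak => // x y xI yI; have := Itop _ _ xI yI.
  rewrite leq_add2r leq_mul2l /= /key => h; rewrite leqNgt; apply/negP => xy.
  have := anti_label_bound x; have : (#|P| * (m' x).+1 <= #|P| * m' y)%N by rewrite leq_mul2l xy orbT.
  rewrite mulnS; move: h; move: (#|P| * m' x)%N (#|P| * m' y)%N (anti_label x) (anti_label y).
  by move: #|P| => n p q r s; lia.
rewrite -ltnS; apply: leq_trans mN.
rewrite mE !potential_shift cJ !ltnS ltn_add2l ltn_add2r.
by apply: exchange_top => //; rewrite eq_sym.
Qed.

Definition topset (l : @linext d P) (j : nat) : {set P} := [set x | (j <= lval l x)%N].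

Lemma topset_ideal l j : upper_ideal (topset l j).
Proof.
apply/forallP => x; apply/forallP => y; apply/implyP; rewrite !inE => /andP[jx].
by rewrite le_eqVlt => /orP[/eqP <- //|/(lval_mono l)/ltnW]; apply: leq_trans.
Qed.

Lemma card_topset l j : #|topset l j| = (#|P| - j)%N.
Proof.
rewrite -sum1_card big_mkcond /=.
rewrite (eq_bigr (fun x => (j <= lval l x) : nat)%N) => [|x _]; last by rewrite inE; case: leqP.
rewrite (sum_lval (fun i => (j <= i) : nat)%N) -(big_mkord xpredT (fun i => (j <= i) : nat)%N).
elim: #|P| => [|n IH]; first by rewrite big_nil.
by rewrite big_nat_recr //= IH; case: (leqP j n) => jn; lia.
Qed.

Lemma linext_eq (l l' : @linext d P) : lval l =1 lval l' -> l = l'.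
Proof. by move=> e; apply: val_inj; apply/ffunP => x; apply: val_inj; exact: e. Qed.

Lemma tperm_mono n (p q u w : 'I_n) : (q.+1 = p)%N -> (u < w)%N -> ~ (u = q /\ w = p) ->
  (tperm p q u <= tperm p q w)%N.
Proof.
move=> pq uw ne.
have {}ne : ~ (u = q :> nat /\ w = p :> nat) by move=> [/val_inj uq /val_inj wp]; apply: ne.
rewrite !permE /= -!(inj_eq val_inj) /= !(fun_if val) /=.
by move: ne uw; rewrite -pq; repeat (case: eqP => ?); lia.
Qed.

Lemma linext_swap (l : @linext d P) a b : (lval l b).+1 = lval l a -> ~~ (b < a)%O ->
  exists l' : @linext d P, forall x, val l' x = tperm (val l a) (val l b) (val l x).
Proof.
move=> ba nba; pose s := tperm (val l a) (val l b).
have li : injective (val l) by move=> x y e; apply: (@lval_inj _ _ l); rewrite /lval e.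
have H : linear_extension [ffun x => s (val l x)].
  apply/andP; split; first by apply/injectiveP => x y; rewrite !ffunE => /perm_inj/li.
  apply/forallP => x; apply/forallP => y; apply/implyP.
  rewrite le_eqVlt !ffunE => /orP[/eqP -> //|xy]; have := lval_mono l xy.
  move=> xy'; apply: tperm_mono => // -[/li xb /li ya].
  by move: nba; rewrite -xb -ya xy.
by exists (exist (fun l => is_true (linear_extension l)) _ H) => x /=; rewrite ffunE.
Qed.

Lemma linext_order_eq (l l' : @linext d P) :
  (forall a b, (lval l b).+1 = lval l a -> (lval l' b < lval l' a)%N) -> l = l'.
Proof.
move=> H; apply: linext_eq.
have ge x : (lval l x <= lval l' x)%N.
  case: (ubnP (lval l x)) => i; elim: i x => // i IH x ix.
  case E: (lval l x) => [|j] //.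
  have [y ly] : exists y, lval l y = j.
    by apply: lval_surj; apply: leq_trans (lval_lt l x); rewrite E.
  have yx : (lval l y).+1 = lval l x by rewrite ly E.
  by apply: leq_ltn_trans (H _ _ yx); rewrite -ly IH //; lia.
move=> x; apply/eqP; rewrite eqn_leq ge /= leqNgt; apply/negP => lt.
have /eqP := mdeg_lval l l'; apply/negP; rewrite neq_ltn; apply/orP; left.
rewrite /mdeg (bigD1 x) //= [ltnRHS](bigD1 x) //= -addSn leq_add // leq_sum //.
Qed.

End Residue.

(** * Signs of the residues in top degree *)

Section ResidueSign.
Context {d : Order.disp_t} {P : finPOrderType d}.
Variable l0 : @linext d P.
Local Notation swpart := (wpart #|P| (anti_label l0)).
Context {F : fieldType} (alpha : {set P} -> F) (v : nat -> F) (rho : (P -> nat) -> F).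
Hypothesis alpha0 : forall J, upper_ideal J -> alpha J != 0.
Hypothesis rho_theta : forall m j, (0 < j <= #|P|)%N -> swpart m ->
  \sum_(J : {set P} | upper_ideal J && (#|J| == j)) alpha J * rho (shift m J) = v j * rho m.
Hypothesis rho_low : forall m, swpart m -> (mdeg m < mdeg (lval l0))%N -> rho m = 0.

Lemma sum_affine (S : {set P}) (k u : P -> nat) :
  (\sum_(x in S) (2 * k x + u x) = 2 * \sum_(x in S) k x + \sum_(x in S) u x)%N.
Proof. by rewrite big_split big_distrr. Qed.

Lemma sum_eq1 (S : {set P}) b : b \in S -> (\sum_(x in S) (x == b) = 1)%N.
Proof.
by move=> bS; rewrite (bigD1 b) //= eqxx big1 // => x /andP[_ /negbTE ->].
Qed.

(** With a tie between a in I and b outside I at the border, the largest sum is reached only by I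
    and by I with a replaced by b. *)
Lemma sum_swap_lt (k : P -> nat) (a b : P) (I J : {set P}) :
  a \in I -> b \notin I -> k a = k b ->
  (forall x, x \in I -> x != a -> (k a < k x)%N) ->
  (forall y, y \notin I -> y != b -> (k y < k a)%N) ->
  #|J| = #|I| -> J != I -> J != b |: (I :\ a) ->
  (\sum_(x in J) k x < \sum_(x in I) k x)%N.
Proof.
move=> aI bI kab kI kC cJ nI nI'.
have ab : a != b by apply: contraNneq bI => <-.
have cI' : #|b |: (I :\ a)| = #|I|.
  by rewrite cardsU1 !inE (negbTE bI) andbF /= (cardsD1 a I) aI.
have sI' : (\sum_(x in b |: (I :\ a)) k x = \sum_(x in I) k x)%N.
  rewrite (big_setU1) /=; last by rewrite !inE (negbTE bI) andbF.
  by rewrite -kab (big_setD1 a aI).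
have [bJ|bJ] := boolP (b \in J).
  have : (\sum_(x in J) (2 * k x + (x == b)) < \sum_(x in b |: (I :\ a)) (2 * k x + (x == b)))%N.
    apply: exchange_top; rewrite 1?eq_sym ?cI' // => x y.
    rewrite !inE negb_or negb_and => /orP[/eqP -> /andP[yb]|/andP[xa xI] /andP[yb]].
      rewrite eqxx (negbTE yb) addn0 negbK => /orP[/eqP ->|yI].
        by rewrite kab addn1.
      by have := kC _ yI yb; rewrite kab; lia.
    have xb : x != b by apply: contraTneq xI => ->.
    rewrite (negbTE xb) (negbTE yb) !addn0 ltn_mul2l negbK => /orP[/eqP ->|yI] /=.
      exact: kI.
    by apply: ltn_trans (kC _ yI yb) (kI _ xI xa).
  rewrite !sum_affine sI' !sum_eq1 ?ltn_add2r ?ltn_mul2l //.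
  by rewrite !inE eqxx.
(* J avoids b, so b may be put below everything; this removes the tie with a. *)
pose k' x := if x == b then 0%N else (k x).+1.
have k'E (S : {set P}) : b \notin S -> (\sum_(x in S) k' x = \sum_(x in S) k x + #|S|)%N.
  move=> bS; rewrite -sum1_card -big_split /=; apply: eq_bigr => x xS.
  by rewrite /k' ifN ?addn1 //; apply: contraNneq bS => <-.
have : (\sum_(x in J) k' x < \sum_(x in I) k' x)%N.
  apply: exchange_top; rewrite 1?eq_sym // => x y xI yI; rewrite /k'.
  have xb : x != b by apply: contraTneq xI => ->.
  rewrite (negbTE xb); case: ifP => // /negbT yb; rewrite ltnS.
  have [->|xa] := eqVneq x a; first exact: kC.
  exact: ltn_trans (kC _ yI yb) (kI _ xI xa).
by rewrite !k'E // cJ ltn_add2r.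
Qed.

Lemma topset_swap (l l' : @linext d P) a b : (lval l b).+1 = lval l a ->
  (forall x, val l' x = tperm (val l a) (val l b) (val l x)) ->
  (forall j, j != lval l a -> topset l' j = topset l j) /\
  topset l' (lval l a) = b |: (topset l (lval l a) :\ a).
Proof.
move=> ba l'E.
have l'E' x : lval l' x = if lval l x == lval l a then lval l b else
    if lval l x == lval l b then lval l a else lval l x.
  by rewrite /lval l'E permE /= -!(inj_eq val_inj) /= !(fun_if val).
split=> [j|]; last first.
  apply/setP => x; rewrite !inE l'E' -!(inj_eq (@lval_inj _ _ l)).
  by case: (lval l x =P lval l a) => h1; case: (lval l x =P lval l b) => h2 /=; lia.
move=> jn; apply/setP => x; rewrite !inE l'E'.
by case: (lval l x =P lval l a) => h1; case: (lval l x =P lval l b) => h2 /=; lia.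
Qed.

(** A bubble sort towards l0. For l and l' differing by an adjacent swap, one straightening relation
    has [lval l] and [lval l'] as its only terms with nonzero residue, so the two residues, weighted
    by alpha, are opposite. The product over the top sets records these weights. *)
Lemma rho_sign (l : @linext d P) : exists s : 'S_#|P|,
  (forall a, s (val l0 a) = val l a) /\
  rho (lval l) * \prod_(j < #|P|) alpha (topset l j) =
    (-1) ^+ s * (rho (lval l0) * \prod_(j < #|P|) alpha (topset l0 j)).
Proof.
case: (ubnP (potential #|P| (anti_label l0) (lval l))) => N; elim: N l => // N IH l lN.
have [->|ne] := eqVneq l l0.
  exists 1%g; rewrite odd_perm1 expr0 mul1r; split=> // a; by rewrite perm1.
have [a [b [ba l0ab]]] : exists a b, (lval l b).+1 = lval l a /\ (lval l0 a < lval l0 b)%N.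
  have [//|H] := pselect (exists a b, (lval l b).+1 = lval l a /\ (lval l0 a < lval l0 b)%N).
  case/eqP: ne; apply: linext_order_eq => a b ba; rewrite ltnNge leq_eqVlt; apply/negP.
  move=> /orP[/eqP/lval_inj e|h]; first by move: ba; rewrite e; lia.
  by apply: H; exists a, b.
have nba : ~~ (b < a)%O by apply/negP => /(lval_mono l0); lia.
have [l' l'E] := linext_swap ba nba.
have [topj topa] := topset_swap ba l'E.
have [I [IE inI]] : exists I, I = topset l (lval l a) /\
    forall x, (x \in I) = (lval l b < lval l x)%N.
  by exists (topset l (lval l a)); split=> // x; rewrite inE -ba.
rewrite -IE in topa.
(* After this subtraction a and b have equal exponents, which is the tie required by
   [sum_swap_lt]. *)
pose m' x := (lval l x - (x \in I))%N.
have aI : a \in I by rewrite inI -ba.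
have bI : b \notin I by rewrite inI ltnn.
have nab : a != b by apply: contraNneq bI => <-.
have m'I x : x \in I -> m' x = (lval l x).-1 by rewrite /m' => ->; lia.
have m'C x : x \notin I -> m' x = lval l x by rewrite /m' => /negbTE ->; lia.
have lE : lval l = shift m' I.
  apply/funext => x; rewrite /shift /m' subnK //.
  by rewrite inI; case: (lval l x) => //= k; case: ltnP.
have l'E' x : lval l' x = if x == a then lval l b else if x == b then lval l a else lval l x.
  by rewrite -!(inj_eq (@lval_inj _ _ l)) /lval l'E permE /= -!(inj_eq val_inj) /= !(fun_if val).
have l'S : lval l' = shift m' (b |: (I :\ a)).
  apply/funext => x; rewrite /shift l'E' in_setU1 in_setD1.
  have [->|xa] := eqVneq x a.
    by rewrite (negbTE nab) /= addn0 m'I // -ba.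
  have [->|xb] := eqVneq x b.
    by rewrite m'C //= -ba addn1.
  by rewrite /= {1}lE /shift.
have cI' : #|b |: (I :\ a)| = #|I|.
  by rewrite cardsU1 in_setD1 (negbTE bI) andbF /= (cardsD1 a I) aI.
have mw' : swpart m'.
  move=> x y xy; rewrite /key.
  have l0xy : (anti_label l0 y < anti_label l0 x)%N by rewrite anti_label_lt; exact: lval_mono.
  have lxy := lval_mono l xy.
  have h : (m' x < m' y)%N.
    have [xI|xI] := boolP (x \in I).
      have yI : y \in I by move: xI; rewrite !inI => /ltn_trans; apply.
      by rewrite !m'I //; move: xI lxy; rewrite inI; case: (lval l x) (lval l y) => [|p] [|q].
    rewrite (m'C _ xI); have [yI|yI] := boolP (y \in I); last by rewrite m'C.
    rewrite m'I //; have : ~ (lval l x = lval l b /\ lval l y = lval l a).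
      by move=> [/lval_inj xb /lval_inj ya]; move: nba; rewrite -xb -ya xy.
    by move: xI yI lxy; rewrite !inI -ba; move: (lval l x) (lval l y) (lval l b) => p q r; clear; lia.
  have := anti_label_bound l0 x; have := anti_label_bound l0 y.
  have : (#|P| * (m' x).+1 <= #|P| * m' y)%N by rewrite leq_mul2l h orbT.
  rewrite mulnS; move: l0xy; move: (#|P| * m' x)%N (#|P| * m' y)%N (anti_label l0 x) (anti_label l0 y).
  by move: #|P| => n p q r s; lia.
have II := topset_ideal l (lval l a); rewrite -IE in II.
have II' : upper_ideal (b |: (I :\ a)) by rewrite -topa; exact: topset_ideal.
have I0 : (0 < #|I|)%N by apply/card_gt0P; exists a.
have := rho_theta (m := m') (j := #|I|); rewrite I0 max_card => /(_ isT mw').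
have dm : (mdeg m' + #|I| = mdeg (lval l0))%N by rewrite -mdeg_shift -lE; exact: mdeg_lval.
rewrite (rho_low mw') ?mulr0; last by lia.
have nII' : b |: (I :\ a) != I.
  by apply: contraNneq bI => <-; rewrite in_setU1 eqxx.
rewrite (bigD1 I) /= ?II ?eqxx // (bigD1 (b |: (I :\ a))) /= ?II' ?cI' ?eqxx ?nII' //.
rewrite big1 ?addr0 => [|J /andP[/andP[/andP[IJ /eqP cJ] nJ] nJ']]; last first.
  rewrite (rho_unbalanced (l0 := l0) alpha0 rho_theta rho_low) ?mulr0 //.
  - exact: wpart_shift.
  - by rewrite mdeg_shift cJ.
  rewrite (sqdeg_lval l0 l) lE !sqdeg_shift ltn_add2l.
  have sl : (\sum_(x in J) m' x < \sum_(x in I) m' x)%N.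
    apply: (sum_swap_lt (a := a) (b := b)) => //.
    - by rewrite (m'I _ aI) (m'C _ bI) -ba.
    - move=> x xI xa; rewrite (m'I _ aI) (m'I _ xI); have : lval l x <> lval l a by move=> /lval_inj e; case/eqP: xa.
      by move: xI; rewrite inI -ba; move: (lval l x) (lval l b) => p q; clear; lia.
    - move=> y yI yb; rewrite (m'I _ aI) (m'C _ yI); have : lval l y <> lval l b by move=> /lval_inj e; case/eqP: yb.
      by move: yI; rewrite inI -ba; move: (lval l y) (lval l b) => p q; clear; lia.
  by rewrite !sum_affine !sum1_card cJ ltn_add2r ltn_mul2l.
rewrite -lE -l'S => rel.
have Pl' : (potential #|P| (anti_label l0) (lval l') < N)%N.
  rewrite -ltnS; apply: leq_trans lN; rewrite lE l'S !potential_shift cI' !ltnS.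
  rewrite ltn_add2l ltn_add2r big_setU1 /=; last by rewrite in_setD1 (negbTE bI) andbF.
  rewrite [ltnRHS](big_setD1 a aI) /= ltn_add2r /key (m'I _ aI) (m'C _ bI) -ba ltn_add2l.
  by rewrite anti_label_lt.
have [s [sE sr]] := IH l' Pl'.
exists (s * tperm (val l a) (val l b))%g; split.
  by move=> x; rewrite permM sE l'E tpermK.
have lna : val l a != val l b.
  by apply/negP => /eqP e; case/eqP: nab; apply: (@lval_inj _ _ l); rewrite /lval e.
rewrite odd_permM odd_tperm lna addbT signrN mulNr -sr.
(* The top sets of l and l' differ at this level only. *)
pose ja := val l a.
rewrite (bigD1 ja) //= [in RHS](bigD1 ja) //=.
rewrite [in RHS](eq_bigr (fun j : 'I_#|P| => alpha (topset l j))); last first.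
  by move=> j jn; rewrite topj.
rewrite -[topset l ja]/(topset l (lval l a)) -IE -[topset l' ja]/(topset l' (lval l a)) topa.
rewrite !mulrA -mulNr; congr (_ * _).
by apply/eqP; rewrite -addr_eq0 -rel; apply/eqP; ring.
Qed.

End ResidueSign.

(** * Posets ranked mod 2 *)

Section Alternating.
Context {d : Order.disp_t} {P : finPOrderType d}.
Implicit Types (m w : P -> nat).

Definition covered (a b : P) : Prop := (a < b)%O /\ forall c, ~ ((a < c)%O /\ (c < b)%O).

Lemma lt_cover_ind (T : P -> P -> Prop) :
  (forall a b c, T a b -> T b c -> T a c) -> (forall a b, covered a b -> T a b) ->
  forall a b, (a < b)%O -> T a b.
Proof.
move=> Ttr Tc a b; case: (ubnP #|[set c | (a < c < b)%O]|) => N.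
elim: N a b => // N IH a b cN ab.
have [[c [ac cb]]|H] := pselect (exists c, (a < c)%O /\ (c < b)%O); last first.
  by apply: Tc; split=> // c hc; apply: H; exists c.
have sub x y : (a <= x)%O -> (y <= b)%O -> c \notin [set z | (x < z < y)%O] ->
    (#|[set z | (x < z < y)%O]| < N)%N.
  move=> ax yb cn; rewrite -ltnS; apply: leq_trans cN; rewrite ltnS.
  apply: proper_card; apply/properP; split; last by exists c => //; rewrite inE ac.
  apply/fintype.subsetP => z; rewrite !inE => /andP[xz zy].
  by rewrite (le_lt_trans ax xz) (lt_le_trans zy yb).
apply: (Ttr _ c); apply: IH => //; apply: sub; rewrite ?(ltW ac) ?(ltW cb) //.
  by rewrite inE ltxx andbF.
by rewrite inE ltxx.
Qed.

Variable S : pred P.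
Hypothesis S_cover : forall a b, covered a b -> S a = ~~ S b.
Hypothesis S_min : forall a, (forall b, ~~ (b < a)%O) -> S a.

(* A partition for this labelling increases strictly along the covers going from
   [S] to its complement, and weakly along the other ones. *)
Definition alt_label : P -> nat := fun x => (S x * #|P| + enum_rank x)%N.

Lemma alt_label_inj : injective alt_label.
Proof.
move=> x y /(congr1 (fun i => i %% #|P|)%N); rewrite /alt_label !modnMDl !modn_small //.
by move/val_inj/enum_rank_inj.
Qed.

Lemma alt_label_bound x : (alt_label x < 2 * #|P|)%N.
Proof.
rewrite /alt_label mul2n -addnn; case: (S x); first by rewrite mul1n ltn_add2l.
by rewrite mul0n add0n ltn_addr.
Qed.

Lemma alt_wpart_le m x y : wpart (2 * #|P|) alt_label m -> (x < y)%O -> (m x <= m y)%N.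
Proof.
move=> mw /mw; rewrite /key => h; rewrite leqNgt; apply/negP => xy.
have : (2 * #|P| * (m y).+1 <= 2 * #|P| * m x)%N by rewrite leq_mul2l xy orbT.
have := alt_label_bound y; move: h; rewrite mulnS.
move: (2 * #|P| * m x)%N (2 * #|P| * m y)%N (alt_label x) (alt_label y).
by move: (2 * #|P|)%N => n p q r s; lia.
Qed.

Lemma alt_wpart_lt m x y : wpart (2 * #|P|) alt_label m -> (x < y)%O -> S x -> ~~ S y ->
  (m x < m y)%N.
Proof.
move=> mw xy Sx Sy; rewrite ltn_neqAle (alt_wpart_le mw xy) andbT; apply/negP => /eqP e.
have := mw x y xy; rewrite /key e ltn_add2l /alt_label Sx (negbTE Sy) mul1n mul0n add0n.
by move=> h; have := ltn_trans h (ltn_ord (enum_rank y)); rewrite ltnNge leq_addr.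
Qed.

Definition nonalt (x : P) : nat := ~~ S x.

(** An element outside S is not minimal and lies above an element of S, so a strict increase occurs
    below it. Hence division by prod_(a notin S) t_a leaves nonnegative exponents. *)
Lemma alt_wpart_pos m x : wpart (2 * #|P|) alt_label m -> (nonalt x <= m x)%N.
Proof.
move=> mw; rewrite /nonalt; case Sx: (S x) => //=.
have [[b bx]|H] := pselect (exists b, (b < x)%O); last first.
  by move: Sx; rewrite S_min // => b; apply/negP => bx; apply: H; exists b.
have : exists2 a, (a < x)%O & S a.
  move: b x bx Sx; apply: lt_cover_ind => [a b c H1 H2 Sc|a b ab Sb].
    by have [e ec Se] := H2 Sc; exists e.
  by exists a; [case: ab | rewrite (S_cover ab) Sb].
by move=> [a ax Sa]; apply: leq_ltn_trans (alt_wpart_lt mw ax Sa (negbT Sx)).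
Qed.

(** Along a cover leaving S the sum gains at least 2 and the divisor 1; along a cover entering S the
    sum does not drop and the divisor loses 1. Both ways the quotient increases strictly. *)
Lemma alt_wpart_add (l0 : @linext d P) m m' :
  wpart (2 * #|P|) alt_label m -> wpart (2 * #|P|) alt_label m' ->
  wpart #|P| (anti_label l0) (fun x => m x + m' x - nonalt x)%N.
Proof.
move=> mw mw'; set g := fun x => _.
have glt : forall x y, (x < y)%O -> (g x < g y)%N.
  apply: lt_cover_ind => [x y z|x y xy]; first exact: ltn_trans.
  have [xy' _] := xy; rewrite /g.
  have := alt_wpart_pos x mw; have := alt_wpart_pos y mw.
  rewrite /nonalt; have := S_cover xy; case Sy: (S y) => /= Sx; rewrite Sx /=.
    by have := alt_wpart_le mw xy'; have := alt_wpart_le mw' xy'; lia.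
  have Sy' := negbT Sy.
  by have := alt_wpart_lt mw xy' Sx Sy'; have := alt_wpart_lt mw' xy' Sx Sy'; lia.
move=> x y /glt h; rewrite /key.
have : (#|P| * (g x).+1 <= #|P| * g y)%N by rewrite leq_mul2l h orbT.
have := anti_label_bound l0 x; rewrite mulnS.
move: (#|P| * g x)%N (#|P| * g y)%N (anti_label l0 x) (anti_label l0 y).
by move: #|P| => n p q r s; lia.
Qed.

Lemma sum_succ_up (l : @linext d P) (f : P -> int) :
  \sum_y \sum_(z | (lval l z).+1 == lval l y) f y = \sum_(y | (0 < lval l y)%N) f y.
Proof.
rewrite [RHS]big_mkcond; apply: eq_bigr => y _; case E: (lval l y) => [|j].
  by rewrite big_pred0.
have [z lz] : exists z, lval l z = j.
  by apply: lval_surj; apply: leq_trans (lval_lt l y); rewrite E.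
rewrite (big_pred1 z) // => z'; rewrite /= eqSS -lz; apply/eqP/eqP => [/lval_inj //|-> //].
Qed.

Lemma sum_succ_down (l : @linext d P) (f : P -> int) :
  \sum_y \sum_(z | (lval l z).+1 == lval l y) f z = \sum_(z | ((lval l z).+1 < #|P|)%N) f z.
Proof.
rewrite (exchange_big_dep predT) //= [RHS]big_mkcond; apply: eq_bigr => z _.
case: ltnP => zn; last first.
  rewrite big_pred0 // => y; apply/negbTE/negP => /eqP zy.
  by have := lval_lt l y; rewrite -zy ltnNge zn.
have [y ly] := lval_surj l zn.
rewrite (big_pred1 y) // => y'; rewrite /= -ly; apply/eqP/eqP => [/lval_inj //|-> //].
Qed.

(** A descent arriving at y raises the exponent of the n - l(y) elements from y on. *)
Lemma mdeg_delta w (l : @linext d P) : (mdeg (delta w l))%:Z =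
  \sum_y \sum_(z | (lval l z).+1 == lval l y) (#|P|%:Z - (lval l y)%:Z) * (w y < w z)%:Z.
Proof.
rewrite /mdeg /delta (exchange_big_dep predT) //= -[LHS]natz natr_sum.
apply: eq_bigr => y _; rewrite sum_nat_const -big_distrr natrM /= natr_sum.
congr (_ * _); last by apply: eq_bigr => z _; rewrite natz.
have -> : #|[pred i | (lval l y <= lval l i)%N]| = #|topset l (lval l y)|.
  by apply: eq_card => x; rewrite !inE.
by rewrite card_topset natz -subzn // ltnW // lval_lt.
Qed.

Lemma swap_count (a b : P) i : ~~ (a < b)%O -> ~~ (b < a)%O -> a != b ->
  #|[pred l : @linext d P | (lval l a == i.+1) && (lval l b == i)]| =
  #|[pred l : @linext d P | (lval l b == i.+1) && (lval l a == i)]|.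
Proof.
have le a' b' : ~~ (b' < a')%O -> a' != b' ->
  (#|[pred l : @linext d P | (lval l a' == i.+1) && (lval l b' == i)]| <=
   #|[pred l : @linext d P | (lval l b' == i.+1) && (lval l a' == i)]|)%N.
  move=> nab ne.
  have fex (l : @linext d P) : exists l' : @linext d P, (lval l b').+1 = lval l a' ->
        forall x, val l' x = tperm (val l a') (val l b') (val l x).
    have [H|H] := pselect ((lval l b').+1 = lval l a'); last by exists l.
    by have [l' l'E] := linext_swap H nab; exists l'.
  have [f fE] := choice fex.
  have succ l : (lval l a' == i.+1) && (lval l b' == i) -> (lval l b').+1 = lval l a'.
    by move=> /andP[/eqP -> /eqP ->].
  rewrite -(card_in_image (f := f)); last first.
    move=> l l' /[!inE] hl hl' e; apply: linext_eq => x.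
    have := fE l (succ _ hl) x; rewrite e (fE l' (succ _ hl')).
    have -> : val l a' = val l' a'.
      move: hl hl' => /andP[/eqP h _] /andP[/eqP h' _].
      exact: val_inj (etrans h (esym h')).
    have -> : val l b' = val l' b'.
      move: hl hl' => /andP[_ /eqP h] /andP[_ /eqP h'].
      exact: val_inj (etrans h (esym h')).
    by move/perm_inj => h; rewrite /lval h.
  apply: subset_leq_card; apply/fintype.subsetP => y /fintype.imageP[l hl ->].
  rewrite inE in hl; rewrite inE.
  have H := fE l (succ _ hl); move: hl => /andP[/eqP la /eqP lb].
  by rewrite /lval !H tpermL tpermR -[nat_of_ord _]/(lval l a') la eqxx /= -[nat_of_ord _]/(lval l b') lb.
move=> ab ba ne; apply/eqP; rewrite eqn_leq (le a b ba ne) /=.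
by apply: le; rewrite // eq_sym.
Qed.

(* This makes the degree of the Gram determinant zero. Exchanging consecutive
   values of a linear extension at incomparable elements cancels all
   contributions but those of covers, and these telescope. *)
Lemma alt_degree (l0 : @linext d P) : (0 < #|P|)%N ->
  (\sum_(l : @linext d P) 2 * mdeg (delta alt_label l) =
   #|{: @linext d P}| * (mdeg (lval l0) + \sum_x nonalt x))%N.
Proof.
move=> P0; apply/eqP; rewrite -eqz_nat -natz natr_sum; apply/eqP.
(* The defect of the descent indicator: antisymmetric, and zero when y covers z. Weighted by the
   number of extensions with z, y in two given consecutive positions, which is symmetric for
   incomparable elements, it sums to zero. *)
pose u (y z : P) : int := 2 * (alt_label y < alt_label z)%:Z - 1 - ((S z)%:Z - (S y)%:Z).
have uC y z : y != z -> u z y = - u y z.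
  move=> yz; rewrite /u; have : alt_label y <> alt_label z by move=> /alt_label_inj/eqP; apply/negP.
  by case: (ltngtP (alt_label y) (alt_label z)) => //= _ _; case: (S y); case: (S z).
have ucov y z : covered z y -> u y z = 0.
  move=> zy; rewrite /u (S_cover zy); have [zy' _] := zy.
  rewrite /alt_label (S_cover zy).
  have := ltn_ord (enum_rank y); have := ltn_ord (enum_rank z).
  case: (S y) => /= hz hy; rewrite mul1n mul0n add0n.
    by rewrite ltnNge (leq_trans (ltnW hz) (leq_addr _ _)).
  by rewrite (leq_trans hy (leq_addr _ _)).
pose c i y z := #|[pred l : @linext d P | (lval l y == i.+1) && (lval l z == i)]|.
have cu i y z : (c i z y)%:Z * u z y = - ((c i y z)%:Z * u y z).
  have c0 x t : (x < t)%O -> c i x t = 0%N.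
    move=> xt; apply: eq_card0 => l; rewrite !inE; apply/negP => /andP[/eqP lx /eqP lt].
    by have := lval_mono l xt; lia.
  have cc x t : (x < t)%O -> (c i t x)%:Z * u t x = 0.
    move=> xt; have [->|/card_gt0P[l]] := posnP (c i t x); first by rewrite mul0r.
    rewrite inE => /andP[/eqP lt /eqP lx]; rewrite ucov ?mulr0 //; split=> // r [xr rt].
    by have := lval_mono l xr; have := lval_mono l rt; rewrite lt lx; clear; lia.
  have [<-|yz] := eqVneq y z.
    suff -> : c i y y = 0%N by rewrite mul0r oppr0.
    by apply: eq_card0 => l; rewrite !inE; apply/negP => /andP[/eqP -> /eqP]; lia.
  have [zy|nzy] := boolP (z < y)%O; first by rewrite (cc z y zy) (c0 z y zy) mul0r oppr0.
  have [yz'|nyz] := boolP (y < z)%O; first by rewrite (cc y z yz') (c0 y z yz') mul0r oppr0.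
  by rewrite {1}/c swap_count // 1?eq_sym // -/(c i y z) (uC y z) // mulrN.
have X0 : \sum_(l : @linext d P)
    \sum_y \sum_(z | (lval l z).+1 == lval l y) (#|P|%:Z - (lval l y)%:Z) * u y z = 0.
  transitivity (\sum_(i < #|P|) (#|P|%:Z - i.+1%:Z) * (\sum_y \sum_z (c i y z)%:Z * u y z)).
    transitivity (\sum_(l : @linext d P) \sum_y \sum_z \sum_(i < #|P|)
        (#|P|%:Z - i.+1%:Z) * (((lval l y == i.+1) && (lval l z == i))%:Z * u y z)).
      apply: eq_bigr => l _; apply: eq_bigr => y _; rewrite big_mkcond; apply: eq_bigr => z _.
      rewrite (bigD1 (val l z)) //= big1 ?addr0 => [|i iz].
        by rewrite -[nat_of_ord _]/(lval l z) eqxx andbT eq_sym; case: eqP => [->|_] /=; rewrite ?mul1r // mul0r mulr0.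
      have -> : (lval l z == i) = false.
        by apply/negbTE/negP => /eqP e; case/eqP: iz; exact: val_inj (esym e).
      by rewrite andbF mul0r mulr0.
    transitivity (\sum_(i < #|P|) \sum_y \sum_z \sum_(l : @linext d P)
        (#|P|%:Z - i.+1%:Z) * (((lval l y == i.+1) && (lval l z == i))%:Z * u y z)).
      under eq_bigr => l _ do under eq_bigr => y _ do rewrite exchange_big.
      under eq_bigr => l _ do rewrite exchange_big.
      rewrite exchange_big; apply: eq_bigr => i _ /=.
      rewrite exchange_big; apply: eq_bigr => y _ /=.
      by rewrite exchange_big.
    apply: eq_bigr => i _; rewrite mulr_sumr; apply: eq_bigr => y _; rewrite mulr_sumr.
    apply: eq_bigr => z _; rewrite -mulr_sumr -mulr_suml; congr (_ * (_ * _)).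
    rewrite -[RHS]natz /c -[X in _ = X%:R]sum1_card natr_sum [RHS]big_mkcond /=.
    apply: eq_bigr => l _.
    by rewrite inE; case: (_ && _).
  apply: big1 => i _; set X := \sum_y _; suff -> : X = 0 by rewrite mulr0.
  have : X = - X.
    rewrite {1}/X exchange_big /= -sumrN; apply: eq_bigr => y _.
    by rewrite -sumrN; apply: eq_bigr => z _; rewrite cu.
  by lia.
transitivity (\sum_(l : @linext d P) ((mdeg (lval l0))%:Z + \sum_x (nonalt x)%:Z)); last first.
  by rewrite sumr_const cardT -cardE -mulr_natl natz PoszM PoszD -[Posz (\sum_x _)%N]natz natr_sum;
     congr (_ * (_ + _)); apply: eq_bigr => x _; rewrite natz.
transitivity (\sum_(l : @linext d P) ((mdeg (lval l0))%:Z + \sum_x (nonalt x)%:Z +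
    \sum_y \sum_(z | (lval l z).+1 == lval l y) (#|P|%:Z - (lval l y)%:Z) * u y z)); last first.
  by rewrite big_split /= X0 addr0.
apply: eq_bigr => l _.
rewrite natz PoszM mdeg_delta mulr_sumr.
pose g (y : P) : int := #|P|%:Z - (lval l y)%:Z.
(* The weight [g y] equals n - l(z) - 1, so the contributions of S at both ends of a step telescope
   along l. *)
transitivity (\sum_y \sum_(z | (lval l z).+1 == lval l y)
   (g y * u y z + g y + (#|P|%:Z - (lval l z)%:Z - 1) * (S z)%:Z - g y * (S y)%:Z)).
  apply: eq_bigr => y _; rewrite mulr_sumr; apply: eq_bigr => z /eqP zy.
  by rewrite /u /g -zy; lia.
pose G1 := \sum_y \sum_(z | (lval l z).+1 == lval l y) g y * u y z.
pose G2 := \sum_y \sum_(z | (lval l z).+1 == lval l y) g y.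
pose G3 := \sum_y \sum_(z | (lval l z).+1 == lval l y) (#|P|%:Z - (lval l z)%:Z - 1) * (S z)%:Z.
pose G4 := \sum_y \sum_(z | (lval l z).+1 == lval l y) g y * (S y)%:Z.
transitivity (G1 + G2 + G3 - G4).
  rewrite /G1 /G2 /G3 /G4 -!big_split -sumrB; apply: eq_bigr => y _ /=.
  by rewrite -!big_split -sumrB.
rewrite /G2 /G3 /G4 (sum_succ_up l g) (sum_succ_up l (fun y => g y * (S y)%:Z)).
rewrite (sum_succ_down l (fun z => (#|P|%:Z - (lval l z)%:Z - 1) * (S z)%:Z)).
have [y0 ly0] := lval_surj l P0.
have y0E y : (0 < lval l y)%N = (y != y0).
  by rewrite lt0n -ly0 (inj_eq (@lval_inj _ _ l)).
rewrite !(eq_bigl _ _ y0E).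
have -> : \sum_(z | ((lval l z).+1 < #|P|)%N) (#|P|%:Z - (lval l z)%:Z - 1) * (S z)%:Z =
    \sum_z (g z - 1) * (S z)%:Z.
  rewrite [LHS]big_mkcond; apply: eq_bigr => z _; case: ifP => // /negbT.
  rewrite -leqNgt => nz; suff -> : g z - 1 = 0 by rewrite mul0r.
  by rewrite /g; have := lval_lt l z; lia.
(* The boundary term of the telescoping: the first element of l is minimal, hence in S. *)
have Sy0 : S y0.
  by apply: S_min => b; apply/negP => /(lval_mono l); rewrite ly0.
have e1 : \sum_y g y = \sum_(y | y != y0) g y + #|P|%:Z.
  by rewrite (bigD1 y0) //= /g ly0 subr0 addrC.
have e2 : \sum_y g y * (S y)%:Z = \sum_(y | y != y0) g y * (S y)%:Z + #|P|%:Z.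
  by rewrite (bigD1 y0) //= Sy0 /g ly0 subr0 mulr1 addrC.
have e3 : \sum_z (g z - 1) * (S z)%:Z = \sum_y g y * (S y)%:Z - \sum_y (S y)%:Z.
  by rewrite -sumrB; apply: eq_bigr => z _; rewrite mulrBl mul1r.
have e4 : \sum_x (nonalt x)%:Z = #|P|%:Z - \sum_y (S y)%:Z.
  rewrite -[X in X - _]natz cardT -cardE -sumr_const -sumrB; apply: eq_bigr => x _.
  by rewrite /nonalt; case: (S x).
have e5 : \sum_y g y = #|P|%:Z * #|P|%:Z - (mdeg (lval l))%:Z.
  rewrite sumrB sumr_const cardT -cardE -mulr_natl natz; congr (_ - _).
  by rewrite /mdeg -[RHS]natz natr_sum; apply: eq_bigr => y _; rewrite natz.
have e6 : (2 * mdeg (lval l) + #|P| = #|P| * #|P|)%N.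
  rewrite /mdeg (sum_lval id) /=; elim: (#|P|) => [|n IH]; first by rewrite big_ord0.
  rewrite big_ord_recr /=; move: IH; move: (\sum_(i < n) i)%N => s; nia.
have e7 := mdeg_lval l0 l.
rewrite -/G1; move: e1 e2 e3 e4 e5 e6 e7.
move: G1 (\sum_y g y) (\sum_(y | y != y0) g y) (\sum_y g y * (S y)%:Z)
  (\sum_(y | y != y0) g y * (S y)%:Z) (\sum_z (g z - 1) * (S z)%:Z) (\sum_y (S y)%:Z)
  (\sum_x (nonalt x)%:Z) (mdeg (lval l)) (mdeg (lval l0)) #|P|.
move=> a1 a2 a3 a4 a5 a6 a7 a8 a9 a10 n; clear; lia.
Qed.

End Alternating.

(** * Parity of heights *)

Section RankedMod2.
Context {d : Order.disp_t} {P : finPOrderType d}.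
Implicit Types (C D : {set P}).

Definition chain_below (a : P) C : bool :=
  [&& is_chain C, a \in C & [forall x in C, (x <= a)%O]].

Definition chain_above (a : P) C : bool :=
  [&& is_chain C, a \in C & [forall x in C, (a <= x)%O]].

Definition height (a : P) : nat := \max_(C | chain_below a C) #|C|.

Lemma is_chain_set1 (a : P) : is_chain [set a].
Proof.
apply/forallP => x; apply/forallP => y; apply/implyP; rewrite !inE.
by move=> /andP[/eqP -> /eqP ->]; exact: comparablexx.
Qed.

Lemma is_chainP C : reflect {in C &, forall x y, (x >=< y)%O} (is_chain C).
Proof.
apply: (iffP forallP) => [H x y xC yC|H x].
  by have /forallP/(_ y)/implyP := H x; apply; rewrite xC.
by apply/forallP => y; apply/implyP => /andP[]; exact: H.
Qed.

Lemma is_chain_sub C D : C \subset D -> is_chain D -> is_chain C.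
Proof.
move=> /fintype.subsetP CD /is_chainP H; apply/is_chainP => x y xC yC.
by apply: H; exact: CD.
Qed.

(** An element comparable with the whole union is below a, above b, or strictly between them; the
    first two cases would lengthen C or D. Used for covers and also for a = b. *)
Lemma maximal_chain_glue (a b : P) C D : (a <= b)%O ->
  (forall x, ~ ((a < x)%O /\ (x < b)%O)) ->
  chain_below a C -> (forall C', chain_below a C' -> (#|C'| <= #|C|)%N) ->
  chain_above b D -> (forall D', chain_above b D' -> (#|D'| <= #|D|)%N) ->
  maximal_chain (C :|: D).
Proof.
move=> ab nab /and3P[Cc aC /forall_inP Ca] Cm /and3P[Dc bD /forall_inP Db] Dm.
apply/maxsetP; split.
  apply/is_chainP => x y; rewrite !inE => /orP[xC|xD] /orP[yC|yD].
  - by move/is_chainP: Cc; apply.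
  - exact: le_comparable (le_trans (Ca _ xC) (le_trans ab (Db _ yD))).
  - rewrite comparable_sym.
    exact: le_comparable (le_trans (Ca _ yC) (le_trans ab (Db _ xD))).
  - by move/is_chainP: Dc; apply.
move=> X Xc CDX; have /is_chainP XP := Xc; apply/eqP; rewrite finset.eqEsubset CDX andbT.
have CX : C \subset X by apply: fintype.subset_trans CDX; exact: finset.subsetUl.
have DX : D \subset X by apply: fintype.subset_trans CDX; exact: finset.subsetUr.
have aX : a \in X by move/fintype.subsetP: CX; apply.
have bX : b \in X by move/fintype.subsetP: DX; apply.
apply/fintype.subsetP => x xX; rewrite inE; apply/orP.
have [xa|nxa] := boolP (x <= a)%O.
  left; apply: contraT => xC.
  have := Cm (x |: C); rewrite cardsU1 xC add1n ltnn => -> //.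
  apply/and3P; split; rewrite ?inE ?aC ?orbT //.
    by apply: is_chain_sub Xc; rewrite finset.subUset finset.sub1set xX.
  by apply/forall_inP => y; rewrite !inE => /orP[/eqP -> //|/Ca].
have [bx|nbx] := boolP (b <= x)%O.
  right; apply: contraT => xD.
  have := Dm (x |: D); rewrite cardsU1 xD add1n ltnn => -> //.
  apply/and3P; split; rewrite ?inE ?bD ?orbT //.
    by apply: is_chain_sub Xc; rewrite finset.subUset finset.sub1set xX.
  by apply/forall_inP => y; rewrite !inE => /orP[/eqP -> //|/Db].
case: (nab x); split.
  by rewrite (comparable_ltNge (XP _ _ aX xX)).
by rewrite (comparable_ltNge (XP _ _ xX bX)).
Qed.

Lemma exists_max_card (Q : pred {set P}) C0 : Q C0 ->
  exists2 C, Q C & forall C', Q C' -> (#|C'| <= #|C|)%N.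
Proof.
by move=> QC0; case: (arg_maxnP (fun C : {set P} => #|C|) QC0) => C QC Cm; exists C.
Qed.

Lemma chain_below1 (a : P) : chain_below a [set a].
Proof.
by apply/and3P; split; rewrite ?is_chain_set1 ?inE //; apply/forall_inP => x /set1P ->.
Qed.

Lemma chain_above1 (a : P) : chain_above a [set a].
Proof.
by apply/and3P; split; rewrite ?is_chain_set1 ?inE //; apply/forall_inP => x /set1P ->.
Qed.

Lemma height_max a C : chain_below a C -> (forall C', chain_below a C' -> (#|C'| <= #|C|)%N) ->
  height a = #|C|.
Proof.
move=> Ca Cm; apply/eqP; rewrite eqn_leq; apply/andP; split; first exact/bigmax_leqP.
exact: (leq_bigmax_cond _ Ca).
Qed.

Hypothesis P_ranked : ranked_mod2 P.

(** Longest chains C below a and B below b extend by the same D above b to maximal chains; these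
    have #|C| + #|D| and #|B| + #|D| - 1 elements, as B and D share b. *)
Lemma height_cover (a b : P) : covered a b -> odd (height a) = ~~ odd (height b).
Proof.
move=> [ab nab].
have [C Ca Cm] := exists_max_card (chain_below1 a).
have [B Bb Bm] := exists_max_card (chain_below1 b).
have [D Db Dm] := exists_max_card (chain_above1 b).
rewrite (height_max Ca Cm) (height_max Bb Bm).
have m1 := maximal_chain_glue (ltW ab) nab Ca Cm Db Dm.
have m2 : maximal_chain (B :|: D).
  apply: maximal_chain_glue Bb Bm Db Dm => // x [h1 h2].
  by have := lt_trans h1 h2; rewrite ltxx.
move: Ca Bb Db => /and3P[_ aC /forall_inP Ca] /and3P[_ bB /forall_inP Bb] /and3P[_ bD /forall_inP Db].
have c1 : (#|C :|: D| = #|C| + #|D|)%N.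
  rewrite cardsU (_ : C :&: D = finset.set0) ?cards0 ?subn0 //.
  apply/setP => x; rewrite !inE; apply/negP => /andP[/Ca xa /Db bx].
  by have := lt_le_trans ab (le_trans bx xa); rewrite ltxx.
have c2 : (#|B :|: D|.+1 = #|B| + #|D|)%N.
  rewrite cardsU (_ : B :&: D = [set b]) ?cards1.
    by have := cardsD1 b B; have := cardsD1 b D; rewrite bB bD /=; lia.
  apply/setP => x; rewrite !inE; apply/andP/eqP => [[/Bb xb /Db bx]|-> //].
  by apply/eqP; rewrite eq_le xb.
have := P_ranked m1 m2; rewrite /chain_length c1.
have B0 : (0 < #|B|)%N by apply/card_gt0P; exists b.
have D0 : (0 < #|D|)%N by apply/card_gt0P; exists b.
have -> : #|B :|: D| = (#|B| + #|D|).-1 by rewrite -c2.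
move: B0 D0; case: #|B| => // p; case: #|D| => // q _ _.
rewrite !addnS !addSn /= !oddD /=.
by case: (odd #|C|); case: (odd p); case: (odd q).
Qed.

Lemma height_min (a : P) : (forall b, ~~ (b < a)%O) -> odd (height a).
Proof.
move=> am; rewrite (@height_max a [set a]) ?cards1 ?chain_below1 // => C /and3P[_ _ /forall_inP Ca].
rewrite -(cards1 a) subset_leq_card //; apply/fintype.subsetP => x /Ca.
by rewrite inE le_eqVlt (negbTE (am x)) orbF.
Qed.

End RankedMod2.

(** * The Gram matrix *)

Section Gram.
Context {d : Order.disp_t} {P : finPOrderType d}.
Local Notation N := #|{: @linext d P}|.
Context {F : fieldType} (alpha : {set P} -> F).
Hypothesis alpha0 : forall J, upper_ideal J -> alpha J != 0.
Variable l0 : @linext d P.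
Local Notation swpart := (wpart #|P| (anti_label l0)).

(** [rho m] is the coefficient of the top descent monomial in a chosen expansion of m. At e(P)
    solutions the matrix of descent monomials is invertible, so this coefficient is also a
    combination of point evaluations. *)
Lemma residue_exists : exists rho : (P -> nat) -> (nat -> F) -> F,
  (forall m, swpart m -> graded (mdeg m) (mdeg (lval l0)) (rho m)) /\
  (forall (K : fieldType) (f : {rmorphism F -> K}) v (t : 'I_N -> P -> K),
     (forall i a, t i a != 0) -> injective t ->
     (forall i j, (0 < j <= #|P|)%N -> theta alpha f (t i) j = f (v j)) ->
     exists2 c : 'I_N -> K, \sum_i c i * monom (t i) (lval l0) = 1 &
       forall m, swpart m -> f (rho m v) = \sum_i c i * monom (t i) m).
Proof.
have rex m : exists r, swpart m -> expansion alpha (anti_label l0) m r.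
  have [mw|nmw] := pselect (swpart m); last by exists (fun _ _ => 0).
  have [r rE] := expansion_exists alpha0 (@anti_label_inj _ _ l0) (anti_label_bound l0) mw.
  by exists r.
have [r rE] := choice rex.
exists (fun m => r m l0); split=> [m mw|K f v t t0 ti tv].
  by have [+ _] := rE m mw; move=> /(_ l0); rewrite delta_anti.
have Efree := deltamx_free alpha0 (@anti_label_inj _ _ l0) (anti_label_bound l0) t0 ti tv.
have Eu : deltamx (anti_label l0) t \in unitmx by rewrite -row_free_unit.
pose c := (\row_j (enum_val j == l0)%:R : 'rV[K]_N) *m invmx (deltamx (anti_label l0) t).
have cE l : \sum_i c 0 i * monom (t i) (delta (anti_label l0) l) = (l == l0)%:R.
  have : c *m deltamx (anti_label l0) t = \row_j (enum_val j == l0)%:R by rewrite mulmxKV.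
  move=> /rowP/(_ (enum_rank l)); rewrite !mxE enum_rankK => <-.
  by apply: eq_bigr => i _; rewrite [deltamx _ _ _ _]mxE enum_rankK.
exists (c 0) => [|m mw]; first by rewrite -(delta_anti l0) cE eqxx.
have [_ /(_ K f)mE] := rE m mw.
rewrite (eq_bigr (fun i => \sum_l f (r m l v) * (c 0 i * monom (t i) (delta (anti_label l0) l)))).
  rewrite exchange_big (bigD1 l0) //= -mulr_sumr cE eqxx mulr1 big1 ?addr0 // => l /negbTE nl.
  by rewrite -mulr_sumr cE nl mulr0.
by move=> i _; rewrite (mE _ v) ?mulr_sumr; [apply: eq_bigr => l _; rewrite mulrCA | exact: tv].
Qed.

Variable S : pred P.
Hypothesis S_cover : forall a b, covered a b -> S a = ~~ S b.
Hypothesis S_min : forall a, (forall b, ~~ (b < a)%O) -> S a.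
Variable rho : (P -> nat) -> (nat -> F) -> F.
Hypothesis rho_graded : forall m, swpart m -> graded (mdeg m) (mdeg (lval l0)) (rho m).

Definition gexp (l l' : @linext d P) : P -> nat := fun x =>
  (delta (alt_label S) l x + delta (alt_label S) l' x - nonalt S x)%N.

Definition gram (v : nat -> F) : 'M[F]_N :=
  \matrix_(i, j) rho (gexp (enum_val i) (enum_val j)) v.

Definition gdeg (i : 'I_N) : nat := mdeg (delta (alt_label S) (enum_val i)).

(** The Gram entry (i, j) has weighted degree [gdeg i + gdeg j - gshift]. *)
Definition gshift : nat := (mdeg (lval l0) + \sum_x nonalt S x)%N.

Let wpart_alt l := wpart_delta (@alt_label_inj _ _ S) (alt_label_bound S) l.

Lemma gexp_wpart l l' : swpart (gexp l l').
Proof. exact: alt_wpart_add. Qed.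

Lemma gexpE l l' x : (gexp l l' x + nonalt S x =
  delta (alt_label S) l x + delta (alt_label S) l' x)%N.
Proof.
rewrite /gexp subnK //; apply: (leq_trans (alt_wpart_pos S_cover S_min x (wpart_alt l))).
exact: leq_addr.
Qed.

Lemma gram_sym v : (gram v)^T = gram v.
Proof.
apply/matrixP => i j; rewrite !mxE; congr (rho _ v); apply/funext => x.
by rewrite /gexp addnC.
Qed.

Lemma gram_graded i j :
  graded (gdeg i + gdeg j) gshift (fun v => gram v i j).
Proof.
have := rho_graded (gexp_wpart (enum_val i) (enum_val j)).
have e : (mdeg (gexp (enum_val i) (enum_val j)) + \sum_x nonalt S x = gdeg i + gdeg j)%N.
  by rewrite /mdeg /gdeg /mdeg -!big_split; apply: eq_bigr => x _ /=; rewrite gexpE.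
rewrite /graded /gshift -e leq_add2r; case: ifP => _ H.
  by rewrite subnDr => x v; rewrite !mxE H.
by move=> v; rewrite mxE H.
Qed.

Lemma gram_scale v x i j :
  x ^+ gshift * gram (fun k => x ^+ k * v k) i j = x ^+ gdeg i * gram v i j * x ^+ gdeg j.
Proof.
have := gram_graded i j; rewrite /graded; case: leqP => h H.
  have /= -> := H x v; rewrite mulrA -exprD subnKC // exprD; exact: mulrAC.
have /= -> := H v; have /= -> := H (fun k => x ^+ k * v k).
by rewrite !mulr0 mul0r.
Qed.

Lemma scale0 (v : nat -> F) : v 0%N = 0 -> (fun k => 0 ^+ k * v k) = (fun=> 0).
Proof. by move=> v0; apply/funext => -[|k]; rewrite ?v0 ?mulr0 // exprS mul0r mul0r. Qed.

(** By [alt_degree] each Leibniz term has total degree 0. Either one of its entries has negative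
    degree and vanishes, or all of them have degree 0, and such entries agree at v and at 0. *)
Lemma gram_det v : (0 < #|P|)%N -> v 0%N = 0 -> \det (gram v) = \det (gram (fun=> 0)).
Proof.
move=> P0 v0; apply: eq_bigr => s _; congr (_ * _).
have [H|H] := pselect (forall i, (gshift <= gdeg i + gdeg (s i))%N); last first.
  have [i iH] : exists i, ~~ (gshift <= gdeg i + gdeg (s i))%N.
    by apply: contrapT => n; apply: H => i; apply: contraT => h; case: n; exists i.
  have := gram_graded i (s i); rewrite /graded (negbTE iH) => G0.
  by rewrite (bigD1 i) //= [RHS](bigD1 i) //= !G0 !mul0r.
have sumE : (\sum_i (gdeg i + gdeg (s i)) = \sum_(i < N) gshift)%N.
  rewrite big_split /= [X in (_ + X)%N](_ : _ = \sum_i gdeg i)%N; last first.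
    by rewrite [RHS](reindex_inj (@perm_inj _ s)).
  rewrite addnn -mul2n big_distrr /= sum_nat_const card_ord.
  rewrite -(alt_degree S_cover S_min l0 P0) (reindex (enum_val (A := {: @linext d P}))) //=.
  by apply: onW_bij; exact: enum_val_bij.
have eqd i : (gdeg i + gdeg (s i) = gshift)%N.
  apply/eqP; rewrite eqn_leq H andbT leqNgt; apply/negP => lt.
  have := sumE; apply/eqP; rewrite neq_ltn; apply/orP; right.
  by rewrite (bigD1 i) //= [ltnRHS](bigD1 i) //= -addSn leq_add // leq_sum.
apply: eq_bigr => i _; have := gram_graded i (s i).
rewrite /graded eqd leqnn subnn => /(_ 0 v); rewrite expr0 mul1r => <-.
by rewrite scale0.
Qed.

(** Evaluation at a point is multiplicative, so the pairing is diagonal in the values at the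
    solutions. *)
Lemma gram_factor (K : fieldType) (f : {rmorphism F -> K}) v (t : 'I_N -> P -> K) (c : 'I_N -> K) :
  (forall i a, t i a != 0) ->
  (forall m, swpart m -> f (rho m v) = \sum_i c i * monom (t i) m) ->
  map_mx f (gram v) = (deltamx (alt_label S) t)^T *m
    diag_mx (\row_k (c k / monom (t k) (nonalt S))) *m deltamx (alt_label S) t.
Proof.
move=> t0 cE; apply/matrixP => i j; rewrite !mxE cE; last exact: gexp_wpart.
apply: eq_bigr => k _; rewrite mul_mx_diag !mxE.
have h0 : monom (t k) (nonalt S) != 0.
  by apply/prodf_neq0 => x _; rewrite expf_neq0.
apply: (mulIf h0); rewrite -mulrA -mulrA -mulrA mulrAC.
have -> : monom (t k) (gexp (enum_val i) (enum_val j)) * monom (t k) (nonalt S) =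
  monom (t k) (delta (alt_label S) (enum_val i)) * monom (t k) (delta (alt_label S) (enum_val j)).
  rewrite /monom -!big_split; apply: eq_bigr => x _ /=.
  by rewrite -!exprD gexpE.
by field.
Qed.

End Gram.

(** * Solutions for widely spaced values of the Wronski map *)

HB.instance Definition _ (R : realType) (n : nat) := Complete.on 'rV[R]_n.

Section BoxFixpoint.
Context {R : realType} (n : nat).
Implicit Types (y z : 'rV[R]_n) (a b D : R).

Definition in_box a b y : Prop := forall i, a <= y 0 i <= b.

Lemma rV_normP y D : 0 <= D -> (`|y| <= D) <-> (forall i, `|y 0 i| <= D).
Proof.
move=> D0; rewrite -[`|y|]/(mx_norm y) mx_normrE; split=> [H i|H].
  exact: le_trans (le_bigmax _ (fun ij => `|y ij.1 ij.2|) (0, i)) H.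
by apply/bigmax_leP; split=> // -[i j] _ /=; rewrite ord1.
Qed.

Lemma closed_box a b : closed [set y | in_box a b y]%classic.
Proof.
rewrite (_ : [set y | _]%classic =
   \bigcap_(i in [set: 'I_n]) ((fun y => y 0 i) @^-1` `[a, b]))%classic; last first.
  apply/seteqP; split=> y /= H i; first by move=> _ /=; rewrite in_itv /=; exact: H.
  by have := H i I; rewrite /= in_itv.
apply: closed_bigI => i _; apply: preimage_closed; last exact: itv_closed.
by move=> y _; exact: coord_continuous.
Qed.

Lemma box_fixpoint a b (Phi : 'rV[R]_n -> 'rV[R]_n) : a <= b ->
  (forall y, in_box a b y -> in_box a b (Phi y)) ->
  (forall y z D, in_box a b y -> in_box a b z -> (forall i, `|y 0 i - z 0 i| <= D) ->
     forall i, `|Phi y 0 i - Phi z 0 i| <= D / 2) ->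
  exists2 y, in_box a b y & Phi y = y.
Proof.
move=> ab Pbox Plip; pose U := [set y | in_box a b y]%classic.
have PU : set_fun U U Phi by move=> y; exact: Pbox.
pose f : {fun U >-> U} := HB.pack Phi (isFun.Build _ _ U U Phi PU).
have cf : is_contraction f.
  have q0 : (0 : R) <= 2^-1 by rewrite invr_ge0.
  exists (NngNum q0); split=> /=; first by lra.
  move=> [y z] [/= yU zU]; apply/rV_normP; first by rewrite mulr_ge0.
  move=> i; rewrite !mxE [_^-1 * _]mulrC; apply: Plip => // j.
  by have /(rV_normP (y - z) (normr_ge0 _)) := lexx `|y - z|; move=> /(_ j); rewrite !mxE.
have U0 : (U !=set0)%classic.
  by exists (const_mx a) => i; rewrite mxE lexx ab.
by have [y Uy yE] := banach_fixed_point cf (closed_box (b:=b)) U0; exists y.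
Qed.

(** One constant bounds both the values and the Lipschitz quotient, which makes the class closed
    under products. *)
Definition bounded_lip a b (g : 'rV[R]_n -> R) : Prop :=
  exists B, forall y z, in_box a b y -> in_box a b z ->
    `|g y| <= B /\ forall D, 0 <= D -> (forall i, `|y 0 i - z 0 i| <= D) -> `|g y - g z| <= B * D.

Lemma bounded_lip_cst a b c : bounded_lip a b (fun=> c).
Proof.
exists `|c| => y z _ _; split=> // D D0 _; rewrite subrr normr0 mulr_ge0 //.
Qed.

Lemma bounded_lip_mul a b g h : bounded_lip a b g -> bounded_lip a b h ->
  bounded_lip a b (fun y => g y * h y).
Proof.
move=> [B gB] [C hC]; exists (2 * (`|B| * `|C|) ) => y z yb zb.
have [g1 g2] := gB y z yb zb; have [h1 h2] := hC y z yb zb.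
have [g3 _] := gB z y zb yb.
have nB : B <= `|B| by exact: ler_norm.
have nC : C <= `|C| by exact: ler_norm.
split=> [|D D0 yz].
  rewrite normrM; apply: (@le_trans _ _ (`|B| * `|C|)).
    by apply: ler_pM => //; [exact: le_trans nB | exact: le_trans nC].
  by rewrite ler_peMl ?mulr_ge0 //; lra.
have -> : g y * h y - g z * h z = (g y - g z) * h y + g z * (h y - h z) by ring.
apply: (le_trans (ler_normD _ _)); rewrite !normrM.
have e1 : `|g y - g z| * `|h y| <= (`|B| * D) * `|C|.
  apply: ler_pM => //; last exact: le_trans nC.
  by apply: (le_trans (g2 D D0 yz)); rewrite ler_wpM2r.
have e2 : `|g z| * `|h y - h z| <= `|B| * (`|C| * D).
  apply: ler_pM => //; first exact: le_trans nB.
  by apply: (le_trans (h2 D D0 yz)); rewrite ler_wpM2r.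
have -> : 2 * (`|B| * `|C|) * D = `|B| * D * `|C| + `|B| * (`|C| * D) by ring.
exact: lerD.
Qed.

Lemma bounded_lip_prod (T : finType) (Q : pred T) a b (g : T -> 'rV[R]_n -> R) :
  (forall k, bounded_lip a b (g k)) -> bounded_lip a b (fun y => \prod_(k | Q k) g k y).
Proof.
move=> H; suff : forall s : seq T, bounded_lip a b (fun y => \prod_(k <- s | Q k) g k y) by exact.
elim=> [|k s IH].
  rewrite (_ : (fun y => _) = fun=> 1); first exact: bounded_lip_cst.
  by apply/funext => y; rewrite big_nil.
rewrite (_ : (fun y => _) = fun y => (if Q k then g k y else 1) * \prod_(k <- s | Q k) g k y).
  by apply: bounded_lip_mul IH; case: (Q k) => //; exact: bounded_lip_cst.
by apply/funext => y; rewrite big_cons; case: (Q k); rewrite ?mul1r.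
Qed.

Lemma bounded_lip_coord a b i : bounded_lip a b (fun y => y 0 i).
Proof.
exists (`|a| + `|b| + 1) => y z yb zb; split=> [|D D0 yz]; last first.
  apply: (le_trans (yz i)); rewrite ler_peMl //.
  by have := normr_ge0 a; have := normr_ge0 b; lra.
have /andP[h1 h2] := yb i; rewrite ler_norml; have := ler_norm b; have := ler_norm (- a).
rewrite normrN => h3 h4; have := normr_ge0 a; have := normr_ge0 b => h5 h6.
by apply/andP; split; lra.
Qed.

Lemma bounded_lip_inv b i : bounded_lip 2^-1 b (fun y => (y 0 i)^-1).
Proof.
exists 4 => y z yb zb; have /andP[y1 _] := yb i; have /andP[z1 _] := zb i.
have y0 : 0 < y 0 i by lra.
have z0 : 0 < z 0 i by lra.
have iy : (y 0 i)^-1 <= 2 by rewrite invf_ple ?posrE.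
have iz : (z 0 i)^-1 <= 2 by rewrite invf_ple ?posrE.
split=> [|D D0 yz]; first by rewrite ger0_norm ?invr_ge0 ?ltW //; lra.
have -> : (y 0 i)^-1 - (z 0 i)^-1 = (y 0 i)^-1 * (z 0 i)^-1 * - (y 0 i - z 0 i).
  by field; rewrite !gt_eqF.
rewrite normrM normrN; apply: ler_pM => //.
have iy0 : 0 <= (y 0 i)^-1 by rewrite invr_ge0 ltW.
have iz0 : 0 <= (z 0 i)^-1 by rewrite invr_ge0 ltW.
rewrite normrM (ger0_norm iy0) (ger0_norm iz0).
have -> : 4 = 2 * 2 :> R by ring.
exact: ler_pM.
Qed.

End BoxFixpoint.

(** * One positive solution per linear extension *)

Section Asymptotics.
Context {R : realType} {d : Order.disp_t} {P : finPOrderType d}.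
Local Notation n := #|P|.
Variable beta : {set P} -> R.
Hypothesis beta_gt0 : forall J, upper_ideal J -> 0 < beta J.

(** The exponent of s^-1 in the monomial of [topset l i] when t_x has the order of s^-1 to the power
    l(x). *)
Definition csum (i : nat) : nat := (\sum_(k < n | i <= k) k)%N.

Section OneExtension.
Variable l : @linext d P.

Lemma csumE i : (\sum_(x in topset l i) lval l x = csum i)%N.
Proof.
rewrite /csum [RHS]big_mkcond -(sum_lval (fun k => if (i <= k)%N then k else 0)%N l) big_mkcond.
by apply: eq_bigr => x _; rewrite inE.
Qed.

(** The default 1 at i = n belongs to the empty top set. *)
Let yext (y : 'rV[R]_n) (i : nat) : R := oapp (fun j => y 0 j) 1 (insub i).

Let b (i : nat) : R := if (i < n)%N then beta (topset l i) else 1.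

(** Chosen so that the product over [topset l i] telescopes to y_i / b_i. *)
Let ratio (x : P) (y : 'rV[R]_n) : R :=
  (yext y (lval l x) * (b (lval l x))^-1) * ((yext y (lval l x).+1)^-1 * b (lval l x).+1).

Let b_gt0 i : 0 < b i.
Proof. by rewrite /b; case: ifP => // _; apply: beta_gt0; exact: topset_ideal. Qed.

Let yext_ord (y : 'rV[R]_n) (i : 'I_n) : yext y i = y 0 i.
Proof. by rewrite /yext valK. Qed.

Let yext_gt0 a y i : 0 < a -> in_box a 1 y -> 0 < yext y i.
Proof.
move=> a0 yb; rewrite /yext; case: insubP => //= j _ _.
by have /andP[h _] := yb j; exact: lt_le_trans h.
Qed.

Let ratio_gt0 a y x : 0 < a -> in_box a 1 y -> 0 < ratio x y.
Proof.
move=> a0 yb; rewrite /ratio !mulr_gt0 ?invr_gt0 ?b_gt0 //; exact: yext_gt0 yb.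
Qed.

Let prod_ratio a y i : 0 < a -> in_box a 1 y -> (i <= n)%N ->
  \prod_(x in topset l i) ratio x y = yext y i / b i.
Proof.
move=> a0 yb iN; rewrite -(subKn iN); elim: (n - i)%N (leq_subr i n) => [|k IH] kn.
  rewrite subn0 big_pred0; last by move=> x; rewrite inE leqNgt lval_lt.
  by rewrite /yext insubN ?ltnn //= /b ltnn divr1.
have kn' : (n - k.+1 < n)%N by rewrite ltn_subrL /=; apply: leq_trans kn.
have kS : ((n - k.+1).+1 = n - k)%N by rewrite subnSK.
have [x lx] := lval_surj l kn'.
rewrite (big_setD1 x) /=; last by rewrite inE lx.
have -> : topset l (n - k.+1) :\ x = topset l (n - k).
  apply/setP => z; rewrite !inE -kS -(inj_eq (@lval_inj _ _ l)) lx.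
  by rewrite [RHS]ltn_neqAle eq_sym.
rewrite (IH (ltnW kn)) /ratio lx kS.
have := yext_gt0 (n - k) a0 yb; have := b_gt0 (n - k) => b0 y0.
by field; rewrite !gt_eqF.
Qed.

Let ratio_lip x : bounded_lip 2^-1 1 (ratio x).
Proof.
apply: bounded_lip_mul; apply: bounded_lip_mul; try exact: bounded_lip_cst.
  rewrite /yext; case: insubP => /= [j _ _|_]; first exact: bounded_lip_coord.
  exact: bounded_lip_cst.
rewrite /yext; case: insubP => /= [j _ _|_]; first exact: bounded_lip_inv.
exact: bounded_lip_cst.
Qed.

Let other (i : nat) : pred {set P} :=
  fun J => [&& upper_ideal J, #|J| == (n - i)%N & J != topset l i].

Let expo (i : nat) (J : {set P}) : nat := (csum i - \sum_(x in J) lval l x)%N.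

Let expo_gt0 i J : (i <= n)%N -> other i J -> (\sum_(x in J) lval l x < csum i)%N.
Proof.
move=> iN /and3P[_ /eqP cJ nJ]; rewrite -csumE.
apply: exchange_top; rewrite 1?eq_sym // ?card_topset // => x y.
by rewrite !inE -ltnNge => h1 h2; exact: leq_trans h2 h1.
Qed.

(* The unknowns are the values y_i of [beta T_i * t^(T_i)] for T_i = [topset l i],
   in units of [s^-1 ^+ csum i]. For a positive solution in which the values
   t_x decrease fast along [l], the other monomials of the same size are smaller
   by a factor [s], so the system is a contraction near y = 1. *)
Lemma solution_near (e : R) : 0 < e -> e <= 2^-1 ->
  exists2 s0 : R, 0 < s0 & forall s, 0 < s -> s <= s0 ->
  exists t : P -> R, [/\ forall x, 0 < t x,
    forall i, (i < n)%N ->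
      \sum_(J : {set P} | upper_ideal J && (#|J| == (n - i)%N)) beta J * \prod_(x in J) t x
        = s^-1 ^+ csum i &
    forall i, (i < n)%N -> (1 - e) * s^-1 ^+ csum i <= beta (topset l i) * \prod_(x in topset l i) t x].
Proof.
move=> e0 e2.
have glip J : bounded_lip 2^-1 1 (fun y => beta J * \prod_(x in J) ratio x y).
  apply: bounded_lip_mul; first exact: bounded_lip_cst.
  by apply: bounded_lip_prod => x; exact: ratio_lip.
have [B BP] := choice glip.
(* For s <= e / M every perturbation G_i below lies in [0, e] and has Lipschitz constant at most s M
   <= e <= 1/2. *)
pose M := 1 + \sum_(J : {set P}) `|B J|.
have M1 : 1 <= M by rewrite lerDl sumr_ge0.
have M0 : 0 < M by lra.
exists (e / M); first by rewrite divr_gt0.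
move=> s s_gt0 sM.
have s1 : s <= 1.
  apply: (le_trans sM); rewrite ler_pdivrMr //; lra.
have seM : s * M <= e by rewrite -ler_pdivlMr.
pose G (i : nat) y := \sum_(J | other i J) s ^+ expo i J * (beta J * \prod_(x in J) ratio x y).
(* The equation y_i = 1 - G_i(y) is the one for ideals of size n - i, divided by
   [s^-1 ^+ csum i]. *)
pose Phi (y : 'rV[R]_n) : 'rV[R]_n := \row_i (1 - G i y).
have box_le (y : 'rV[R]_n) : in_box (1 - e) 1 y -> in_box 2^-1 1 y.
  by move=> yb i; have /andP[h1 h2] := yb i; apply/andP; split=> //; lra.
have half : (0 : R) < 1 - e by lra.
have s_expo i J : (i <= n)%N -> other i J -> s ^+ expo i J <= s.
  move=> iN oJ; have := expo_gt0 iN oJ; rewrite -subn_gt0 -/(expo i J).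
  by case: (expo i J) => // k _; rewrite exprS ler_piMr ?exprn_ile1 ?(ltW s_gt0).
have sumB (Q : pred {set P}) : \sum_(J | Q J) `|B J| <= M.
  apply: (@le_trans _ _ (\sum_(J : {set P}) `|B J|)); last by rewrite /M lerDr.
  by rewrite [leLHS]big_mkcond; apply: ler_sum => J _; case: ifP.
have [y yb yE] : exists2 y, in_box (1 - e) 1 y & Phi y = y.
  apply: box_fixpoint; first by lra.
    move=> y yb i; rewrite mxE.
    have G0 : 0 <= G i y.
      apply: sumr_ge0 => J /and3P[IJ _ _]; rewrite mulr_ge0 ?exprn_ge0 ?(ltW s_gt0) //.
      rewrite mulr_ge0 ?(ltW (beta_gt0 IJ)) // prodr_ge0 // => x _.
      exact: ltW (ratio_gt0 _ half yb).
    have Ge : G i y <= e.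
      apply: le_trans seM; apply: (@le_trans _ _ (\sum_(J | other i J) s * `|B J|)).
        apply: ler_sum => J oJ.
        have [H _] := BP J y y (box_le _ yb) (box_le _ yb).
        apply: ler_pM; rewrite ?exprn_ge0 ?(ltW s_gt0) //.
        - have /and3P[IJ _ _] := oJ.
          rewrite mulr_ge0 ?(ltW (beta_gt0 IJ)) // prodr_ge0 // => x _.
          exact: ltW (ratio_gt0 _ half yb).
        - by apply: s_expo => //; exact: ltnW.
        by apply: le_trans (ler_norm _) (le_trans H (ler_norm _)).
      by rewrite -mulr_sumr ler_wpM2l ?(ltW s_gt0).
    by apply/andP; split; lra.
  move=> y z D yb zb yz i; rewrite !mxE.
  have D0 : 0 <= D by exact: le_trans (yz i).
  have -> : 1 - G i y - (1 - G i z) = - (G i y - G i z) by ring.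
  rewrite normrN /G -sumrB; apply: (le_trans (ler_norm_sum _ _ _)).
  apply: (@le_trans _ _ (\sum_(J | other i J) s * (`|B J| * D))).
    apply: ler_sum => J oJ; rewrite -mulrBr normrM.
    have [_ H] := BP J y z (box_le _ yb) (box_le _ zb).
    apply: ler_pM => //.
      by rewrite ger0_norm ?exprn_ge0 ?(ltW s_gt0) //; apply: s_expo => //; exact: ltnW.
    by apply: (le_trans (H D D0 yz)); rewrite ler_wpM2r // ler_norm.
  rewrite -mulr_sumr -mulr_suml mulrA [D / 2]mulrC; apply: ler_wpM2r => //.
  apply: (@le_trans _ _ (s * M)); first by rewrite ler_wpM2l ?(ltW s_gt0).
  lra.
pose t x := s^-1 ^+ lval l x * ratio x y.
have prod_t J : \prod_(x in J) t x = s^-1 ^+ (\sum_(x in J) lval l x) * \prod_(x in J) ratio x y.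
  by rewrite /t big_split /= expr_sum.
have ye i : y 0 i = 1 - G i y by rewrite -{1}yE mxE.
have top_t i : (i < n)%N -> beta (topset l i) * \prod_(x in topset l i) t x =
    s^-1 ^+ csum i * yext y i.
  move=> iN; rewrite prod_t csumE (prod_ratio half yb (ltnW iN)) /b iN.
  have b0 : beta (topset l i) != 0 by rewrite gt_eqF // beta_gt0 // topset_ideal.
  by field.
exists t; split.
- by move=> x; rewrite mulr_gt0 ?exprn_gt0 ?invr_gt0 // (ratio_gt0 _ half yb).
- move=> i iN; rewrite (bigD1 (topset l i)) /=; last by rewrite topset_ideal card_topset eqxx.
  have -> : \prod_(j in topset l i) t j = \prod_(x in topset l i) t x by [].
  rewrite top_t // (yext_ord y (Ordinal iN)) ye /= mulrBr mulr1.
  rewrite -[RHS]addr0 -addrA; congr (_ + _); apply/eqP; rewrite addrC subr_eq0; apply/eqP.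
  rewrite mulr_sumr; apply: eq_big => [J|J oJ]; first by rewrite /other andbA.
  rewrite prod_t; have oJ' : other i J by rewrite /other andbA.
  have := expo_gt0 (ltnW iN) oJ'; rewrite /expo => lt.
  have -> : s^-1 ^+ csum i = s^-1 ^+ (\sum_(x in J) lval l x) *
      (s ^+ (csum i - \sum_(x in J) lval l x))^-1.
    by rewrite -exprVn -exprD addnC subnK // ltnW.
  have s0 : s ^+ (csum i - \sum_(x in J) lval l x)%N != 0 by rewrite expf_neq0 // gt_eqF.
  by field.
move=> i iN; rewrite top_t // mulrC ler_wpM2l ?exprn_ge0 ?invr_ge0 ?(ltW s_gt0) //.
rewrite (yext_ord y (Ordinal iN)); by have /andP[] := yb (Ordinal iN).
Qed.

End OneExtension.

(** A common s is required: only then do the points for all the extensions share the same values of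
    the Wronski map. *)
Lemma solutions_exist (e : R) : 0 < e -> e <= 2^-1 ->
  exists s : R, 0 < s /\ forall l : @linext d P,
  exists t : P -> R, [/\ forall x, 0 < t x,
    forall i, (i < n)%N ->
      \sum_(J : {set P} | upper_ideal J && (#|J| == (n - i)%N)) beta J * \prod_(x in J) t x
        = s^-1 ^+ csum i &
    forall i, (i < n)%N -> (1 - e) * s^-1 ^+ csum i <= beta (topset l i) * \prod_(x in topset l i) t x].
Proof.
move=> e0 e2.
have H (l : @linext d P) : exists s0 : R, 0 < s0 /\ forall s, 0 < s -> s <= s0 ->
  exists t : P -> R, [/\ forall x, 0 < t x,
    forall i, (i < n)%N ->
      \sum_(J : {set P} | upper_ideal J && (#|J| == (n - i)%N)) beta J * \prod_(x in J) t x
        = s^-1 ^+ csum i &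
    forall i, (i < n)%N -> (1 - e) * s^-1 ^+ csum i <= beta (topset l i) * \prod_(x in topset l i) t x].
  by have [s0 s00 sP] := solution_near l e0 e2; exists s0.
have [f fP] := choice H.
exists (\big[Order.min/1]_(l : @linext d P) f l); split.
  by apply: lt_bigmin => // l _; have [h _] := fP l.
move=> l; have [h1 h2] := fP l; apply: h2; last exact: bigmin_le.
by apply: lt_bigmin => // l' _; have [h _] := fP l'.
Qed.

End Asymptotics.

(** * Signs of the residue coefficients at widely spaced values *)

Section Degenerate.
Context {R : realType} {d : Order.disp_t} {P : finPOrderType d}.
Local Notation n := #|P|.
Local Notation N := #|{: @linext d P}|.

(** If M is the largest |x_j|, then |x_i - y_i| <= M / 3, so M <= 1 + M / 3 and x_i is within 1/2 of
    y_i, which is a sign. *)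
Lemma near_identity_signs k (A : 'I_k -> 'I_k -> R) (x y : 'I_k -> R) (e : R) :
  (forall i j, `|A i j - (i == j)%:R| <= e) -> k%:R * e <= 3^-1 ->
  (forall i, \sum_j x j * A i j = y i) -> (forall i, `|y i| = 1) ->
  forall i, 0 < y i * x i.
Proof.
move=> Ae ke xA y1 i0; have k0 : (0 < k)%N by apply: leq_ltn_trans (ltn_ord i0).
have [j0 _ jmax] := @Order.TotalTheory.arg_maxP _ _ _ i0 xpredT (fun j => `|x j|) isT.
pose M := `|x j0|.
have close i : `|x i - y i| <= 3^-1 * M.
  have -> : x i - y i = \sum_j x j * ((i == j)%:R - A i j).
    under eq_bigr do rewrite mulrBr.
    rewrite sumrB xA; congr (_ - _); rewrite (bigD1 i) //= eqxx mulr1 big1 ?addr0 // => j /negbTE.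
    by rewrite eq_sym => ->; rewrite mulr0.
  apply: (le_trans (ler_norm_sum _ _ _)).
  apply: (@le_trans _ _ (\sum_(j < k) M * e)).
    apply: ler_sum => j _; rewrite normrM distrC.
    by apply: ler_pM => //; exact: jmax.
  rewrite sumr_const card_ord -[M * e *+ k]mulr_natr.
  rewrite (_ : M * e * k%:R = k%:R * e * M); last by ring.
  by rewrite ler_wpM2r // normr_ge0.
have M2 : M <= 3 / 2.
  have := close j0; have := ler_normD (x j0 - y j0) (y j0); rewrite subrK y1 -/M; lra.
have := close i0 => h; have {h} : `|x i0 - y i0| <= 2^-1 by lra.
have yy : y i0 * y i0 = 1 by rewrite -expr2 -real_normK ?num_real // y1 expr1n.
have -> : y i0 * x i0 = 1 + y i0 * (x i0 - y i0) by rewrite mulrBr yy addrC subrK.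
move=> h; have : `|y i0 * (x i0 - y i0)| <= 2^-1 by rewrite normrM y1 mul1r.
rewrite ler_norml => /andP[]; lra.
Qed.

Variable alpha : {set P} -> R.
Hypothesis alpha_weight : is_weight alpha.
Variable l0 : @linext d P.
Local Notation swpart := (wpart #|P| (anti_label l0)).

Let alpha0 J : upper_ideal J -> alpha J != 0.
Proof. by case: alpha_weight => H _; exact: H. Qed.

(** The sign shared by all ideals of size j; any ideal of that size may represent it. *)
Let sgn (j : nat) : R := Num.sg (alpha (topset l0 (n - j))).

Let alphaE J : upper_ideal J -> (0 < #|J|)%N -> alpha J = sgn #|J| * `|alpha J|.
Proof.
move=> IJ J0; have [_ H] := alpha_weight.
rewrite [LHS]numEsg /sgn; congr (_ * _); apply: H => //; first exact: topset_ideal.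
by rewrite card_topset subKn // max_card.
Qed.

(** The element x belongs to the top sets of levels 0, ..., l(x), that is to l(x) + 1 of them. *)
Lemma prod_topset_monom (t : P -> R) (l : @linext d P) :
  \prod_(j < n) \prod_(x in topset l j) t x = (\prod_x t x) * monom t (lval l).
Proof.
rewrite /monom -big_split /=.
under eq_bigr do rewrite big_mkcond.
rewrite exchange_big /=; apply: eq_bigr => x _; rewrite -exprS -big_mkcond /=.
rewrite (eq_bigl (fun j : 'I_n => (j < (lval l x).+1)%N)) => [|j]; last by rewrite inE ltnS.
by rewrite -(big_ord_widen n (fun=> t x) (lval_lt l x)) prodr_const card_ord.
Qed.

(** Suitably normalised, the monomials [lval l] at the points form a matrix close to the identity,
    while [rho_sign] gives their residues up to a common factor as signs of permutations. Solving
    the linear system for [c] therefore yields these signs. *)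
Lemma degenerate_point (rho : (P -> nat) -> (nat -> R) -> R) :
  (forall m, swpart m -> graded (mdeg m) (mdeg (lval l0)) (rho m)) ->
  exists v, v 0%N = 0 /\ exists t : 'I_N -> P -> R,
  [/\ forall i a, 0 < t i a, injective t,
    forall i j, (0 < j <= n)%N -> theta alpha idfun (t i) j = v j &
    forall c : 'I_N -> R, \sum_i c i * monom (t i) (lval l0) = 1 ->
      (forall m, swpart m -> rho m v = \sum_i c i * monom (t i) m) ->
    forall i, exists s : 'S_n, (forall a, s (val l0 a) = val (enum_val i : @linext d P) a) /\
      0 < (-1) ^+ s * c i].
Proof.
move=> rho_graded.
pose beta J := `|alpha J|.
have beta0 J : upper_ideal J -> 0 < beta J by move=> /alpha0; rewrite normr_gt0.
(* A product of n shares, each within e of 0 or 1, is off by at most (n + 1) e, and N such errors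
   must stay below 1/3. *)
pose e : R := (3 * n.+1%:R * N.+1%:R)^-1.
have nR : (1 : R) <= n.+1%:R by rewrite ler1n.
have NR : (1 : R) <= N.+1%:R by rewrite ler1n.
have nN : (1 : R) <= n.+1%:R * N.+1%:R by rewrite mulr_ege1.
have e0 : 0 < e by rewrite invr_gt0 -mulrA mulr_gt0 // (lt_le_trans ltr01 nN).
have eE : e * (n.+1%:R * N.+1%:R) = 3^-1.
  by rewrite /e -mulrA invfM -mulrA mulVf ?mulr1 // gt_eqF.
have e3 : e <= 3^-1.
  by rewrite -eE ler_peMr // ltW.
have e2 : e <= 2^-1 by lra.
have [s [s0 sP]] := solutions_exist beta0 e0 e2.
have [tl tlP] := choice sP.
pose T (i : nat) : R := s^-1 ^+ csum (P := P) i.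
have T0 i : 0 < T i by rewrite exprn_gt0 // invr_gt0.
pose v j : R := if (0 < j <= n)%N then sgn j * T (n - j)%N else 0.
exists v; split; first by rewrite /v.
pose t (i : 'I_N) := tl (enum_val i).
(* The share of the monomial of [topset l j] in the sum over the ideals of its size, at the point i.
   Shares of distinct ideals add up to at most 1, so when the point's own top set takes 1 - e, any
   other gets at most e. *)
pose a (l : @linext d P) (j : nat) (i : 'I_N) : R :=
  beta (topset l j) * (\prod_(x in topset l j) t i x) / T j.
have t0 i x : 0 < t i x by have [H _ _] := tlP (enum_val i); exact: H.
have a0 l j i : 0 <= a l j i.
  rewrite /a mulr_ge0 ?invr_ge0 ?(ltW (T0 _)) // mulr_ge0 ?normr_ge0 //.
  by apply: prodr_ge0 => x _; exact: ltW.
have term0 i J : 0 <= beta J * \prod_(x in J) t i x.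
  by rewrite mulr_ge0 ?normr_ge0 // prodr_ge0 // => x _; exact: ltW.
have a1 l j i : (j < n)%N -> a l j i <= 1.
  move=> jn; rewrite /a ler_pdivrMr // mul1r.
  have [_ /(_ j jn) E _] := tlP (enum_val i); rewrite -[T j]E.
  rewrite (bigD1 (topset l j)) /=; last by rewrite topset_ideal card_topset eqxx.
  by rewrite lerDl; apply: sumr_ge0 => J _; exact: term0.
have adiag j i : (j < n)%N -> 1 - e <= a (enum_val i) j i.
  move=> jn; rewrite /a ler_pdivlMr //.
  by have [_ _ /(_ j jn)] := tlP (enum_val i).
have aoff l j i : (j < n)%N -> topset l j != topset (enum_val i) j -> a l j i <= e.
  move=> jn ne; suff : a l j i + a (enum_val i) j i <= 1.
    by have := adiag j i jn; lra.
  rewrite /a -mulrDl ler_pdivrMr // mul1r.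
  have [_ /(_ j jn) E _] := tlP (enum_val i); rewrite -[T j]E.
  rewrite (bigD1 (topset l j)) /=; last by rewrite topset_ideal card_topset eqxx.
  rewrite lerD2l (bigD1 (topset (enum_val i) j)) /=.
    by rewrite lerDl; apply: sumr_ge0 => J _; exact: term0.
  by rewrite topset_ideal card_topset eqxx eq_sym.
have topne (l l' : @linext d P) : l != l' -> exists2 j, (j < n)%N & topset l j != topset l' j.
  move=> ne; have [//|H] := pselect (exists2 j, (j < n)%N & topset l j != topset l' j).
  have {}H j : (j < n)%N -> topset l j = topset l' j.
    by move=> jn; apply/eqP; apply: contraT => h; case: H; exists j.
  case/eqP: ne; apply: linext_eq => x; apply/eqP; rewrite eqn_leq; apply/andP; split.
    have := H _ (lval_lt l x) => /setP/(_ x); rewrite !inE leqnn => /esym.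
    by [].
  by have := H _ (lval_lt l' x) => /setP/(_ x); rewrite !inE leqnn.
have thetaE i j : (0 < j <= n)%N -> theta alpha idfun (t i) j = v j.
  move=> jn; rewrite /v jn; have /andP[j0 jn'] := jn.
  have jn2 : (n - j < n)%N by rewrite ltn_subrL j0; exact: leq_trans jn'.
  have [_ /(_ _ jn2) + _] := tlP (enum_val i); rewrite subKn // /T => <-.
  rewrite /theta mulr_sumr; apply: eq_bigr => J /andP[IJ /eqP cJ].
  by rewrite /= alphaE ?cJ // mulrA.
exists t; split=> // [i i'|].
  move=> tii'; apply: enum_val_inj; apply/eqP; apply: contraT => /topne[j jn ne].
  have := aoff _ _ i' jn ne; have := adiag j i jn.
  by rewrite /a tii'; lra.
move=> c c1 cE.
pose L m := \sum_i c i * monom (t i) m.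
have L_theta m j : (0 < j <= n)%N -> swpart m ->
  \sum_(J : {set P} | upper_ideal J && (#|J| == j)) alpha J * L (shift m J) = v j * L m.
  move=> jn _; rewrite /L mulr_sumr.
  rewrite (eq_bigr (fun J => \sum_i c i * (alpha J * monom (t i) (shift m J)))); last first.
    by move=> J _; rewrite mulr_sumr; apply: eq_bigr => i _; rewrite mulrCA.
  rewrite exchange_big; apply: eq_bigr => i _ /=; rewrite -mulr_sumr.
  have := theta_monom alpha idfun (t i) m j; rewrite thetaE //= => <-.
  by rewrite mulrCA.
have L_low m : swpart m -> (mdeg m < mdeg (lval l0))%N -> L m = 0.
  move=> mw mlt; rewrite /L -cE //; have := rho_graded m mw.
  by rewrite /graded leqNgt mlt.
pose p i := \prod_x t i x.
have p0 i : 0 < p i by apply: prodr_gt0 => x _.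
pose K := \prod_(j < n) beta (topset l0 j).
have K0 : 0 < K by apply: prodr_gt0 => j _; apply: beta0; exact: topset_ideal.
pose TT := \prod_(j < n) T j.
have TT0 : 0 < TT by apply: prodr_gt0 => j _.
have [sg sgP] := choice (rho_sign (rho := L) (l0 := l0) alpha0 L_theta L_low).
pose x i := c i / p i * TT / K.
pose A (j i : 'I_N) := \prod_(k < n) a (enum_val j) k i.
have prodalpha l : \prod_(j < n) alpha (topset l j) =
    (\prod_(j < n) sgn (n - j)%N) * \prod_(j < n) beta (topset l j).
  rewrite -big_split; apply: eq_bigr => j _ /=.
  by rewrite {1}alphaE ?topset_ideal // card_topset ?subn_gt0.
have sgn0 : \prod_(j < n) sgn (n - j)%N != 0.
  by apply/prodf_neq0 => j _; rewrite /sgn sgr_eq0 alpha0 // topset_ideal.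
have Lsgn l : L (lval l) * \prod_(j < n) beta (topset l j) = (-1) ^+ sg l * K.
  have [_] := sgP l; rewrite !prodalpha.
  have -> : L (lval l0) = 1 by [].
  move=> H; apply: (mulfI sgn0).
  by rewrite mulrCA H mul1r mulrCA.
have xA (j : 'I_N) : \sum_i x i * A j i = (-1) ^+ sg (enum_val j).
  apply: (mulIf (lt0r_neq0 K0)); rewrite -Lsgn mulr_suml /L mulr_suml.
  apply: eq_bigr => i _; rewrite /x /A /a big_split /= big_split /= prodfV -/TT.
  rewrite prod_topset_monom -/(p i).
  have pi := lt0r_neq0 (p0 i); have k0 := lt0r_neq0 K0; have tt := lt0r_neq0 TT0.
  by field; rewrite pi k0 tt.
have A01 j i : 0 <= A j i <= 1.
  apply/andP; split; first by apply: prodr_ge0 => k _.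
  by apply: prodr_ile1 => k _; rewrite a0 a1.
have AE j i : `|A j i - (j == i)%:R| <= n.+1%:R * e.
  have [->|ne] := eqVneq j i.
    have /andP[_ h] := A01 i i; rewrite -[true%:R]/(1 : R) distrC ger0_norm ?subr_ge0 //.
    suff : 1 - n%:R * e <= A i i by rewrite -natr1; lra.
    (* Bernoulli's inequality for q factors between 1 - e and 1. *)
    rewrite /A; suff : forall q, (q <= n)%N -> 1 - q%:R * e <= \prod_(k < n | (k < q)%N) a (enum_val i) k i.
      move=> /(_ n (leqnn n)); rewrite (eq_bigl xpredT) // => k; exact: ltn_ord.
    elim=> [|q IH] qn; first by rewrite big_pred0 ?mul0r ?subr0.
    rewrite (bigD1 (Ordinal qn)) //=.
    rewrite (eq_bigl (fun k : 'I_n => (k < q)%N)); last first.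
      by move=> k; rewrite -(inj_eq val_inj) /= ltnS ltn_neqAle andbC.
    have := IH (ltnW qn); have := adiag q i qn.
    set u := \prod_(_ < _ | _) _; have u1 : 0 <= u <= 1.
      apply/andP; split; first by apply: prodr_ge0 => k _.
      by apply: prodr_ile1 => k _; rewrite a0 a1.
    move: (a _ _ _) => w hw hu; have /andP[u0 u1'] := u1; rewrite -natr1.
    have [h1|h1] := lerP 0 (1 - e); nra.
  have [k kn ne'] : exists2 k, (k < n)%N & topset (enum_val j) k != topset (enum_val i) k.
    by apply: topne; rewrite (inj_eq enum_val_inj).
  have /andP[h0 _] := A01 j i; rewrite subr0 ger0_norm //.
  rewrite /A (bigD1 (Ordinal kn)) //=.
  have h2 : \prod_(k' < n | k' != Ordinal kn) a (enum_val j) k' i <= 1.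
    by apply: prodr_ile1 => k' _; rewrite a0 a1.
  apply: (@le_trans _ _ (e * 1)).
    by apply: ler_pM => //; [apply: prodr_ge0 | exact: aoff].
  by rewrite mulr1 -natr1 mulrDl mul1r lerDr; apply: mulr_ge0 => //; exact: ltW.
move=> i; exists (sg (enum_val i)); split; first by have [] := sgP (enum_val i).
have : 0 < (-1) ^+ sg (enum_val i) * x i.
  apply: (near_identity_signs AE _ xA) => [|j]; last by rewrite normrX normrN1 expr1n.
  rewrite -eE mulrA mulrC ler_pM2l // mulrC ler_pM2l ?ler_nat //; lra.
rewrite /x !mulrA pmulr_lgt0 ?invr_gt0 // pmulr_lgt0 // pmulr_lgt0 ?invr_gt0 //.
Qed.

End Degenerate.

(** * Inertia of Hermitian forms *)

Section Inertia.
Context {R : realType} (N : nat).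
Local Notation C := R[i].
Local Notation toC := (real_complex R).

Definition hform (G : 'M[R]_N) (x : 'rV[C]_N) : C :=
  \sum_i \sum_j x 0 i * toC (G i j) * Num.conj (x 0 j).

Lemma spectral_hform (G : 'M[R]_N) : G^T = G -> \det G != 0 ->
  exists U : 'M[C]_N, exists e : 'I_N -> C,
  [/\ U \in unitmx, forall k, e k \is Num.real, forall k, e k != 0 &
    forall x, hform G x = \sum_k e k * `|(x *m U) 0 k| ^+ 2].
Proof.
move=> GT G0; pose A : 'M[C]_N := map_mx toC G.
have Areal : A \is a mxOver Num.real.
  by apply/mxOverP => i j; rewrite mxE; apply/complex_realP; exists (G i j).
have Asym : A \is symmetricmx.
  by apply/is_hermitianmxP; rewrite expr0 scale1r map_mx_id //= /A map_trmx GT.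
have Aherm : A \is hermsymmx by apply: realsym_hermsym.
have /orthomx_spectralP AE := hermitian_normalmx Aherm.
have Su := spectral_unit A.
exists (invmx (spectralmx A)), (fun k => spectral_diag A 0 k); split.
- by rewrite unitmx_inv.
- by move=> k; have /mxOverP := hermitian_spectral_diag_real Aherm; apply.
- move=> k; have detA : \det A != 0 by rewrite det_map_mx fmorph_eq0.
  have := congr1 determinant AE.
  rewrite !det_mulmx det_inv mulrAC mulVf ?mul1r; last by rewrite -unitfE -unitmxE.
  by rewrite det_diag => e; move: detA; rewrite e => /prodf_neq0; apply.
move=> x; set Q := spectralmx A in AE Su *.
have QE : Q *m map_mx Num.conj x^T = map_mx Num.conj (x *m invmx Q)^T.
  rewrite invmx_unitary ?spectral_unitarymx // trmx_mul map_mxM /=.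
  by congr (_ *m _); rewrite [RHS]trmxCK.
have -> : hform G x = (x *m A *m map_mx Num.conj x^T) 0 0.
  rewrite mxE /hform exchange_big /=; apply: eq_bigr => j _; rewrite !mxE mulr_suml.
  by apply: eq_bigr => i _; rewrite !mxE.
rewrite {1}AE !mulmxA -mulmxA QE; move: (x *m invmx Q) => z.
rewrite mul_mx_diag mxE; apply: eq_bigr => k _.
by rewrite !mxE normCK mulrAC mulrC.
Qed.

Lemma hform_real (G : 'M[R]_N) x : G^T = G -> hform G x \is Num.real.
Proof.
move=> GT; apply/CrealP; rewrite /hform rmorph_sum exchange_big /=.
apply: eq_bigr => i _; rewrite rmorph_sum /=; apply: eq_bigr => j _.
have Gij : G i j = G j i by rewrite -{1}GT mxE.
have /CrealP GC : toC (G j i) \is Num.real by apply/complex_realP; exists (G j i).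
by rewrite !rmorphM /= conjCK Gij GC; ring.
Qed.

(** Fewer than N linear conditions on N coordinates; this replaces dimension counts for
    intersections of subspaces. *)
Lemma common_zero (k1 k2 : nat) (A1 : 'M[C]_(N, k1)) (A2 : 'M[C]_(N, k2))
    (S1 : pred 'I_k1) (S2 : pred 'I_k2) :
  (#|S1| + #|S2| < N)%N -> exists2 x : 'rV[C]_N, x != 0 &
    (forall k, S1 k -> (x *m A1) 0 k = 0) /\ (forall k, S2 k -> (x *m A2) 0 k = 0).
Proof.
move=> SN; pose M := row_mx (\matrix_(i < N, j < #|S1|) A1 i (enum_val j))
  (\matrix_(i < N, j < #|S2|) A2 i (enum_val j)).
have : kermx M != 0.
  rewrite kermx_eq0 /row_free neq_ltn; apply/orP; left.
  exact: leq_ltn_trans (rank_leq_col _) SN.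
case/rowV0Pn => x /sub_kermxP xM x0; exists x => //.
have : row_mx (x *m (\matrix_(i < N, j < #|S1|) A1 i (enum_val j)))
  (x *m (\matrix_(i < N, j < #|S2|) A2 i (enum_val j))) = row_mx 0 0.
  by rewrite -mul_mx_row xM row_mx0.
move=> /eq_row_mx[/rowP e1 /rowP e2]; split=> k Sk.
  have := e1 (enum_rank_in Sk k); rewrite !mxE => h; rewrite -[RHS]h; apply: eq_bigr => i _.
  by rewrite mxE enum_rankK_in.
have := e2 (enum_rank_in Sk k); rewrite !mxE => h; rewrite -[RHS]h; apply: eq_bigr => i _.
by rewrite mxE enum_rankK_in.
Qed.

Lemma mulr_le_sq (a b : C) : 0 <= a -> 0 <= b -> a * b <= a ^+ 2 + b ^+ 2.
Proof.
move=> a0 b0; have [|] := real_leP (ger0_real a0) (ger0_real b0) => ab.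
  by apply: ler_wpDl; rewrite ?exprn_ge0 // expr2 ler_wpM2r.
by apply: ler_wpDr; rewrite ?exprn_ge0 // expr2 ler_wpM2l // ltW.
Qed.

(** On the span of the positive eigenvectors G0 dominates a multiple of the squared norm, and a
    small change of the entries costs only a smaller multiple of it. *)
Lemma hform_perturb (G0 : 'M[R]_N) (U : 'M[C]_N) (e : 'I_N -> C) : G0^T = G0 ->
  U \in unitmx -> (forall k, e k \is Num.real) ->
  (forall x, hform G0 x = \sum_k e k * `|(x *m U) 0 k| ^+ 2) ->
  exists2 eta : R, 0 < eta & forall G : 'M[R]_N,
    G^T = G -> (forall i j, `|G i j - G0 i j| <= eta) ->
    forall x : 'rV[C]_N, x != 0 -> (forall k, ~~ (0 < e k) -> (x *m U) 0 k = 0) -> 0 < hform G x.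
Proof.
move=> G0T Uu er G0E; pose V := invmx U.
(* A positive lower bound for the positive eigenvalues, meaningful even if there are none. *)
pose delta : C := (1 + \sum_(k | 0 < e k) (e k)^-1)^-1.
have inv0 k : 0 < e k -> 0 <= (e k)^-1 by move=> h; rewrite invr_ge0 ltW.
have delta0 : 0 < delta by rewrite invr_gt0 ltr_pwDl // sumr_ge0.
have deltaE k : 0 < e k -> delta <= e k.
  move=> ek; rewrite -[leRHS]invrK lef_pV2 ?posrE ?invr_gt0 //; last first.
    by rewrite ltr_pwDl // sumr_ge0.
  rewrite (bigD1 k) //= addrCA lerDl addr_ge0 // sumr_ge0 // => k' /andP[h _].
  exact: inv0.
pose M : C := \sum_k \sum_i `|V k i|.
have M0 : 0 <= M by rewrite sumr_ge0 // => k _; rewrite sumr_ge0.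
pose b : C := M ^+ 2 * (2 * N%:R) + 1.
have b0 : 0 < b by rewrite ltr_pwDr // mulr_ge0 ?exprn_ge0 // mulr_ge0 ?ler0n.
have db : 0 < delta / b by rewrite divr_gt0.
have etaE := RRe_real (gtr0_real db).
set eta := complex.Re (delta / b) in etaE.
exists eta; first by rewrite -ltcR etaE.
move=> G GT Gn x x0 xU; set z := x *m U in xU.
have xz : x = z *m V by rewrite /z mulmxK.
pose S := \sum_k `|z 0 k|; pose Q := \sum_k `|z 0 k| ^+ 2.
have Q0 : 0 < Q.
  have [k zk] : exists k, z 0 k != 0.
    have z0 : z != 0 by apply: contraNneq x0 => z0; rewrite xz z0 mul0mx.
    by have /rV0Pn := z0.
  rewrite /Q (bigD1 k) //= ltr_pwDl ?exprn_gt0 ?normr_gt0 // sumr_ge0 // => k' _.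
have S2 : S ^+ 2 <= 2 * N%:R * Q.
  rewrite expr2 /S mulr_suml; apply: (@le_trans _ _ (\sum_k \sum_j (`|z 0 k| ^+ 2 + `|z 0 j| ^+ 2))).
    by apply: ler_sum => k _; rewrite mulr_sumr; apply: ler_sum => j _; apply: mulr_le_sq.
  rewrite le_eqVlt; apply/orP; left; apply/eqP.
  under eq_bigr do rewrite big_split /= sumr_const card_ord -/Q.
  by rewrite big_split /= sumrMnl sumr_const card_ord -/Q -[Q *+ N]mulr_natl; ring.
have xS : \sum_i `|x 0 i| <= M * S.
  apply: (@le_trans _ _ (\sum_i \sum_k `|z 0 k| * `|V k i|)).
    apply: ler_sum => i _; rewrite xz mxE; apply: (le_trans (ler_norm_sum _ _ _)).
    by apply: ler_sum => k _; rewrite normrM.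
  rewrite exchange_big /= mulr_sumr; apply: ler_sum => k _.
  rewrite -mulr_sumr [leRHS]mulrC; apply: ler_wpM2l => //.
  by rewrite /M [leRHS](bigD1 k) //= lerDl sumr_ge0 // => k' _; rewrite sumr_ge0.
pose E : C := \sum_i \sum_j x 0 i * toC (G i j - G0 i j) * Num.conj (x 0 j).
have GE : hform G x = hform G0 x + E.
  rewrite /hform /E -big_split; apply: eq_bigr => i _ /=.
  rewrite -big_split; apply: eq_bigr => j _ /=.
  by rewrite rmorphB; ring.
have En : `|E| <= (delta / b) * (M ^+ 2 * (2 * N%:R)) * Q.
  apply: (@le_trans _ _ (\sum_i \sum_j (delta / b) * (`|x 0 i| * `|x 0 j|))).
    apply: (le_trans (ler_norm_sum _ _ _)); apply: ler_sum => i _.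
    apply: (le_trans (ler_norm_sum _ _ _)); apply: ler_sum => j _.
    rewrite !normrM norm_conjC mulrAC [leRHS]mulrC; apply: ler_wpM2l; first exact: mulr_ge0.
    by rewrite -etaE normc_def /= expr0n /= addr0 sqrtr_sqr lecR.
  rewrite (eq_bigr (fun i => (delta / b) * `|x 0 i| * (\sum_j `|x 0 j|))); last first.
    by move=> i _; rewrite mulr_sumr; apply: eq_bigr => j _; rewrite mulrA.
  rewrite -mulr_suml -mulr_sumr -[leLHS]mulrA -[leRHS]mulrA; apply: ler_wpM2l; first exact: ltW.
  apply: (@le_trans _ _ ((M * S) * (M * S))).
    by apply: ler_pM => //; rewrite sumr_ge0.
  have -> : M * S * (M * S) = M ^+ 2 * S ^+ 2 by ring.
  rewrite -mulrA; apply: ler_wpM2l; first exact: exprn_ge0.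
  exact: S2.
have Er : E \is Num.real.
  have -> : E = hform G x - hform G0 x by rewrite GE addrC addKr.
  by rewrite rpredB // hform_real.
have h0 : delta * Q <= hform G0 x.
  rewrite G0E /Q mulr_sumr; apply: ler_sum => k _; rewrite -/z.
  have [ek|ek] := boolP (0 < e k); first by rewrite ler_wpM2r ?exprn_ge0 ?deltaE.
  by rewrite (xU k ek) normr0 expr0n /= !mulr0.
have Elt : `|E| < delta * Q.
  apply: (le_lt_trans En); rewrite ltr_pM2r // -mulrA gtr_pMr // mulrC ltr_pdivrMr // mul1r.
  by rewrite /b ltrDl.
rewrite GE; apply: (lt_le_trans (y := delta * Q - `|E|)); first by rewrite subr_gt0.
apply: lerD => //; rewrite lerNl -normrN; apply: real_ler_norm.
by rewrite rpredN.
Qed.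

End Inertia.

(** * Comparison of signatures *)

Section InertiaCount.
Context {R : realType} (N : nat).
Local Notation C := R[i].
Local Notation toC := (real_complex R).
Implicit Types (G : 'M[R]_N).

(* [G] is congruent, up to a positive factor, to matrices arbitrarily close to [G0]. *)
Definition degenerates_to G0 G : Prop := forall eta : R, 0 < eta ->
  exists G' (T : 'M[C]_N) (c : C), [/\ G'^T = G', forall i j, `|G' i j - G0 i j| <= eta,
    T \in unitmx, 0 < c & forall x, c * hform G' x = hform G (x *m T)].

Lemma hformN G x : hform (- G) x = - hform G x.
Proof.
rewrite /hform -sumrN; apply: eq_bigr => i _; rewrite -sumrN; apply: eq_bigr => j _.
by rewrite mxE rmorphN mulrN mulNr.
Qed.

Lemma degenerates_toN G0 G : degenerates_to G0 G -> degenerates_to (- G0) (- G).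
Proof.
move=> H eta /H[G' [T [c [GT Gn Tu c0 GE]]]]; exists (- G'), T, c; split=> //.
- by rewrite linearN /= GT.
- by move=> i j; rewrite !mxE -opprD normrN.
by move=> x; rewrite !hformN mulrN GE.
Qed.

Lemma positive_cone G0 G (U : 'M[C]_N) (e : 'I_N -> C) :
  G0^T = G0 -> U \in unitmx -> (forall k, e k \is Num.real) ->
  (forall x, hform G0 x = \sum_k e k * `|(x *m U) 0 k| ^+ 2) -> degenerates_to G0 G ->
  exists B : 'M[C]_N, forall y : 'rV[C]_N, y != 0 ->
    (forall k, ~~ (0 < e k) -> (y *m B) 0 k = 0) -> 0 < hform G y.
Proof.
move=> G0T Uu er G0E near; have [eta eta0 H] := hform_perturb G0T Uu er G0E.
have [G' [T [c [GT Gn Tu c0 GE]]]] := near eta eta0.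
exists (invmx T *m U) => y y0 yB.
have -> : y = (y *m invmx T) *m T by rewrite mulmxKV.
rewrite -GE mulr_gt0 // H //; last by move=> k /yB; rewrite mulmxA.
by apply: contraNneq y0 => h; rewrite -(mulmxKV Tu y) h mul0mx.
Qed.

(** The condition k <= s k selects one element of each 2-cycle and every fixed point. *)
Lemma card_below_involution (s : 'I_N -> 'I_N) : involutive s ->
  (#|[pred k : 'I_N | (k <= s k)%N]|.*2 = N + #|[pred k | s k == k]|)%N.
Proof.
move=> sI.
have e1 : (#|[pred k : 'I_N | (k <= s k)%N]| = #|[pred k : 'I_N | (k < s k)%N]| + #|[pred k | s k == k]|)%N.
  rewrite -!sum1_card (bigID (fun k => s k == k)) /= addnC; congr addn; apply: eq_bigl => k.
    by rewrite !inE -(inj_eq val_inj) ltn_neqAle andbC eq_sym.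
  rewrite !inE andbC; case: eqP => //= ->; exact: leqnn.
have e2 : (#|[pred k : 'I_N | (k < s k)%N]| = #|[pred k : 'I_N | (s k < k)%N]|)%N.
  rewrite -!sum1_card (reindex_inj (inv_inj sI)); apply: eq_bigl => k.
  by rewrite !inE sI.
have e3 : (#|[pred k : 'I_N | (k <= s k)%N]| + #|[pred k : 'I_N | (s k < k)%N]| = N)%N.
  rewrite -[RHS]card_ord -(cardC [pred k : 'I_N | (k <= s k)%N]); congr addn.
  by apply: eq_card => k; rewrite !inE ltnNge.
by rewrite -addnn; lia.
Qed.

(** Let a be the positive index of G0, p and q the numbers of positive and negative D_k, and h the
    number of orbits of s. Comparison with G1 gives a <= p and N - a <= q, hence equality. The form
    G2 vanishes once one coordinate per orbit does, so p, q <= h; and 2 h is N plus the number of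
    fixed points. *)
Lemma inertia_bound G0 G1 G2 (D : 'I_N -> R) (E1 : 'M[C]_N)
    (D2 : 'I_N -> C) (E2 : 'M[C]_N) (s : 'I_N -> 'I_N) :
  G0^T = G0 -> \det G0 != 0 -> degenerates_to G0 G1 -> degenerates_to G0 G2 ->
  (forall k, D k != 0) ->
  (forall x, hform G1 x = \sum_k toC (D k) * `|(x *m E1) 0 k| ^+ 2) ->
  involutive s ->
  (forall x, hform G2 x = \sum_k D2 k * ((x *m E2) 0 k * Num.conj ((x *m E2) 0 (s k)))) ->
  (#|[pred k | (0 < D k)%R]| <= #|[pred k | (D k < 0)%R]| + #|[pred k | s k == k]|)%N /\
  (#|[pred k | (D k < 0)%R]| <= #|[pred k | (0 < D k)%R]| + #|[pred k | s k == k]|)%N.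
Proof.
move=> G0T G0d near1 near2 D0 G1E sI G2E.
have [U [e [Uu er e0 G0E]]] := spectral_hform G0T G0d.
have G0NT : (- G0)^T = - G0 by rewrite linearN /= G0T.
have erN k : - e k \is Num.real by rewrite rpredN.
have G0NE x : hform (- G0) x = \sum_k - e k * `|(x *m U) 0 k| ^+ 2.
  by rewrite hformN G0E -sumrN; apply: eq_bigr => k _; rewrite mulNr.
have [B1 B1P] := positive_cone G0T Uu er G0E near1.
have [B2 B2P] := positive_cone G0T Uu er G0E near2.
have [B3 B3P] := positive_cone G0NT Uu erN G0NE (degenerates_toN near1).
have [B4 B4P] := positive_cone G0NT Uu erN G0NE (degenerates_toN near2).
pose a := #|[pred k | (0 < e k)%R]|.
have an : (#|[pred k | ~~ (0 < e k)%R]| = N - a)%N.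
  by rewrite -[N in RHS]card_ord -(cardC [pred k | (0 < e k)%R]) addKn; apply: eq_card.
have aN : (#|[pred k | ~~ (0 < - e k)%R]| = a)%N.
  apply: eq_card => k; rewrite !inE.
  by rewrite oppr_gt0 -real_leNgt ?real0 // le_eqVlt eq_sym (negbTE (e0 k)).
have a_le : (a <= N)%N by have := max_card [pred k | (0 < e k)%R]; rewrite card_ord.
pose p := #|[pred k | (0 < D k)%R]|; pose q := #|[pred k | (D k < 0)%R]|.
have pq : (p + q = N)%N.
  rewrite -[RHS]card_ord -(cardC [pred k | (0 < D k)%R]); congr addn.
  by apply: eq_card => k; rewrite !inE lt_neqAle D0 -leNgt.
have toC0 (r : R) : (toC r <= 0) = (r <= 0) by rewrite -(rmorph0 toC) lecR.
have h1 : (a <= p)%N.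
  suff : (N <= (N - a) + p)%N by move: a_le; clear; lia.
  rewrite leqNgt; apply/negP; rewrite -an => /(common_zero B1 E1)[x x0 [xB xE]].
  have := B1P x x0 xB; rewrite G1E => pos.
  suff /(lt_le_trans pos) : \sum_k toC (D k) * `|(x *m E1) 0 k| ^+ 2 <= 0 by rewrite ltxx.
  apply: sumr_le0 => k _; have [Dk|Dk] := ltP 0 (D k); first by rewrite xE // normr0 expr0n /= mulr0.
  by rewrite mulr_le0_ge0 ?exprn_ge0 // toC0.
have h2 : (N - a <= q)%N.
  suff : (N <= a + q)%N by move: a_le; clear; lia.
  rewrite leqNgt; apply/negP; rewrite -aN => /(common_zero B3 E1)[x x0 [xB xE]].
  have := B3P x x0 xB; rewrite hformN oppr_gt0 G1E => neg.
  suff h : 0 <= \sum_k toC (D k) * `|(x *m E1) 0 k| ^+ 2 by have := le_lt_trans h neg; rewrite ltxx.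
  apply: sumr_ge0 => k _; have [Dk|Dk] := ltP (D k) 0; first by rewrite xE // normr0 expr0n /= mulr0.
  by rewrite mulr_ge0 ?exprn_ge0 // -(rmorph0 toC) lecR.
pose h := #|[pred k : 'I_N | (k <= s k)%N]|.
have half x : (forall k : 'I_N, (k <= s k)%N -> (x *m E2) 0 k = 0) -> hform G2 x = 0.
  move=> xE; rewrite G2E big1 // => k _; case: (leqP k (s k)) => ks.
    by rewrite xE // mul0r mulr0.
  by rewrite (xE (s k)) ?sI ?(ltnW ks) // rmorph0 !mulr0.
have h3 : (a <= h)%N.
  suff : (N <= (N - a) + h)%N by move: a_le; clear; lia.
  rewrite leqNgt; apply/negP; rewrite -an => /(common_zero B2 E2)[x x0 [xB xE]].
  by have := B2P x x0 xB; rewrite half ?ltxx.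
have h4 : (N - a <= h)%N.
  suff : (N <= a + h)%N by move: a_le; clear; lia.
  rewrite leqNgt; apply/negP; rewrite -aN => /(common_zero B4 E2)[x x0 [xB xE]].
  by have := B4P x x0 xB; rewrite hformN half ?oppr0 ?ltxx.
have key (a' p' q' h' r : nat) : (h'.*2 = N + r -> a' <= p' -> N - a' <= q' -> a' <= h' ->
    N - a' <= h' -> p' + q' = N -> p' <= q' + r /\ q' <= p' + r)%N.
  by clear; lia.
exact: key (card_below_involution sI) h1 h2 h3 h4 pq.
Qed.

End InertiaCount.

(** * The volume of the order polytope *)

Section VolumeBound.
Context {R : realType}.

Lemma card_cons_tuple (T : finType) n (Q : pred (n.+1.-tuple T)) :
  (#|Q| = \sum_(k : T) #|[pred ks : n.-tuple T | Q [tuple of k :: ks]]|)%N.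
Proof.
rewrite -sum1_card (reindex (fun p : T * n.-tuple T => [tuple of p.1 :: p.2])) /=; last first.
  exists (fun t => (thead t, [tuple of behead t])) => [[k ks] _|t _] /=.
    by congr pair; apply: val_inj.
  by rewrite -tuple_eta.
rewrite -(pair_big_dep xpredT (fun (k : T) (ks : n.-tuple T) => Q [tuple of k :: ks]) (fun _ _ => 1%N)) /=.
by apply: eq_bigr => k _; rewrite -sum1_card.
Qed.

Lemma volume_ge0 n (A : set (n.-tuple R)) : (0 <= volume A)%E.
Proof.
by elim: n A => [|n IH] A /=; [exact: measure_ge0 | apply: integral_ge0 => x _; exact: IH].
Qed.

Let cell (K : nat) (k : 'I_K) : set R := [set` `]k%:R / K%:R, k.+1%:R / K%:R[].

Lemma cell_disjoint K (k k' : 'I_K) x : cell k x -> cell k' x -> k = k'.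
Proof.
rewrite /cell /= !in_itv /=.
have K0' : 0 < (K%:R : R) by rewrite ltr0n; exact: leq_ltn_trans (ltn_ord k).
rewrite !ltr_pdivrMr // !ltr_pdivlMr // => /andP[h1 h2] /andP[h3 h4]; apply: val_inj => /=.
have := lt_trans h1 h4; have := lt_trans h3 h2; rewrite !ltr_nat; lia.
Qed.

(** The integral of a nonnegative function is a supremum over the simple functions below it, hence
    monotone without measurability. The slice volumes need not be shown measurable. *)
Lemma le_integral_unmeasurable d (T : measurableType d) (mu : {measure set T -> \bar R})
  (f g : T -> \bar R) : (forall x, 0 <= f x)%E -> (forall x, f x <= g x)%E ->
  (\int[mu]_x f x <= \int[mu]_x g x)%E.
Proof.
move=> f0 fg; have g0 x : (0 <= g x)%E by exact: le_trans (f0 x) (fg x).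
rewrite !ge0_integralTE //; apply: ereal_sup_le => _ [h hf <-]; exists h => // x.
exact: le_trans (hf x) (fg x).
Qed.

Lemma volume_ge_cells (K : nat) n (Q : pred (n.-tuple 'I_K)) (A : set (n.-tuple R)) :
  (forall (ks : n.-tuple 'I_K) (v : n.-tuple R), Q ks -> (forall i, cell (tnth ks i) (tnth v i)) -> A v) ->
  ((#|Q|%:R / K%:R ^+ n)%:E <= volume A)%E.
Proof.
elim: n Q A => [|n IH] Q A QA.
  rewrite expr0 divr1 /= diracE; have [/eqP Q0|] := posnP #|Q|.
    by rewrite (eqP Q0) lee_fin ler0n.
  move=> /card_gt0P[ks kQ]; have -> : ([tuple] \in A) = true.
    by apply/mem_set; apply: (QA ks) => // -[].
  rewrite lee_fin ler_nat; apply: (leq_trans (max_card _)).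
  by rewrite card_tuple expn0.
have [K0|K0] := posnP K.
  have -> : (K%:R : R) = 0 by rewrite K0.
  by rewrite exprS mul0r invr0 mulr0; exact: volume_ge0.
have K0' : 0 < (K%:R : R) by rewrite ltr0n.
pose c (k : 'I_K) : R := #|[pred ks : n.-tuple 'I_K | Q [tuple of k :: ks]]|%:R / K%:R ^+ n.
have c0 k : 0 <= c k by rewrite divr_ge0 ?exprn_ge0 ?ler0n.
(* A step function below the slice volume, by the induction hypothesis on each cell. *)
pose g (x : R) : \bar R := (\sum_(k <- enum 'I_K) (c k)%:E * (\1_(cell k) x)%:E)%E.
have mc k : measurable (cell k : set R) by exact: measurable_itv.
have intg : (\int[lebesgue_measure]_x g x = (#|Q|%:R / K%:R ^+ n.+1)%:E)%E.
  rewrite ge0_integral_sum //=; last first.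
  - by move=> k x _; rewrite mule_ge0 ?lee_fin.
  - by move=> k; apply: measurable_funeM; apply/measurable_EFinP; apply: measurable_indic; exact: mc.
  transitivity (\sum_(k <- enum 'I_K) (c k / K%:R)%:E)%E.
    apply: eq_bigr => k _.
    rewrite ge0_integralZl_EFin //=; last first.
      by apply/measurable_EFinP; apply: measurable_indic; exact: mc.
    rewrite integral_indic //; last exact: mc.
    transitivity ((c k)%:E * lebesgue_measure (cell k : set R))%E.
      by congr (_ * _)%E; congr (lebesgue_measure _); exact: classical_sets.setIT.
    rewrite /cell lebesgue_measure_itv /= lte_fin ltr_pM2r ?invr_gt0 //.
    by rewrite ltr_nat ltnSn -EFinB -EFinM -mulrBl -natrB // subSnn mul1r.
  transitivity ((\sum_(k <- enum 'I_K) (c k / K%:R))%:E); first exact: sumEFin.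
  rewrite big_enum. congr EFin. rewrite /=.
  rewrite card_cons_tuple natr_sum. rewrite -!mulr_suml exprS invfM.
  by rewrite mulrA mulrAC.
rewrite -intg /=; apply: le_integral_unmeasurable => x.
  by apply: sume_ge0 => k _; rewrite mule_ge0 ?lee_fin.
have [[k xk]|H] := pselect (exists k : 'I_K, cell k x); last first.
  rewrite /g big1 ?volume_ge0 // => k _; rewrite indicE memNset ?mule0 // => xk.
  by apply: H; exists k.
rewrite /g (bigD1_seq k) ?mem_enum ?enum_uniq //= big1 => [|k' k'k]; last first.
  rewrite indicE memNset ?mule0 // => /(cell_disjoint xk) e.
  by rewrite e eqxx in k'k.
rewrite adde0 indicE mem_set // mule1; apply: IH => ks v Qks vks.
apply: (QA [tuple of k :: ks]) => // i; case: (unliftP ord0 i) => [j ->|->].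
  by rewrite !tnthS.
by rewrite !tnth0.
Qed.

End VolumeBound.

(** * Lattice cells and linear extensions *)

Section VolumeCount.
Context {d : Order.disp_t} {P : finPOrderType d}.
Local Notation n := #|P|.
Local Notation N := #|{: @linext d P}|.

(** The falling factorial falls short of K^m by at most m^2 K^(m-1); multiplied by K and written
    without subtraction. *)
Lemma ffact_lower K m : (K ^ m.+1 <= K ^_ m * K + m ^ 2 * K ^ m)%N.
Proof.
elim: m => [|m IH]; first by rewrite expn1 ffactn0 mul1n leq_addr.
rewrite ffactnSr; have [mK|Km] := ltnP m K; last first.
  rewrite (_ : K - m = 0)%N ?muln0 ?mul0n ?add0n; last by apply/eqP; rewrite subn_eq0.
  rewrite expnS leq_mul2r; apply/orP; right.
  by apply: (leq_trans (leq_trans Km (leqnSn m))); rewrite expnS expn1 leq_pmulr.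
have h := leq_mul IH (leqnn (K - m)).
rewrite [(K ^ m.+2)%N]expnS [(K ^ m.+1)%N]expnS in h *.
have e : K = (K - m + m)%N by rewrite subnK // ltnW.
move: h; move: (K ^_ m) (K ^ m)%N => q p; move: {mK IH} (K - m)%N e => r -> h; nia.
Qed.

Definition strict_index K (ks : n.-tuple 'I_K) : bool :=
  [forall a : P, forall b : P, (a < b)%O ==>
     (tnth ks (enum_rank a) < tnth ks (enum_rank b))%N].

Lemma sorted_enum_ord K (D : {set 'I_K}) : sorted (relpre val ltn) (enum D).
Proof.
rewrite /(enum _) -enumT; apply: sorted_filter => [x y z|]; first exact: ltn_trans.
by rewrite -sorted_map val_enum_ord iota_ltn_sorted.
Qed.

(** Placing the elements of an n-subset in increasing order along l gives a strict indexing that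
    determines both the subset and l. *)
Lemma card_strict_index K : (N * 'C(K.+1, n) <= #|@strict_index K.+1|)%N.
Proof.
pose ksof (p : @linext d P * {set 'I_K.+1}) : n.-tuple 'I_K.+1 :=
  [tuple nth ord0 (enum p.2) (lval p.1 (enum_val i)) | i < n].
have ksE p x : tnth (ksof p) (enum_rank x) = nth ord0 (enum p.2) (lval p.1 x).
  by rewrite tnth_mktuple enum_rankK.
pose A := [pred p : @linext d P * {set 'I_K.+1} | #|p.2| == n].
have cA : #|A| = (N * 'C(K.+1, n))%N.
  have c := card_draws 'I_K.+1 n; rewrite card_ord in c.
  rewrite -c -cardX; apply: eq_card => -[l D].
  by rewrite !inE.
rewrite -cA -(@card_in_imset _ _ ksof A).
  apply: subset_leq_card; apply/fintype.subsetP => _ /imsetP[[l D] /eqP /= cD ->].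
  apply/forallP => a; apply/forallP => b; apply/implyP => ab; rewrite !ksE /=.
  apply: (sorted_ltn_nth (leT := relpre val ltn)); last exact: lval_mono.
  - by move=> x y z; exact: ltn_trans.
  - exact: sorted_enum_ord.
  - by rewrite inE -cardE cD lval_lt.
  by rewrite inE -cardE cD lval_lt.
move=> [l D] [l' D']; rewrite !inE /= => /eqP cD /eqP cD' e.
have xE x : nth ord0 (enum D) (lval l x) = nth ord0 (enum D') (lval l' x).
  by rewrite -(ksE (l, D)) -(ksE (l', D')) e.
have DE (l1 : @linext d P) (D1 : {set 'I_K.+1}) y : #|D1| = n ->
    (y \in D1) = [exists x, y == nth ord0 (enum D1) (lval l1 x)].
  move=> c1; apply/idP/existsP => [yD|[x /eqP ->]]; last first.
    by rewrite -mem_enum mem_nth // -cardE c1 lval_lt.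
  have iy : (index y (enum D1) < n)%N by rewrite -c1 cardE index_mem mem_enum.
  have [x lx] := lval_surj l1 iy; exists x.
  by rewrite lx nth_index // mem_enum.
have DD : D = D'.
  apply/setP => y; rewrite (DE l) // (DE l' D') //; apply: eq_existsb => x; by rewrite xE.
subst D'; congr pair; apply: linext_eq => x; apply/eqP.
have := xE x; move/eqP; rewrite nth_uniq ?enum_uniq // -cardE cD lval_lt //.
Qed.

(** Only a lower bound for the volume is needed. Cells of side 1/K with strict indices lie in the
    polytope, and their total volume times n! tends to N as K grows. *)
Lemma volume_natural (R : realType) (k : nat) :
  ((k%:R)%:E = (n`!)%:R%:E * order_polytope_volume R P)%E -> (N <= k)%N.
Proof.
move=> kE.
have bound K : (N * K.+1 ^_ n <= k * K.+1 ^ n)%N.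
  have K0 : 0 < (K.+1%:R : R) by rewrite ltr0n.
  have h : ((#|@strict_index K.+1|%:R / K.+1%:R ^+ n)%:E <= order_polytope_volume R P)%E.
    apply: volume_ge_cells => ks v /forallP ksI vks.
    have cell_itv a : (tnth ks (enum_rank a))%:R / K.+1%:R < tnth v (enum_rank a) <
      (tnth ks (enum_rank a)).+1%:R / K.+1%:R by have := vks (enum_rank a); rewrite /= in_itv.
    split=> [a|a b].
      have /andP[h1 h2] := cell_itv a; apply/andP; split.
        by apply: le_trans (ltW h1); rewrite divr_ge0.
      by apply: (le_trans (ltW h2)); rewrite ler_pdivrMr // mul1r ler_nat.
    rewrite le_eqVlt => /orP[/eqP -> //|ab].
    have /forallP/(_ b)/implyP/(_ ab) lt := ksI a.
    have /andP[_ h1] := cell_itv a; have /andP[h2 _] := cell_itv b.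
    apply: ltW; apply: (lt_trans h1); apply: le_lt_trans h2.
    by rewrite ler_pM2r ?invr_gt0 // ler_nat.
  have {h} : ((n`!%:R * (#|@strict_index K.+1|%:R / K.+1%:R ^+ n))%:E <= k%:R%:E :> \bar R)%E.
    by rewrite kE EFinM lee_wpmul2l // lee_fin.
  rewrite lee_fin mulrA ler_pdivrMr ?exprn_gt0 // -natrX -!natrM ler_nat; apply: leq_trans.
  by rewrite -bin_ffact mulnA mulnC leq_mul2l card_strict_index orbT.
rewrite leqNgt; apply/negP => kN.
(* At K = N n^2 + 1 the error term N n^2 is smaller than K, so k < N becomes impossible. *)
have := bound (N * n ^ 2)%N; have := ffact_lower (N * n ^ 2).+1 n.
set K := (N * n ^ 2).+1; rewrite expnS.
have K0 : (0 < K ^ n)%N by rewrite expn_gt0.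
move: (K ^_ n) (K ^ n)%N K0 => q p p0 h1 h2.
have h3 : (N * (K * p) <= k * p * K + N * (n ^ 2 * p))%N.
  apply: (@leq_trans (N * (q * K + n ^ 2 * p))); first by rewrite leq_mul2l h1 orbT.
  by rewrite mulnDr leq_add2r mulnA leq_mul2r h2 orbT.
have : (N * K <= k * K + N * n ^ 2)%N.
  rewrite -(leq_pmul2r p0); apply: (leq_trans _ (leq_trans h3 _)).
    by rewrite mulnA leqnn.
  by rewrite mulnDl mulnAC !mulnA leqnn.
have : (k.+1 * K <= N * K)%N by rewrite leq_mul2r kN orbT.
by rewrite mulSn /K; move: (N * n ^ 2)%N (k * (N * n ^ 2).+1)%N => u w; lia.
Qed.

End VolumeCount.

(** * From the Wronski system to the Wronski map *)

Section Reduction.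
Context {R : realType} {d : Order.disp_t} {P : finPOrderType d}.
Local Notation n := #|P|.
Variables (alpha : {set P} -> R) (c : 'M[R]_(n, n.+1)).
Hypothesis alpha0 : forall J, upper_ideal J -> alpha J != 0.

Lemma meval_wronski (K : fieldType) (f : {rmorphism R -> K}) (t : {ffun P -> K}) i :
  meval (coords t) (map_mpoly f (wronski_system alpha c i)) =
  \sum_(j < n.+1) f (c i j) * theta alpha f t j.
Proof.
rewrite /wronski_system [map_mpoly f _]rmorph_sum [LHS]rmorph_sum /=.
rewrite (partition_big (fun J : {set P} => inord #|J| : 'I_n.+1) xpredT) //=.
apply: eq_bigr => j _; rewrite /theta mulr_sumr.
have e (J : {set P}) : ((inord #|J| : 'I_n.+1) == j) = (#|J| == j).
  by rewrite -(inj_eq val_inj) /= inordK // ltnS max_card.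
apply: eq_big => [J|J /andP[_ /eqP Jj]]; first by rewrite e.
rewrite map_mpolyZ mevalZ Jj rmorphM mulrA; congr (_ * _).
rewrite [map_mpoly f _]rmorph_prod [LHS]rmorph_prod; apply: eq_bigr => a _.
by rewrite /= map_mpolyX mevalXU /coords enum_rankK.
Qed.

Lemma theta0 (K : fieldType) (f : {rmorphism R -> K}) (t : P -> K) :
  theta alpha f t 0 = f (alpha finset.set0).
Proof.
rewrite /theta (big_pred1 finset.set0) ?big_set0 ?mulr1 // => J.
rewrite /= cards_eq0; case: eqP => [->|_]; rewrite ?andbF ?andbT //.
by apply/forallP => a; apply/forallP => b; rewrite inE.
Qed.

Lemma meval_sumM (K : fieldType) m k (p : 'I_m -> K) (h F : 'I_k -> mpoly m K) :
  meval p (\sum_i h i * F i) = \sum_i meval p (h i) * meval p (F i).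
Proof. by rewrite rmorph_sum; apply: eq_bigr => i _; rewrite /= mevalM. Qed.

Lemma meval_mderiv_sumM (K : fieldType) m k (p : 'I_m -> K) (h F : 'I_k -> mpoly m K) l :
  (forall i, meval p (F i) = 0) ->
  meval p (mderiv l (\sum_i h i * F i)) = \sum_i meval p (h i) * meval p (mderiv l (F i)).
Proof.
move=> F0; rewrite [mderiv _ _]raddf_sum [LHS]rmorph_sum; apply: eq_bigr => i _.
by rewrite /= mderivM mevalD !mevalM F0 mulr0 add0r.
Qed.

Definition jacobian (K : fieldType) m k (F : 'I_k -> mpoly m K) (p : 'I_m -> K) : 'M[K]_(k, m) :=
  \matrix_(i, l) meval p (mderiv l (F i)).

(** Multiplicity one puts each X_l - p_l in the local ideal: u (X_l - p_l) is a combination of the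
    F_i with u(p) nonzero. Differentiating at p expresses the unit vectors by the rows of the
    Jacobian. *)
Lemma simple_jacobian_full (K : fieldType) m k (F : 'I_k -> mpoly m K) (p : 'I_m -> K) :
  (forall i, meval p (F i) = 0) -> has_multiplicity F p 1 -> row_full (jacobian F p).
Proof.
move=> F0 [b bP].
have local0 g : in_local_ideal F p g -> meval p g = 0.
  move=> [u u0 [h hE]]; have := congr1 (meval p) hE.
  rewrite meval_sumM big1 => [/eqP|i _]; last by rewrite F0 mulr0.
  by rewrite mevalM mulf_eq0 (negbTE u0) => /eqP.
have sum1 (a : 'rV[K]_1) : \sum_(j < 1) a 0 j *: b j = a 0 0 *: b 0 by rewrite big_ord1.
have b0 : meval p (b 0) != 0.
  have [a [aP _]] := bP 1; have := local0 _ aP; rewrite sum1 mevalB mevalZ meval1.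
  by move=> h; apply: contra_eq_neq h => ->; rewrite mulr0 subr0 oner_neq0.
have X_local l : in_local_ideal F p (mpolyX K (mnm1 l) - mpolyC m (p l)).
  have [a [aP _]] := bP (mpolyX K (mnm1 l) - mpolyC m (p l)).
  have := local0 _ aP; rewrite sum1 !mevalB mevalXU mevalC subrr sub0r mevalZ => /eqP.
  rewrite oppr_eq0 mulf_eq0 (negbTE b0) orbF => /eqP a0.
  by move: aP; rewrite sum1 a0 scale0r subr0.
rewrite -sub1mx; apply/row_subP => l; have [u u0 [h hE]] := X_local l.
have -> : row l 1%:M = (meval p u)^-1 *: ((\row_i meval p (h i)) *m jacobian F p).
  apply/rowP => l'; rewrite !mxE.
  have := congr1 (fun q => meval p (mderiv l' q)) hE; rewrite (meval_mderiv_sumM _ _ F0).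
  rewrite mderivM mevalD !mevalM !mevalB mevalXU mevalC subrr mulr0 add0r.
  rewrite mderivB mderivC subr0 mderivX mevalZ mevalX => h1.
  rewrite (eq_bigr (fun i => meval p (h i) * meval p (mderiv l' (F i)))); last first.
    by move=> i _; rewrite !mxE.
  rewrite -h1 mulrA mulVf // mul1r mnm1E eq_sym; case: eqP => [<-|_] /=; last by rewrite mul0r.
  by rewrite big1 ?mulr1 // => i _; rewrite mnmBE subnn expr0.
by rewrite scalemx_sub // submxMl.
Qed.

(** A relation between the rows of c is one between the equations, hence between the rows of the
    square Jacobian, which has full rank. *)
Lemma wronski_row_free (t : {ffun P -> R[i]}) :
  torus_zeros (complexify (wronski_system alpha c)) t ->
  has_multiplicity (complexify (wronski_system alpha c)) (coords t) 1 -> row_free c.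
Proof.
move=> [_ tF] tm; have Jfull := simple_jacobian_full tF tm.
have Jfree : row_free (jacobian (complexify (wronski_system alpha c)) (coords t)).
  by move: Jfull; rewrite /row_full /row_free.
rewrite /row_free -(mxrank_map (real_complex R)) -/(row_free (map_mx (real_complex R) c)).
rewrite -kermx_eq0; apply/rowV0P => y /sub_kermxP yc.
apply: (row_free_inj Jfree); rewrite mul0mx; apply/rowP => l; rewrite !mxE.
have e : \sum_i y 0 i *: complexify (wronski_system alpha c) i = 0.
  rewrite /complexify /wronski_system.
  rewrite (eq_bigr (fun i => \sum_(J : {set P} | upper_ideal J)
     (y 0 i * real_complex R (c i (inord #|J|)) * real_complex R (alpha J)) *:
       map_mpoly (real_complex R) (\prod_(a in J) mpolyX R (mnm1 (enum_rank a))))); last first.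
    move=> i _; rewrite [map_mpoly _ _]rmorph_sum scaler_sumr; apply: eq_bigr => J _ /=.
    by rewrite map_mpolyZ scalerA rmorphM mulrA.
  rewrite exchange_big big1 // => J _; rewrite -scaler_suml -mulr_suml.
  have /rowP/(_ (inord #|J|)) := yc; rewrite !mxE => h.
  rewrite (_ : \sum_i _ = 0) ?mul0r ?scale0r // -[RHS]h.
  by apply: eq_bigr => i _; rewrite mxE.
have := congr1 (fun q => meval (coords t) (mderiv l q)) e.
rewrite mderiv0 meval0 [mderiv _ _]raddf_sum [X in X = _ -> _]rmorph_sum => h; rewrite -[RHS]h.
by apply: eq_bigr => i _; rewrite /= mxE mderivZ mevalZ.
Qed.

(** The vector (W_0, ..., W_n) must lie on the line which is the kernel of c, and W_0 is the nonzero
    constant weight of the empty ideal, which selects one point of that line. *)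
Lemma wronski_zeros : row_free c ->
  (exists t : {ffun P -> R[i]}, torus_zeros (complexify (wronski_system alpha c)) t) ->
  exists v : nat -> R, v 0%N = 0 /\
  forall (K : fieldType) (f : {rmorphism R -> K}) (t : {ffun P -> K}),
    torus_zeros (fun i => map_mpoly f (wronski_system alpha c i)) t <->
    (forall a, t a != 0) /\ forall j, (0 < j <= n)%N -> theta alpha f t j = f (v j).
Proof.
move=> cfree [t0 [t0a t0F]].
have rank_ker (K : fieldType) (f : {rmorphism R -> K}) : \rank (kermx (map_mx f c)^T) = 1%N.
  by rewrite mxrank_ker mxrank_tr mxrank_map (eqP cfree) subSnn.
pose W (K : fieldType) (f : {rmorphism R -> K}) (t : P -> K) : 'rV[K]_n.+1 :=
  \row_j theta alpha f t j.
have WP (K : fieldType) (f : {rmorphism R -> K}) (t : {ffun P -> K}) :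
    (forall i, meval (coords t) (map_mpoly f (wronski_system alpha c i)) = 0) <->
    (W K f t <= kermx (map_mx f c)^T)%MS.
  split=> [H|/sub_kermxP/rowP H i].
    apply/sub_kermxP/rowP => i; rewrite !mxE -[RHS](H i) meval_wronski.
    by apply: eq_bigr => j _; rewrite !mxE mulrC.
  rewrite meval_wronski; have := H i; rewrite !mxE => h; rewrite -[RHS]h.
  by apply: eq_bigr => j _; rewrite !mxE mulrC.
pose z : 'rV[R]_n.+1 := nz_row (kermx c^T).
have zker : (z <= kermx c^T)%MS by exact: nz_row_sub.
have z0 : z != 0.
  rewrite nz_row_eq0 -mxrank_eq0; have := rank_ker _ (idfun : {rmorphism R -> R}).
  by rewrite map_mx_id // => ->.
have zP (K : fieldType) (f : {rmorphism R -> K}) (w : 'rV[K]_n.+1) :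
    (w <= kermx (map_mx f c)^T)%MS -> exists a, w = a *: map_mx f z.
  have zf : (map_mx f z <= kermx (map_mx f c)^T)%MS.
    by rewrite map_trmx -map_kermx map_submx.
  have eq : (kermx (map_mx f c)^T <= map_mx f z)%MS.
    rewrite -(geq_leqif (mxrank_leqif_sup zf)) rank_ker rank_rV.
    by rewrite map_mx_eq0 z0.
  by move=> /submx_trans/(_ eq)/sub_rVP.
have a0 := alpha0 (J := finset.set0).
have aS0 : alpha finset.set0 != 0.
  by apply: a0; apply/forallP => a; apply/forallP => b; rewrite inE.
(* This is where an existing solution is used: its W_0 is a nonzero multiple of z_0. *)
have z00 : z 0 0 != 0.
  have [a aE] := zP _ (real_complex R) _ ((WP _ (real_complex R) t0).1 t0F).
  have := congr1 (fun w : 'rV_n.+1 => w 0 0) aE; rewrite !mxE theta0 => h.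
  apply: contra_neq aS0 => z00; apply: (fmorph_inj (real_complex R)).
  by rewrite h z00 rmorph0 mulr0.
pose v j : R := if (0 < j <= n)%N then alpha finset.set0 / z 0 0 * z 0 (inord j) else 0.
exists v; split=> // K f t; split.
  move=> [ta /WP/zP[a aE]]; split=> // j jn.
  have := congr1 (fun w : 'rV_n.+1 => w 0 0) aE; rewrite !mxE theta0 => h0.
  have := congr1 (fun w : 'rV_n.+1 => w 0 (inord j)) aE; rewrite !mxE inordK; last first.
    by rewrite ltnS; case/andP: jn.
  move=> ->; rewrite /v jn !rmorphM fmorphV h0 mulfK // fmorph_eq0 //.
move=> [ta tv]; split=> //; apply/WP.
suff -> : W K f t = f (alpha finset.set0 / z 0 0) *: map_mx f z.
  by rewrite scalemx_sub // map_trmx -map_kermx map_submx.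
apply/rowP => j; rewrite !mxE -rmorphM; have [j0|j0] := posnP j.
  rewrite j0 theta0 (_ : j = 0); last by apply: val_inj.
  by rewrite divfK.
have jn : (0 < j <= n)%N by rewrite j0 -ltnS ltn_ord.
by rewrite (tv _ jn) /v jn inord_val.
Qed.

End Reduction.

(** * The lower bound *)

Lemma counting_ge (R : realType) (T : choiceType) (A : set T) k (u : 'I_k -> T) :
  injective u -> (forall i, A (u i)) -> (k%:R%:E <= counting A :> \bar R)%E.
Proof.
move=> ui uA; rewrite /counting; case: asboolP => Af; last by rewrite leey.
rewrite lee_fin ler_nat -[k]card_ord cardE -(size_map u).
apply: uniq_leq_size; first by rewrite map_inj_uniq ?enum_uniq.
by move=> x /mapP[i _ ->]; rewrite in_fset_set //; apply/mem_set.
Qed.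

(** The upper bound on injective families gives finiteness, after which the count is a natural
    number and [lower] applies. *)
Lemma counting_enum (R : realType) (T : choiceType) (A : set T) N :
  (forall k (u : 'I_k -> T), injective u -> (forall i, A (u i)) -> (k <= N)%N) ->
  (forall k : nat, counting A = k%:R%:E :> \bar R -> (N <= k)%N) ->
  exists u : 'I_N -> T, [/\ injective u, forall i, A (u i) & forall x, A x -> exists i, u i = x].
Proof.
move=> bound lower.
have Af : finite_set A.
  apply: contrapT => /(@infinite_set_fset _ _ N.+1)[B BA BN].
  have : (size (finmap.enum_fset B) <= N)%N; last by rewrite leqNgt BN.
  apply: (bound _ (tnth (in_tuple (finmap.enum_fset B)))).
    by apply/tuple_uniqP; exact: finmap.fset_uniq.
  by move=> i; apply: BA; rewrite /=; exact: mem_tnth.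
have cA : counting A = (size (finmap.enum_fset (fset_set A)))%:R%:E :> \bar R by rewrite /counting asboolT.
have kN : size (finmap.enum_fset (fset_set A)) == N.
  rewrite eqn_leq (lower _ cA) andbT.
  apply: (bound _ (tnth (in_tuple (finmap.enum_fset (fset_set A))))).
    by apply/tuple_uniqP; exact: finmap.fset_uniq.
  by move=> i; apply: set_mem; rewrite -in_fset_set //; exact: mem_tnth.
pose t : N.-tuple T := Tuple kN.
exists (tnth t); split.
- by apply/tuple_uniqP; exact: finmap.fset_uniq.
- by move=> i; apply: set_mem; rewrite -in_fset_set //; exact: (mem_tnth i t).
move=> x Ax; have /tnthP[i xi] : x \in t by rewrite [x \in _]in_fset_set //; exact/mem_set.
by exists i.
Qed.

(** * The Gram matrix as a Hermitian form *)

Section Assembly.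
Context {R : realType} {d : Order.disp_t} {P : finPOrderType d}.
Local Notation n := #|P|.
Local Notation N := #|{: @linext d P}|.
Local Notation C := R[i].
Local Notation toC := (real_complex R).

(** The factorisation is bilinear and the form sesquilinear; conjugating a row of E turns it into
    row s k, which pairs coordinates of conjugate points. *)
Lemma hform_factor m (G : 'M[R]_m) (E : 'M[C]_m) (e : 'rV[C]_m) (s : 'I_m -> 'I_m) :
  map_mx toC G = E^T *m diag_mx e *m E ->
  (forall k j, Num.conj (E k j) = E (s k) j) ->
  forall x, hform G x = \sum_k e 0 k * ((x *m E^T) 0 k * Num.conj ((x *m E^T) 0 (s k))).
Proof.
move=> GE sE x; rewrite /hform.
have Gij i j : toC (G i j) = \sum_k E k i * e 0 k * E k j.
  have /matrixP/(_ i j) := GE; rewrite !mxE => ->; apply: eq_bigr => k _.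
  by rewrite mul_mx_diag !mxE.
have sI j k : Num.conj (E (s k) j) = E k j by rewrite -sE conjCK.
transitivity (\sum_k \sum_i \sum_j e 0 k * (x 0 i * E k i * (Num.conj (x 0 j) * E k j))).
  rewrite [RHS]exchange_big; apply: eq_bigr => i _.
  rewrite [RHS]exchange_big; apply: eq_bigr => j _ /=.
  by rewrite Gij mulr_sumr mulr_suml; apply: eq_bigr => k _; ring.
apply: eq_bigr => k _; rewrite [(x *m E^T) 0 k]mxE [(x *m E^T) 0 (s k)]mxE.
rewrite rmorph_sum mulr_suml mulr_sumr; apply: eq_bigr => i _.
rewrite mulr_sumr mulr_sumr; apply: eq_bigr => j _.
by rewrite !mxE rmorphM /= sI.
Qed.

(** Scaling v by x is a congruence up to a positive factor. Entries of positive degree shrink with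
    x, those of degree 0 stay fixed, and those of negative degree are zero. *)
Lemma gram_degenerates (l0 : @linext d P) (S : pred P) rho v :
  (forall a b, covered a b -> S a = ~~ S b) -> (forall a, (forall b, ~~ (b < a)%O) -> S a) ->
  (forall m, wpart n (anti_label l0) m -> graded (mdeg m) (mdeg (lval l0)) (rho m)) ->
  v 0%N = 0 ->
  degenerates_to (gram S rho (fun=> 0)) (gram S rho v : 'M[R]_N).
Proof.
move=> Sc Sm rg v0 eta eta0.
pose B : R := 1 + \sum_i \sum_j `|gram S rho v i j|.
have B1 : 1 <= B by rewrite lerDl sumr_ge0 // => i _; rewrite sumr_ge0.
have Bij i j : `|gram S rho v i j| <= B.
  apply: (@le_trans _ _ (\sum_j' `|gram S rho v i j'|)).
    by rewrite [leRHS](bigD1 j) //= lerDl sumr_ge0.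
  apply: (@le_trans _ _ (\sum_i' \sum_j' `|gram S rho v i' j'|)); last by rewrite /B lerDr.
  by rewrite [leRHS](bigD1 i) //= lerDl sumr_ge0 // => k _; rewrite sumr_ge0.
(* Ensures x <= 1 together with x B <= eta, where B bounds the entries. *)
pose x : R := eta / (B + eta).
have Be : 0 < B + eta by lra.
have x0 : 0 < x by rewrite divr_gt0.
have x1 : x <= 1 by rewrite ler_pdivrMr // mul1r; lra.
have xB : x * B <= eta.
  by rewrite /x mulrAC ler_pdivrMr // ler_pM2l //; lra.
pose Delta : 'M[C]_N := diag_mx (\row_i toC (x ^+ gdeg S i)).
exists (gram S rho (fun k => x ^+ k * v k)), Delta, (toC (x ^+ gshift l0 S)).
split.
- exact: gram_sym.
- move=> i j; have := gram_graded (l0 := l0) Sc Sm rg i j; rewrite /graded; case: leqP => h H.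
    have /= -> := H x v; have := H 0 v; rewrite /= (scale0 v0) => ->.
    case: (_ - _)%N => [|k]; first by rewrite !expr0 subrr normr0 ltW.
    rewrite [0 ^+ _]exprS !mul0r subr0 normrM ger0_norm ?exprn_ge0 ?(ltW x0) //.
    apply: (le_trans _ xB); apply: ler_pM => //; first by rewrite exprn_ge0 // ltW.
    by rewrite exprS ler_piMr ?exprn_ile1 ?(ltW x0).
  have /= -> := H (fun=> 0); have /= -> := H (fun k => x ^+ k * v k).
  by rewrite subrr normr0 ltW.
- rewrite unitmxE det_diag unitfE; apply/prodf_neq0 => i _.
  by rewrite mxE fmorph_eq0 expf_neq0 // gt_eqF.
- by rewrite ltcR exprn_gt0.
move=> y; rewrite /hform mulr_sumr; apply: eq_bigr => i _.
rewrite mulr_sumr; apply: eq_bigr => j _.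
have e : toC (x ^+ gshift l0 S) * toC (gram S rho (fun k => x ^+ k * v k) i j) =
    toC (x ^+ gdeg S i) * toC (gram S rho v i j) * toC (x ^+ gdeg S j).
  by rewrite -!rmorphM; congr (toC _); exact: (gram_scale (l0 := l0)).
have rC (r : R) : Num.conj (toC r) = toC r.
  by have /CrealP : toC r \is Num.real by apply/complex_realP; exists r.
have yD k : (y *m Delta) 0 k = y 0 k * toC (x ^+ gdeg S k) by rewrite mul_mx_diag !mxE.
rewrite !yD rmorphM /= rC.
move: e; move: (toC (gram S rho _ i j)) (toC (gram S rho v i j)) (toC (x ^+ gdeg S i))
  (toC (x ^+ gdeg S j)) (toC (x ^+ gshift l0 S)) (Num.conj (y 0 j)) (y 0 i).
move=> g1 g2 z1 z2 z3 y1 y2 e; transitivity (y2 * (z3 * g1) * y1); first by ring.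
by rewrite e; ring.
Qed.

End Assembly.

(** * Real solutions and the sign-imbalance *)

Section Main.
Context {R : realType} {d : Order.disp_t} {P : finPOrderType d}.
Local Notation n := #|P|.
Local Notation N := #|{: @linext d P}|.
Local Notation C := R[i].
Local Notation toC := (real_complex R).

Lemma extension_sign_uniq (l0 l : @linext d P) (s : 'S_n) b :
  (forall a, s (val l0 a) = val l a) -> extension_sign (val l0) (val l) b = (odd_perm s == b).
Proof.
move=> sE; apply/existsP/idP => [[s' /andP[/forallP s'E /eqP <-]]|/eqP <-].
  suff -> : s' = s by [].
  apply/permP => i; have [a la] := lval_surj l0 (ltn_ord i).
  have -> : i = val l0 a by apply: val_inj.
  by rewrite (eqP (s'E a)) sE.
by exists s; rewrite eqxx andbT; apply/forallP => a; rewrite sE.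
Qed.

Lemma signed_count (l0 : @linext d P) (sg : 'I_N -> bool) b :
  (forall i, exists s : 'S_n, (forall a, s (val l0 a) = val (enum_val i : @linext d P) a) /\
     odd_perm s = sg i) ->
  signed_extensions (val l0) b = #|[pred i | sg i == b]|.
Proof.
move=> sgP; pose u (i : 'I_N) := val (enum_val i : @linext d P).
have ui : injective u by move=> i j /val_inj/enum_val_inj.
rewrite /signed_extensions -(fintype.card_image ui); apply: eq_card => l.
apply/andP/fintype.imageP => [[ll ls]|[i iA ->]]; last first.
  split; first exact: valP.
  have [s [sE sb]] := sgP i; move: iA; rewrite inE => /eqP ib.
  by rewrite (extension_sign_uniq b sE) sb ib.
pose l' : @linext d P := exist (fun l => is_true (linear_extension l)) l ll.
exists (enum_rank l'); last by rewrite /u enum_rankK.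
have [s [sE sb]] := sgP (enum_rank l').
by rewrite inE -sb -(extension_sign_uniq b sE) enum_rankK.
Qed.

Lemma theta_conj (alpha : {set P} -> R) (t : P -> C) j :
  theta alpha toC (fun a => Num.conj (t a)) j = Num.conj (theta alpha toC t j).
Proof.
rewrite /theta rmorph_sum; apply: eq_bigr => J _; rewrite rmorphM rmorph_prod /=.
by congr (_ * _); have /CrealP : toC (alpha J) \is Num.real by apply/complex_realP; exists (alpha J).
Qed.

(** [inertia_bound] is applied to the Gram matrices at the widely spaced value and at v. The first
    has diagonal coefficients with the signs of the linear extensions; in the second, conjugation
    permutes the coordinates by s. *)
Lemma real_points_bound (alpha : {set P} -> R) (v : nat -> R) (t : 'I_N -> P -> C) (s : 'I_N -> 'I_N) :
  (0 < n)%N -> ranked_mod2 P -> is_weight alpha -> v 0%N = 0 ->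
  (forall i a, t i a != 0) -> injective t ->
  (forall i j, (0 < j <= n)%N -> theta alpha toC (t i) j = toC (v j)) ->
  (forall i a, t (s i) a = Num.conj (t i a)) ->
  (sign_imbalance P <= #|[pred i | s i == i]|)%N.
Proof.
move=> n0 Pr aw v0 t0 ti tv ts; have [alpha0 _] := aw.
pose l0 : @linext d P :=
  exist (fun l => is_true (linear_extension l)) _ (xchooseP (@linear_extension_exists _ P)).
pose S : pred P := fun a => odd (height a).
have Sc : forall a b, covered a b -> S a = ~~ S b by move=> a b; exact: height_cover.
have Sm : forall a, (forall b, ~~ (b < a)%O) -> S a by move=> a; exact: height_min.
have [rho [rho_graded rhoE]] := residue_exists alpha0 l0.
have [v1 [v10 [t1 [t1_gt0 t1i t1v t1c]]]] := degenerate_point aw rho_graded.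
have t10 i a : t1 i a != 0 by rewrite gt_eqF.
have [c1 c1n c1E] := rhoE R idfun v1 t1 t10 t1i t1v.
have [c cn cE] := rhoE C toC v t t0 ti tv.
have sgn1 := t1c c1 c1n c1E.
pose G := gram S rho.
pose h1 i := monom (t1 i) (nonalt S).
have h1_gt0 i : 0 < h1 i by apply: prodr_gt0 => x _; rewrite exprn_gt0.
pose D i := c1 i / h1 i.
have [sg sgP] : exists sg : 'I_N -> bool, forall i,
    (exists s : 'S_n, (forall a, s (val l0 a) = val (enum_val i : @linext d P) a) /\
      odd_perm s = sg i) /\ 0 < (-1) ^+ sg i * D i.
  have /choice[f fP] := sgn1; exists (fun i => odd_perm (f i)) => i.
  have [f1 f2] := fP i; split; first by exists (f i).
  by rewrite mulrA divr_gt0.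
have D0 i : D i != 0.
  have [_ h] := sgP i; apply: contraTneq h => ->; by rewrite mulr0 ltxx.
have Wi := @alt_label_inj _ _ S; have Wb := alt_label_bound S.
pose E1 := deltamx (alt_label S) t1; pose E2 := deltamx (alt_label S) t.
have G1f := gram_factor (S := S) Sc Sm (f := idfun) (v := v1) t10 c1E.
have G2f := gram_factor (S := S) Sc Sm (f := toC) (v := v) t0 cE.
rewrite map_mx_id // in G1f.
have detG0 : \det (G (fun=> 0)) != 0.
  rewrite -(gram_det Sc Sm rho_graded n0 v10) G1f !det_mulmx det_tr.
  have E1free : row_free E1 := deltamx_free alpha0 Wi Wb t10 t1i t1v.
  rewrite row_free_unit unitmxE unitfE in E1free.
  rewrite !mulf_neq0 // det_diag; apply/prodf_neq0 => i _; rewrite mxE; exact: D0.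
have G1f' : map_mx toC (G v1) = (map_mx toC E1)^T *m
    diag_mx (\row_k toC (D k)) *m (map_mx toC E1).
  rewrite [G v1]G1f !map_mxM map_trmx map_diag_mx; congr (_ *m diag_mx _ *m _).
  by apply/rowP => k; rewrite !mxE.
have rC (r : R) : Num.conj (toC r) = toC r.
  by have /CrealP : toC r \is Num.real by apply/complex_realP; exists r.
have G1E x : hform (G v1) x = \sum_k toC (D k) * `|(x *m (map_mx toC E1)^T) 0 k| ^+ 2.
  rewrite (hform_factor (s := id) G1f'); last by move=> k j; rewrite mxE rC.
  by apply: eq_bigr => k _; rewrite mxE normCK.
have sI : involutive s.
  by move=> i; apply: ti; apply/funext => a; rewrite !ts conjCK.
have G2E := hform_factor (s := s) G2f.
have E2s k j : Num.conj (E2 k j) = E2 (s k) j.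
  rewrite !mxE /monom rmorph_prod; apply: eq_bigr => a _ /=.
  by rewrite rmorphXn ts.
have [b1 b2] := inertia_bound (gram_sym S rho (fun=> 0)) detG0
  (gram_degenerates Sc Sm rho_graded v10) (gram_degenerates Sc Sm rho_graded v0) D0 G1E sI
  (G2E E2s).
have signP b : signed_extensions (val l0) b = #|[pred i | sg i == b]|.
  by apply: signed_count => i; have [] := sgP i.
have Dsg i : (0 < D i) = ~~ sg i.
  have [_] := sgP i; case: (sg i) => /=; first by rewrite mulN1r oppr_gt0 => /ltW; case: ltP.
  by rewrite mul1r.
have p1 : #|[pred k | (0 < D k)%R]| = signed_extensions (val l0) false.
  by rewrite signP; apply: eq_card => i; rewrite !inE Dsg eqbF_neg.
have p2 : #|[pred k | (D k < 0)%R]| = signed_extensions (val l0) true.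
  rewrite signP; apply: eq_card => i; rewrite !inE eqb_id ltNge le_eqVlt eq_sym (negbTE (D0 i)) /=.
  by rewrite Dsg negbK.
rewrite /sign_imbalance /sign_imbalance_wrt -[xchoose _]/(val l0).
move: b1 b2; rewrite p1 p2; move: (signed_extensions _ false) (signed_extensions _ true) #|[pred i | s i == i]| => p q r.
by clear; lia.
Qed.

End Main.

Lemma sign_imbalance_empty (d : Order.disp_t) (P : finPOrderType d) :
  #|P| = 0%N -> (sign_imbalance P <= 1)%N.
Proof.
move=> n0; rewrite /sign_imbalance /sign_imbalance_wrt.
have le1 l b : (signed_extensions (P := P) l b <= 1)%N.
  apply: (leq_trans (max_card _)).
  by rewrite card_ffun card_ord n0 expn0.
have := le1 (xchoose (linear_extension_exists P)) false.
have := le1 (xchoose (linear_extension_exists P)) true.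
move: (signed_extensions _ false) (signed_extensions _ true) => p q.
by clear; lia.
Qed.

Lemma map_mpoly_idfun (R : nzRingType) m (p : mpoly m R) : map_mpoly idfun p = p.
Proof. by apply/mpolyP => k; rewrite mcoeff_map_mpoly. Qed.

Theorem theorem4p3 (R : realType) (d : Order.disp_t) (P : finPOrderType d)
    (alpha : {set P} -> R) (c : 'M[R]_(#|P|, #|P|.+1))
    (P_ranked : ranked_mod2 P)
    (alpha_weight : is_weight alpha)
    (generic_count :
      counting (torus_zeros (complexify (wronski_system alpha c)))
        = ((#|P|)`!%:R%:E * order_polytope_volume R P)%E)
    (generic_simple : forall t : {ffun P -> R[i]},
      torus_zeros (complexify (wronski_system alpha c)) t ->
      has_multiplicity (complexify (wronski_system alpha c)) (coords t) 1) :
  ((sign_imbalance P)%:R%:E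
     <= counting (torus_zeros (wronski_system alpha c)) :> \bar R)%E.
Proof.
(* The degree count needs a first element of P. For empty P there are no equations and the empty
   function is a solution. *)
have [n0|n0] := posnP #|P|.
  apply: (@le_trans _ _ (1%:R%:E : \bar R)); first by rewrite lee_fin ler_nat sign_imbalance_empty.
  apply: (@counting_ge _ _ _ 1 (fun=> [ffun=> 1])) => [i j _|_]; first by rewrite !ord1.
  split=> [a|i]; first by have := max_card (pred1 a); rewrite n0 card1.
  by have := ltn_ord i; rewrite {2}n0.
have [alpha0 _] := alpha_weight.
have [l0 l0P] := linear_extension_exists P.
have N0 : (0 < #|{: @linext d P}|)%N.
  by apply/card_gt0P; exists (exist (fun l => is_true (linear_extension l)) l0 l0P).
(* With no solution the count would be 0, below the number of linear extensions. *)
have [t0 t0Z] : exists t, torus_zeros (complexify (wronski_system alpha c)) t.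
  apply: contrapT => H; suff : (#|{: @linext d P}| <= 0)%N by rewrite leqNgt N0.
  apply: (@volume_natural _ _ R); rewrite -generic_count.
  have -> : torus_zeros (complexify (wronski_system alpha c)) = classical_sets.set0.
    by apply/classical_sets.seteqP; split=> // t tZ; apply: H; exists t.
  rewrite /counting asboolT; last exact: finite_set0.
  by rewrite fset_set0.
have cfree := wronski_row_free t0Z (generic_simple _ t0Z).
have [v [v0 vP]] := wronski_zeros alpha0 cfree (ex_intro _ t0 t0Z).
have vC := vP _ (real_complex R).
have [t [ti tZ tZ']] : exists t : 'I_#|{: @linext d P}| -> {ffun P -> R[i]}, [/\ injective t,
    forall i, torus_zeros (complexify (wronski_system alpha c)) (t i) &
    forall x, torus_zeros (complexify (wronski_system alpha c)) x -> exists i, t i = x].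
  apply: (@counting_enum R) => [k u ui uZ|k kE]; last first.
    by apply: (@volume_natural _ _ R); rewrite -generic_count.
  apply: (torus_points_bound alpha0 (@anti_label_inj _ _ (exist (fun l => is_true (linear_extension l)) l0 l0P))
    (anti_label_bound _) (f := real_complex R) (v := v) (t := fun i a => u i a)).
  - by move=> i a; have [H _] := (vC _).1 (uZ i); exact: H.
  - by move=> i j e; apply: ui; apply/ffunP => a; exact: (congr1 (fun g => g a) e).
  - move=> i j jn; have [_ H] := (vC _).1 (uZ i); exact: H.
have tconj i : torus_zeros (complexify (wronski_system alpha c)) [ffun a => Num.conj (t i a)].
  apply/vC; have [H1 H2] := (vC _).1 (tZ i); split=> [a|j jn].
    by rewrite ffunE conjC_eq0.
  rewrite (_ : theta _ _ _ _ = theta alpha (real_complex R) (fun a => Num.conj (t i a)) j).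
    rewrite theta_conj H2 //; apply/CrealP; apply/complex_realP; by exists (v j).
  by congr theta; apply/funext => a; rewrite ffunE.
have [s sE] := choice (fun i => tZ' _ (tconj i)).
have bound := @real_points_bound R _ P alpha v (fun i a => t i a) s n0 P_ranked alpha_weight v0.
have {}bound : (sign_imbalance P <= #|[pred i | s i == i]|)%N.
  apply: bound.
  - by move=> i a; have [H _] := (vC _).1 (tZ i); exact: H.
  - by move=> i j e; apply: ti; apply/ffunP => a; exact: (congr1 (fun g => g a) e).
  - by move=> i j jn; have [_ H] := (vC _).1 (tZ i); exact: H.
  - by move=> i a; rewrite sE ffunE.
apply: (@le_trans _ _ ((#|[pred i | s i == i]|)%:R%:E : \bar R)); first by rewrite lee_fin ler_nat.
(* Solutions fixed by conjugation have real coordinates, so taking real parts loses nothing and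
   stays injective. *)
pose w (k : 'I_#|[pred i | s i == i]|) : {ffun P -> R} := [ffun a => complex.Re (t (enum_val k) a)].
have wE k a : real_complex R (w k a) = t (enum_val k) a.
  rewrite ffunE; apply: RRe_real; apply/CrealP.
  have /eqP sk : s (enum_val k) == enum_val k by have := enum_valP k; rewrite inE.
  by have := congr1 (fun g : {ffun P -> R[i]} => g a) (sE (enum_val k)); rewrite sk ffunE => <-.
apply: (@counting_ge _ _ _ _ w) => [k k' e|k].
  apply: enum_val_inj; apply: ti; apply/ffunP => a.
  by rewrite -!wE e.
have -> : wronski_system alpha c = (fun i => map_mpoly idfun (wronski_system alpha c i)).
  by apply/funext => i; rewrite map_mpoly_idfun.
apply/(vP _ idfun); have [H1 H2] := (vC _).1 (tZ (enum_val k)); split=> [a|j jn].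
  by apply: contra_neq (H1 a) => wa; rewrite -wE wa rmorph0.
apply: (fmorph_inj (real_complex R)); rewrite -H2 //.
rewrite /theta rmorph_sum; apply: eq_bigr => J _; rewrite rmorphM rmorph_prod; congr (_ * _).
by apply: eq_bigr => a _; rewrite -wE.
Qed.
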